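(* Let $n,m\ge 1$ and let $f\in H^{\otimes n}$, $g\in H^{\otimes m}$ be symmetric. Denote by $\Lambda$ the Malliavin matrix of the vector $(F,G)=(I_n(f),I_m(g))$. Then $$E\det\Lambda=\sum_{r=0}^{(n-1)\wedge(m-1)} mn\,m!\,n!\,C_{n-1}^{r}C_{m-1}^{r}\left[\Vert f\otimes_r g\Vert^2-\Vert f\otimes_{r+1}g\Vert^2\right]+R_{n,m},$$ where $R_{n,m}=\sum_{k=1}^{(n-1)\wedge(m-1)}T_k$ with $T_k$ defined in the context. Moreover $R_{n,m}\ge 0$ for every $n,m\ge 1$.
   Context: $H$ is a real separable Hilbert space with a fixed complete orthonormal system $(e_j)_{j\ge1}$, and $(W(h),h\in H)$ is an isonormal process on a probability space $(\Omega,\mathcal F,P)$, i.e. a centered Gaussian family with $E[W(h)W(g)]=\langle h,g\rangle_H$; $\mathcal F$ is generated by $W$. $I_n$ denotes the multiple Wiener-Itô integral of order $n$ with respect to $W$: on symmetric elements it is the linear map with $I_n(h^{\otimes n})=H_n(W(h))$ for $\Vert h\Vert=1$ ($H_n$ the monic Hermite polynomial of degree $n$), and it satisfies $E[I_n(f)^2]=n!\Vert f\Vert^2_{H^{\otimes n}}$ for symmetric $f$. $D$ is the Malliavin derivative with respect to $W$. The Malliavin matrix of $(F,G)$ is the random matrix $\Lambda=\begin{pmatrix}\Vert DF\Vert_H^2&\langle DF,DG\rangle_H\\ \langle DF,DG\rangle_H&\Vert DG\Vert_H^2\end{pmatrix}$. $\langle\cdot,\cdot\rangle$, $\Vert\cdot\Vert$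 denote scalar product and norm in $H^{\otimes k}$ for any $k$ (with $H^{\otimes 0}=\mathbb R$), $C_a^b=\binom{a}{b}$, and $a\wedge b=\min(a,b)$. For symmetric $f=\sum_{j_1,\dots,j_n\ge1}\lambda_{j_1,\dots,j_n}e_{j_1}\otimes\cdots\otimes e_{j_n}$ and $g=\sum_{k_1,\dots,k_m\ge1}\beta_{k_1,\dots,k_m}e_{k_1}\otimes\cdots\otimes e_{k_m}$, the contraction of order $r$, $0\le r\le m\wedge n$, is $$f\otimes_r g=\sum_{i_1,\dots,i_r}\sum_{j_1,\dots,j_{n-r}}\sum_{k_1,\dots,k_{m-r}}\lambda_{i_1,\dots,i_r,j_1,\dots,j_{n-r}}\beta_{i_1,\dots,i_r,k_1,\dots,k_{m-r}}\,(e_{j_1}\otimes\cdots\otimes e_{j_{n-r}})\otimes(e_{k_1}\otimes\cdots\otimes e_{k_{m-r}})\in H^{\otimes(m+n-2r)},$$ with $f\otimes_0 g=f\otimes g$; $f\tilde\otimes_r g$ is its symmetrization. For $i\ge1$ put $s_{i,f}=n\sum_{j_2,\dots,j_n\ge1}\lambda_{i,j_2,\dots,j_n}e_{j_2}\otimes\cdots\otimes e_{j_n}\in H^{\otimes(n-1)}$ and $s_{i,g}=m\sum_{k_2,\dots,k_m\ge1}\beta_{i,k_2,\dots,k_m}e_{k_2}\otimes\cdots\otimes e_{k_m}\in H^{\otimes(m-1)}$. For $k=0,\dots,(m-1)\wedge(n-1)$, $$T_k=\frac12\sum_{i,l\ge1}k!^2\,(C_{m-1}^k)^2(C_{n-1}^k)^2(m+n-2-2k)!\,\Vert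 s_{i,f}\tilde\otimes_k s_{l,g}-s_{l,f}\tilde\otimes_k s_{i,g}\Vert^2.$$ An empty sum is $0$. *)

(* Defs.v *)
From HB Require Import structures.
From mathcomp Require Import all_boot all_order all_algebra all_fingroup.
From mathcomp Require Import all_classical all_reals all_analysis.

Set Implicit Arguments.
Unset Strict Implicit.
Unset Printing Implicit Defensive.

Import Order.TTheory GRing.Theory Num.Theory.
Import numFieldNormedType.Exports.

Local Open Scope classical_set_scope.
Local Open Scope ring_scope.

(* A real Hilbert space is a complete normed module whose norm comes from an
   inner product [ip]; positive definiteness follows from the last clause. *)
Definition inner_product (R : realType) (H : completeNormedModType R)
    (ip : H -> H -> R) : Prop :=
  [/\ forall x y, ip x y = ip y x,
      forall a x y z, ip (a *: x + y) z = a * ip x z + ip y z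
    & forall x, ip x x = `|x| ^+ 2].

(* The indices j >= 1 of the orthonormal system are shifted to start at 0. *)
Definition complete_orthonormal_system (R : realType)
    (H : completeNormedModType R) (ip : H -> H -> R) (e : nat -> H) : Prop :=
  (forall i j, ip (e i) (e j) = (i == j)%:R) /\
  (forall x, (forall j, ip x (e j) = 0) -> x = 0).

(** ** Tensors *)

(* Arrays of coefficients in the basis e_{j_1} (x) ... (x) e_{j_n} of the n-th
   tensor power of H; the elements of the tensor power are the square summable
   arrays. For n = 0 there is one index, [::], and the tensor power is R. *)
Definition tensor (R : realType) (n : nat) : Type := n.-tuple nat -> R.

(* Reads a sequence as an n-tuple; only used on sequences of size n, for which
   the underlying sequence is unchanged. *)
Definition as_tuple (n : nat) (s : seq nat) : n.-tuple nat :=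
  [tuple nth 0%N s i | i < n].

Definition permute_index (n : nat) (s : 'S_n) (t : n.-tuple nat) :
    n.-tuple nat :=
  [tuple tnth t (s i) | i < n].

Definition square_summable (R : realType) (n : nat) (f : tensor R n) : Prop :=
  (\esum_(t in [set: n.-tuple nat]) ((f t) ^+ 2)%:E < +oo)%E.

Definition symmetric_tensor (R : realType) (n : nat) (f : tensor R n) : Prop :=
  square_summable f /\ forall (s : 'S_n) t, f (permute_index s t) = f t.

Definition sqnorm (R : realType) (n : nat) (f : tensor R n) : R :=
  fine (\esum_(t in [set: n.-tuple nat]) ((f t) ^+ 2)%:E).

(* Sum of an absolutely summable real family. *)
Definition usum (R : realType) (J : choiceType) (a : J -> R) : R :=
  fine (\esum_(i in [set: J]) (Num.max (a i) 0)%:E) -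
  fine (\esum_(i in [set: J]) (Num.max (- a i) 0)%:E).

Definition tensor_power (R : realType) (H : completeNormedModType R)
    (ip : H -> H -> R) (e : nat -> H) (n : nat) (h : H) : tensor R n :=
  fun t => \prod_(i < n) ip h (e (tnth t i)).
Arguments tensor_power {R H} ip e {n} h t.

(* For r <= min n m, so that the order n - r + (m - r) is n + m - 2 r. *)
Definition tensor_contraction (R : realType) (n m r : nat)
    (f : tensor R n) (g : tensor R m) : tensor R (n - r + (m - r)) :=
  fun t => usum (fun i : r.-tuple nat =>
    f (as_tuple n (i ++ take (n - r) t)) *
    g (as_tuple m (i ++ drop (n - r) t))).
Arguments tensor_contraction {R n m} r f g t.

Definition symmetrization (R : realType) (n : nat) (f : tensor R n) :
    tensor R n :=
  fun t => (n`!%:R)^-1 * \sum_(s : 'S_n) f (permute_index s t).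
Arguments symmetrization {R n} f t.

(* The tensor s_{i,f}. *)
Definition slice (R : realType) (n : nat) (i : nat) (f : tensor R n) :
    tensor R n.-1 :=
  fun t => n%:R * f (as_tuple n (i :: t)).
Arguments slice {R n} i f t.

Definition T_ (R : realType) (n m : nat) (f : tensor R n) (g : tensor R m)
    (k : nat) : \bar R :=
  ((2%:R^-1)%:E *
   \esum_(p in [set: nat * nat])
     ((k`! ^ 2)%:R * 'C(m.-1, k)%:R ^+ 2 * 'C(n.-1, k)%:R ^+ 2 *
      (m + n - 2 - 2 * k)`!%:R *
      sqnorm (fun t : (n.-1 - k + (m.-1 - k)).-tuple nat =>
        symmetrization (tensor_contraction k (slice p.1 f) (slice p.2 g)) t -
        symmetrization (tensor_contraction k (slice p.2 f) (slice p.1 g)) t))%:E)%E.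

Definition remainder (R : realType) (n m : nat)
    (f : tensor R n) (g : tensor R m) : \bar R :=
  (\sum_(1 <= k < (minn n.-1 m.-1).+1) T_ f g k)%E.

(** ** Isonormal Gaussian processes *)

(* The Dirac mass at 0 is listed apart because [normal_prob 0 0] is not it. *)
Definition centered_gaussian (d : measure_display) (T : measurableType d)
    (R : realType) (P : probability T R) (X : T -> R) : Prop :=
  X = cst 0 %[ae P] \/
  exists2 s : R, 0 < s &
    forall A, measurable A -> P (X @^-1` A) = normal_prob 0 s A.

Definition isonormal (d : measure_display) (T : measurableType d)
    (R : realType) (P : probability T R) (H : completeNormedModType R)
    (ip : H -> H -> R) (W : H -> {RV P >-> R}) : Prop :=
  (forall (k : nat) (a : 'I_k -> R) (h : 'I_k -> H),
     centered_gaussian P (fun w => \sum_(i < k) a i * W (h i) w)) /\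
  (forall h g, 'E_P[fun w => (W h w * W g w)%R] = (ip h g)%:E)%E.

Definition generated_by (d : measure_display) (T : measurableType d)
    (R : realType) (P : probability T R) (H : completeNormedModType R)
    (W : H -> {RV P >-> R}) : Prop :=
  (@measurable d T) =
  <<s [set A | exists h B, measurable B /\ A = W h @^-1` B] >>.

Definition hermite (R : realType) (n : nat) : {poly R} :=
  iter n (fun p => 'X * p - p^`()) 1.

(* Linearity, normalization and isometry determine [I] on symmetric tensors,
   up to null sets; its values elsewhere are irrelevant. *)
Definition multiple_integral (d : measure_display) (T : measurableType d)
    (R : realType) (P : probability T R) (H : completeNormedModType R)
    (ip : H -> H -> R) (e : nat -> H) (W : H -> {RV P >-> R})
    (n : nat) (I : tensor R n -> {RV P >-> R}) : Prop :=
  [/\ forall (a : R) (f g : tensor R n),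
        symmetric_tensor f -> symmetric_tensor g ->
        I (fun t => a * f t + g t) = (fun w => a * I f w + I g w) %[ae P],
      forall h : H, `|h| = 1 ->
        I (tensor_power ip e h) = (fun w => (hermite R n).[W h w]) %[ae P]
    & forall f : tensor R n, symmetric_tensor f ->
        ('E_P[fun w => ((I f w) ^+ 2)%R] = (n`!%:R * sqnorm f)%:E)%E].

(** ** Malliavin derivative *)

Definition iter_partial (R : realType) (k : nat) (s : seq 'I_k)
    (phi : 'rV[R]_k -> R) : 'rV[R]_k -> R :=
  foldr (fun i psi x => 'D_(delta_mx 0 i) psi x) phi s.

(* Infinitely differentiable, with all partial derivatives of all orders
   (including 0) of polynomial growth. *)
Definition smooth_poly_growth (R : realType) (k : nat)
    (phi : 'rV[R]_k -> R) : Prop :=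
  forall s : seq 'I_k,
    (forall x, differentiable (iter_partial s phi) x) /\
    exists (C : R) (p : nat),
      forall x, `|iter_partial s phi x| <= C * (1 + `|x|) ^+ p.

Definition smooth_cylindrical (d : measure_display) (T : measurableType d)
    (R : realType) (P : probability T R) (H : completeNormedModType R)
    (W : H -> {RV P >-> R}) (F : T -> R) (DF : T -> H) : Prop :=
  exists (k : nat) (phi : 'rV[R]_k -> R) (h : 'I_k -> H),
    [/\ smooth_poly_growth phi,
        F = (fun w => phi (\row_i W (h i) w))
      & DF = (fun w => \sum_(i < k)
                 ('D_(delta_mx 0 i) phi (\row_j W (h j) w)) *: h i)].

(* [F] is in the domain of the closure, from L^2(P) to L^2(P; H), of the
   derivative of smooth cylindrical variables, with value [u]. Measurability
   in H is meant weakly, which is the same as strongly for separable H. *)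
Definition is_malliavin_derivative (d : measure_display)
    (T : measurableType d) (R : realType) (P : probability T R)
    (H : completeNormedModType R) (ip : H -> H -> R)
    (W : H -> {RV P >-> R}) (F : {RV P >-> R}) (u : T -> H) : Prop :=
  (forall h, measurable_fun [set: T] (fun w => ip (u w) h)) /\
  exists (Fs : nat -> T -> R) (us : nat -> T -> H),
    [/\ forall j, smooth_cylindrical W (Fs j) (us j),
        (fun j => 'E_P[fun w => ((Fs j w - F w) ^+ 2)%R])%E @ \oo --> 0%E
      & (fun j => 'E_P[fun w => (`|us j w - u w| ^+ 2)%R])%E @ \oo --> 0%E].

(* A version of DF for F in the domain of D; 0 outside of the domain. *)
Definition malliavin_derivative (d : measure_display)
    (T : measurableType d) (R : realType) (P : probability T R)
    (H : completeNormedModType R) (ip : H -> H -> R)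
    (W : H -> {RV P >-> R}) (F : {RV P >-> R}) : T -> H :=
  xget (fun=> 0) [set u : T -> H | is_malliavin_derivative ip W F u].

Definition malliavin_matrix (d : measure_display)
    (T : measurableType d) (R : realType) (P : probability T R)
    (H : completeNormedModType R) (ip : H -> H -> R)
    (W : H -> {RV P >-> R}) (F G : {RV P >-> R}) (w : T) : 'M[R]_(1 + 1) :=
  let DF := malliavin_derivative ip W F w in
  let DG := malliavin_derivative ip W G w in
  block_mx (`|DF| ^+ 2)%:M (ip DF DG)%:M
           (ip DF DG)%:M   (`|DG| ^+ 2)%:M.

(* Main.v *)
(** On tensors supported by the first N basis vectors, a multiple integral is a
    polynomial in the independent Gaussian variables W(e_0), ..., W(e_(N-1)): by
    polarization it is enough to consider powers of a unit vector, that is Hermite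
    polynomials. For such polynomials, Gaussian integration by parts (Stroock's
    formula) yields E[(I_p(a) I_q(b) - I_p(a') I_q(b'))^2] as the sum over k of
    k!^2 C_q^k^2 C_p^k^2 (p+q-2k)! times the squared norm of
    a ~(x)_k b - a' ~(x)_k b'.

    The coordinates of D I_n(f) are the I_(n-1)(s_{i,f}), and Lagrange's identity
    |u|^2 |v|^2 - <u,v>^2 = 1/2 sum_{i,l} (u_i v_l - u_l v_i)^2 turns the expectation
    of the determinant into the sum of the T_k, each of which is nonnegative. The
    term T_0 is computed by sorting the permutations in the scalar product of two
    symmetrized tensor products according to the number of exchanged slots: the
    diagonal terms give the |f (x)_r g|^2 and the cross terms the |f (x)_(r+1) g|^2.

    All these quantities are squared norms of bounded bilinear expressions in
    (f, g), so the identities pass to the limit from finitely supported tensors.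
    The derivative is determined almost surely because the integration by parts
    formula against cos(W(g) + c) passes to the closure and these variables are
    total. *)
Require Import Defs.
From HB Require Import structures.
From mathcomp Require Import all_boot all_order all_algebra all_fingroup.
From mathcomp Require Import all_classical all_reals all_analysis.
From mathcomp Require Import measurable_realfun ring lra zify.
From mathcomp Require mpoly.
Import -(notations) mpoly.
Import Order.TTheory GRing.Theory Num.Theory.
Import numFieldNormedType.Exports.
Local Open Scope classical_set_scope.
Local Open Scope ring_scope.

Set Implicit Arguments.
Unset Strict Implicit.
Unset Printing Implicit Defensive.

(** * Wick polynomials *)

(** The combinatorial part never sees a Gaussian law. It works with an arbitrary linear functional
    [mu] on polynomials such that [mu 1 = 1] and [mu (X_i F) = mu (d_i F)]; the expectation is
    substituted for [mu] only at the end. Three obstacles shape the rest. The hypotheses on [I]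
    control second moments, whereas the determinant involves products of two integrals; these are
    square integrable because their truncations have second moments bounded uniformly, and a duality
    argument passes the bound to the limit. The forms in play take values in the extended reals, so
    continuity under truncation is derived from [Q (u + v) <= (1 + s) Q u + (1 + 1/s) Q v], a
    triangle inequality free of square roots. Finally [malliavin_derivative] is a choice among all
    versions: a version with known coordinates is built by the Riesz-Fischer theorem on the event
    where these are square summable, and almost sure uniqueness transfers them to the chosen one.
    Integration by parts for several variables avoids joint densities: the component along one
    direction is split off and only the one-dimensional identity of Stein is integrated. *)

Section Words.
Variables (N : nat).
Implicit Types (p q : nat) (s t : seq 'I_N).

(** Plain sequences rather than tuples: catenation, masks and removal of a first letter then need no
    cast between lengths. *)
Fixpoint words p : seq (seq 'I_N) :=
  if p is p'.+1 then [seq i :: s | i <- enum 'I_N, s <- words p'] else [:: [::]].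

Lemma mem_words p s : (s \in words p) = (size s == p).
Proof.
elim: p s => [|p IH] s /=; first by rewrite inE size_eq0.
case: s => [|i s] /=.
  by apply/negbTE/negP => /allpairsP[[i s] /= [_ _ //]].
rewrite eqSS -IH; apply/allpairsP/idP => [[[j u] /= [_ us [_ ->]]] //|us].
by exists (i, s); rewrite /= mem_enum.
Qed.

Lemma words_uniq p : uniq (words p).
Proof.
elim: p => //= p IH; apply: allpairs_uniq => //; first exact: enum_uniq.
by move=> [i s] [j t] _ _ /= [-> ->].
Qed.

Variable V : nmodType.
Implicit Type F : seq 'I_N -> V.

Lemma big_words0 F : \sum_(s <- words 0) F s = F [::].
Proof. by rewrite big_seq1. Qed.

Lemma big_wordsS p F :
  \sum_(s <- words p.+1) F s = \sum_i \sum_(s <- words p) F (i :: s).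
Proof. by rewrite big_allpairs_dep /= big_enum. Qed.

Lemma eq_words p F G : (forall s, size s = p -> F s = G s) ->
  \sum_(s <- words p) F s = \sum_(s <- words p) G s.
Proof.
move=> FG; rewrite big_seq [RHS]big_seq; apply: eq_bigr => s.
by rewrite mem_words => /eqP; exact: FG.
Qed.

Lemma big_words_cat p q F : \sum_(s <- words (p + q)) F s =
  \sum_(x <- words p) \sum_(y <- words q) F (x ++ y).
Proof.
elim: p F => [|p IH] F; first by rewrite big_words0.
by rewrite addSn !big_wordsS; apply: eq_bigr => i _; rewrite IH.
Qed.

(** Bridge to tuples, on which permutations act. *)
Lemma big_words_tuple p F :
  \sum_(s <- words p) F s = \sum_(t : p.-tuple 'I_N) F t.
Proof.
have -> : \sum_(t : p.-tuple 'I_N) F t =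
    \sum_(s <- [seq val u | u <- enum {: p.-tuple 'I_N}]) F s.
  by rewrite big_map big_enum.
apply: perm_big; apply: uniq_perm; first exact: words_uniq.
  by rewrite map_inj_uniq ?enum_uniq//; exact: val_inj.
move=> s; rewrite mem_words; apply/eqP/mapP => [sp|[u _ ->]].
  by exists (tcast sp (in_tuple s)); rewrite ?mem_enum //= val_tcast.
by rewrite size_tuple.
Qed.

End Words.

(** A mask is a subset of the slots of a word, [map negb] being its complement. It records which
    factor receives each derivative in the Leibniz rule. *)
Fixpoint masks n : seq bitseq :=
  if n is n'.+1 then [seq true :: m | m <- masks n'] ++
                     [seq false :: m | m <- masks n'] else [:: [::]].

Lemma mem_masks n m : (m \in masks n) = (size m == n).
Proof.
elim: n m => [|n IH] m /=; first by rewrite inE size_eq0.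
rewrite mem_cat; case: m => [|b m] /=.
  by apply/negbTE; rewrite negb_or; apply/andP; split; apply/negP => /mapP[].
rewrite eqSS -IH; apply/orP/idP => [[]/mapP[m' ? [_ ->]]//|mn].
by case: b; [left|right]; apply/mapP; exists m.
Qed.

Lemma count_masks n k :
  count (fun m => count id m == k) (masks n) = 'C(n, k).
Proof.
elim: n k => [|n IH] [|k] //=; rewrite count_cat !count_map.
  rewrite (@eq_count _ _ pred0) ?count_pred0 ?add0n; last by move=> m.
  by rewrite (eq_count (a2 := fun m => count id m == 0%N)) ?IH ?bin0//; move=> m.
by rewrite binS addnC -!IH; congr (_ + _)%N; apply: eq_count => m.
Qed.

Lemma count_negb (m : bitseq) : count id (map negb m) = (size m - count id m)%N.
Proof.
rewrite count_map -(count_predC id m) addKn.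
by apply: eq_count => b.
Qed.

Lemma big_masksS (V : nmodType) n (F : bitseq -> V) :
  \sum_(m <- masks n.+1) F m =
  \sum_(m <- masks n) F (true :: m) + \sum_(m <- masks n) F (false :: m).
Proof. by rewrite /= big_cat !big_map. Qed.

Lemma eq_masks (V : nmodType) n (P : pred bitseq) (F G : bitseq -> V) :
  (forall m, size m = n -> P m -> F m = G m) ->
  \sum_(m <- masks n | P m) F m = \sum_(m <- masks n | P m) G m.
Proof.
move=> FG; rewrite big_seq_cond [RHS]big_seq_cond; apply: eq_bigr => m.
by rewrite mem_masks => /andP[/eqP]; exact: FG.
Qed.

Lemma big_masks_cat (V : nmodType) n k (F : bitseq -> V) :
  \sum_(m <- masks (n + k)) F m =
  \sum_(m <- masks n) \sum_(m' <- masks k) F (m ++ m').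
Proof.
elim: n F => [|n IH] F; first by rewrite /= big_seq1.
by rewrite addSn !big_masksS !IH.
Qed.

(** A word is freely determined by its letters inside and outside the mask. *)
Lemma big_words_mask N (V : nmodType) (m : bitseq)
    (F : seq 'I_N -> seq 'I_N -> V) :
  \sum_(s <- words N (size m)) F (mask m s) (mask (map negb m) s) =
  \sum_(x <- words N (count id m)) \sum_(y <- words N (count id (map negb m))) F x y.
Proof.
elim: m F => [|b m IH] F; first by rewrite /= !big_seq1.
rewrite big_wordsS; case: b => /=; rewrite ?add1n ?add0n.
  by rewrite big_wordsS; apply: eq_bigr => i _; exact: (IH (fun x y => F (i :: x) y)).
rewrite (eq_bigr (fun i => \sum_(x <- words N (count id m))
   \sum_(y <- words N (count id (map negb m))) F x (i :: y))); last first.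
  by move=> i _; exact: (IH (fun x y => F x (i :: y))).
by rewrite exchange_big; apply: eq_bigr => x _; rewrite big_wordsS.
Qed.

Lemma perm_mask_cat (T : eqType) (m : bitseq) (s : seq T) : size m = size s ->
  perm_eq (mask m s ++ mask (map negb m) s) s.
Proof.
elim: m s => [|b m IH] [|x s] //= [ms]; case: b => /=.
  by rewrite perm_cons IH.
apply: (perm_trans (y := x :: (mask m s ++ mask (map negb m) s))).
  exact/permPl/(perm_catCA _ [:: x]).
by rewrite perm_cons IH.
Qed.

(** The permutation depends on the mask alone: it is read off the word of indices [ord_tuple M], and
    every other word is an image of that one. *)
Lemma mask_cat_perm M (m : bitseq) : size m = M ->
  exists tau : 'S_M, forall (T : Type) (t : M.-tuple T),
    mask m t ++ mask (map negb m) t = [tuple tnth t (tau i) | i < M].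
Proof.
move=> mM; have sE : size (mask m (ord_tuple M) ++ mask (map negb m) (ord_tuple M)) == M.
  apply/eqP; have := perm_mask_cat (s := ord_tuple M) (m := m).
  by rewrite size_tuple => /(_ mM) /perm_size ->; rewrite size_tuple.
have := perm_mask_cat (s := ord_tuple M) (m := m); rewrite size_tuple => /(_ mM).
rewrite -[X in perm_eq X]/(tval (Tuple sE)) => /tuple_permP[tau tauE].
exists tau => T t.
have tE : tval t = map (tnth t) (ord_tuple M).
  by rewrite -[in LHS](map_tnth_enum t) val_ord_tuple.
have mE (k : bitseq) : mask k t = map (tnth t) (mask k (ord_tuple M)).
  by rewrite map_mask -tE.
rewrite !mE -map_cat; move: tauE => /= ->; rewrite -map_comp.
by apply: eq_map => i /=; rewrite tnth_ord_tuple.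
Qed.

(** * Creation operators on polynomials *)

Section Wick.
Variables (R : realType) (N : nat).
Notation poly := (mpoly N R).
Notation X i := (mpolyX R (mnm1 i) : poly).
Implicit Types (F G H : poly) (i j : 'I_N) (s t : seq 'I_N).
Implicit Types (a b : seq 'I_N -> R).

Fixpoint ders t F : poly := if t is i :: t' then ders t' (mderiv i F) else F.

Lemma ders_cat s t F : ders (s ++ t) F = ders t (ders s F).
Proof. by elim: s F => /=. Qed.

Lemma dersD t : {morph ders t : F G / F + G}.
Proof. by elim: t => //= i t IH F G; rewrite mderivD IH. Qed.

Lemma dersZ t c F : ders t (c *: F) = c *: ders t F.
Proof. by elim: t F => //= i t IH F; rewrite mderivZ IH. Qed.

Lemma dersB t F G : ders t (F - G) = ders t F - ders t G.
Proof. by rewrite -scaleN1r dersD dersZ scaleN1r. Qed.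

Lemma ders_mderiv i t F : ders t (mderiv i F) = mderiv i (ders t F).
Proof. by elim: t F => //= j t IH F; rewrite mderiv_comm IH. Qed.

Lemma ders_perm s t F : perm_eq s t -> ders s F = ders t F.
Proof.
elim: s t F => [|i s IH] t F; first by rewrite perm_sym => /perm_nilP ->.
move=> st; have it : i \in t by rewrite -(perm_mem st) mem_head.
case/splitPr: it st => t1 t2 st.
have st' : perm_eq s (t1 ++ t2).
  rewrite -(perm_cons i); apply: (perm_trans st).
  exact/permPl/(perm_catCA _ [:: i]).
by rewrite /= (IH _ _ st') !ders_cat /= ders_mderiv.
Qed.

Lemma ders_mul t F G : ders t (F * G) =
  \sum_(m <- masks (size t)) ders (mask m t) F * ders (mask (map negb m) t) G.
Proof.
elim: t F G => [|i t IH] F G; first by rewrite big_seq1.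
by rewrite /= mderivM dersD !IH /= big_cat !big_map.
Qed.

(** The divergence, or creation operator: the adjoint of [mderiv i] for the Gaussian mean. *)
Definition delta i F : poly := X i * F - mderiv i F.

Lemma mderivXU i j : mderiv i (X j) = (i == j)%:R.
Proof.
rewrite mderivX mnm1E eq_sym; case: eqVneq => [->|_]; last by rewrite scale0r.
by rewrite scale1r (_ : mnm_sub _ _ = mnm0) ?mpolyX0// ; apply/mnmP => k; rewrite mnmBE mnm0E subnn.
Qed.

(** The canonical commutation relation, source of all the factorials below. *)
Lemma mderiv_delta i j F :
  mderiv i (delta j F) = delta j (mderiv i F) + (i == j)%:R * F.
Proof.
by rewrite /delta mderivB mderivM mderivXU (mderiv_comm j i); ring.
Qed.

(** An induction principle adapted to the mean: a factor [delta i F] can be moved to the other side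
    by adjointness, whereas a factor [X_i] cannot. *)
Inductive wick : poly -> Prop :=
| wickC c : wick (mpolyC N c)
| wickD F G : wick F -> wick G -> wick (F + G)
| wick_delta i F : wick F -> wick (delta i F).

Lemma wickZ c F : wick F -> wick (c *: F).
Proof.
elim=> [c'|F1 G1 _ hF _ hG|i F1 _ hF].
- by rewrite -mul_mpolyC -mpolyCM; exact: wickC.
- by rewrite scalerDr; exact: wickD.
- have -> : c *: delta i F1 = delta i (c *: F1).
    by rewrite /delta mderivZ scalerBr scalerAr.
  exact: wick_delta.
Qed.

Lemma wick_mderiv i F : wick F -> wick (mderiv i F).
Proof.
elim=> [c|F1 G1 _ hF _ hG|j F1 wF hF].
- by rewrite mderivC -[0]/(mpolyC N 0); exact: wickC.
- by rewrite mderivD; exact: wickD.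
- rewrite mderiv_delta; apply: wickD; first exact: wick_delta.
  by rewrite -mpolyC_nat mul_mpolyC; exact: wickZ.
Qed.

Lemma wickX i F : wick F -> wick (X i * F).
Proof.
move=> wF; have -> : X i * F = delta i F + mderiv i F by rewrite /delta subrK.
by apply: wickD; [exact: wick_delta|exact: wick_mderiv].
Qed.

(** Multiplication by [X_i] is [delta i + mderiv i], and the class is stable under [mderiv] by the
    commutation relation; so it contains all monomials. *)
Lemma wick_all F : wick F.
Proof.
elim/mpolyind: F => [|c m F _ _ wF]; first by rewrite -[0]/(mpolyC N 0); exact: wickC.
apply: wickD => //; apply: wickZ; rewrite mpolyXE_id.
rewrite -[\prod_(_ < _) _]mulr1.
suff hm G : wick G -> wick (\prod_(i < N) X i ^+ m i * G) by exact/hm/(wickC 1).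
elim/big_ind: _ G => [G wG|F1 F2 h1 h2 G wG|i _ G wG].
- by rewrite mul1r.
- by rewrite -mulrA; apply: h1; exact: h2.
- by elim: (m i) => [|k IH]; rewrite ?mul1r// exprS -mulrA; exact: wickX.
Qed.

End Wick.

(** * Stroock's formula and chaos for an abstract Gaussian mean *)

Section GaussianFunctional.
Variables (R : realType) (N : nat).
Notation poly := (mpoly N R).
Notation Xv i := (mpolyX R (mnm1 i) : poly).
Implicit Types (F G H : poly) (i j : 'I_N) (s t : seq 'I_N).
Implicit Types (a b : seq 'I_N -> R).

Variable mu : poly -> R.
Hypothesis muD : forall F G, mu (F + G) = mu F + mu G.
Hypothesis muZ : forall c F, mu (c *: F) = c * mu F.
Hypothesis mu1 : mu 1 = 1.
Hypothesis muX : forall i F, mu (Xv i * F) = mu (mderiv i F).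

Lemma mu0 : mu 0 = 0. Proof. by rewrite -(scale0r 0) muZ mul0r. Qed.

Lemma muB F G : mu (F - G) = mu F - mu G.
Proof. by rewrite muD -scaleN1r muZ mulN1r. Qed.

Lemma mu_sum (J : Type) (r : seq J) (P : pred J) (f : J -> poly) :
  mu (\sum_(k <- r | P k) f k) = \sum_(k <- r | P k) mu (f k).
Proof. exact: (big_morph mu muD mu0). Qed.

Lemma muC c : mu (mpolyC N c) = c.
Proof. by rewrite -[mpolyC N c]mulr1 mul_mpolyC muZ mu1 mulr1. Qed.

Lemma mu_delta i F : mu (delta i F) = 0.
Proof. by rewrite /delta muB muX subrr. Qed.

Lemma mu_deltaM i F G : mu (delta i F * G) = mu (F * mderiv i G).
Proof.
by rewrite /delta mulrBl muB -mulrA muX mderivM muD addrAC subrr add0r.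
Qed.

(** Scalar product of the tensors of mean derivatives of order [M] of [F] and [G]; up to factorials
    these tensors are the chaos kernels. *)
Fixpoint stroock M F G : R :=
  if M is M'.+1 then \sum_i stroock M' (mderiv i F) (mderiv i G)
  else mu F * mu G.

Lemma stroock_words M F G :
  stroock M F G = \sum_(s <- words N M) mu (ders s F) * mu (ders s G).
Proof.
elim: M F G => [|M IH] F G; first by rewrite big_words0.
by rewrite big_wordsS /=; apply: eq_bigr => i _; rewrite IH.
Qed.

Lemma stroockD M F F' G : stroock M (F + F') G = stroock M F G + stroock M F' G.
Proof.
elim: M F F' G => [|M IH] F F' G /=; first by rewrite muD mulrDl.
by rewrite -big_split; apply: eq_bigr => i _; rewrite mderivD IH.
Qed.

Lemma stroockZ M c F G : stroock M (c *: F) G = c * stroock M F G.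
Proof.
elim: M F G => [|M IH] F G /=; first by rewrite muZ mulrA.
by rewrite mulr_sumr; apply: eq_bigr => i _; rewrite mderivZ IH.
Qed.

(** Each of the [M] derivatives applied to [delta i F] may be the one consumed by the commutation
    relation. If none is, a [delta] remains outermost and its mean is zero. *)
Lemma stroock_delta M i F G :
  stroock M (delta i F) G = M%:R * stroock M.-1 F (mderiv i G).
Proof.
elim: M F G => [|M IH] F G /=; first by rewrite mu_delta !mul0r.
under eq_bigr => j _ do rewrite mderiv_delta stroockD IH -mpolyC_nat mul_mpolyC stroockZ.
rewrite big_split /= [X in _ + X](bigD1 i)//= eqxx mul1r.
rewrite [X in _ + (_ + X)]big1 ?addr0; last by move=> j /negbTE ->; rewrite mul0r.
case: M {IH} => [|M] /=.
  by rewrite big1 ?add0r ?mul1r// => j _; rewrite mul0r.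
rewrite -mulr_sumr -[in RHS]natr1 mulrDl mul1r; congr (_ + _).
by congr (_ * _); apply: eq_bigr => j _; rewrite mderiv_comm.
Qed.

(* Stroock's formula, without convergence issues since derivatives of high order of a polynomial vanish. *)
Lemma mu_stroock F : exists K0, forall K G, (K0 <= K)%N ->
  mu (F * G) = \sum_(M < K) M`!%:R^-1 * stroock M F G.
Proof.
elim: F / (wick_all F) => [c|F F' _ [K1 h1] _ [K2 h2]|i F _ [K0 h]].
- exists 1%N => -[//|K] G _; rewrite big_ord_recl /= muC fact0 invr1 mul1r.
  rewrite mul_mpolyC muZ big1 ?addr0// => M _.
  by rewrite big1 ?mulr0// => j _; rewrite mderivC -(scale0r 0) stroockZ mul0r.
- exists (maxn K1 K2) => K G; rewrite geq_max => /andP[? ?].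
  rewrite mulrDl muD (h1 K)// (h2 K)// -big_split; apply: eq_bigr => M _ /=.
  by rewrite stroockD mulrDr.
(* Adjointness replaces [G] by [mderiv i G]. The term of order [M.+1] of the new expansion is the
   old term of order [M], since the factor [M.+1] of [stroock_delta] cancels against the factorial;
   hence the shift of the threshold. *)
- exists K0.+1 => -[//|K] G lK; rewrite mu_deltaM (h K)//.
  rewrite big_ord_recl stroock_delta mul0r mulr0 add0r; apply: eq_bigr => M _.
  by rewrite lift0 stroock_delta factS natrM invfM mulrACA mulVf ?mul1r ?pnatr_eq0.
Qed.

(* The multiple integral of order p of the tensor with coefficients a, as a
   polynomial in the independent Gaussian variables W(e_0), ..., W(e_(N-1));
   only the values of a on words of length p matter. *)
Fixpoint chaos p a : poly :=
  if p is p'.+1 then \sum_i delta i (chaos p' (fun s => a (i :: s)))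
  else mpolyC N (a [::]).

Lemma deltaD i F G : delta i (F + G) = delta i F + delta i G.
Proof. by rewrite /delta mderivD mulrDr opprD addrACA. Qed.

Lemma deltaZ i c F : delta i (c *: F) = c *: delta i F.
Proof. by rewrite /delta mderivZ scalerBr scalerAr. Qed.

Lemma eq_chaos p a b : (forall s, size s = p -> a s = b s) ->
  chaos p a = chaos p b.
Proof.
elim: p a b => [|p IH] a b ab /=; first by rewrite ab.
by apply: eq_bigr => i _; rewrite (IH _ (fun s => b (i :: s)))// => s sp; rewrite ab//= sp.
Qed.

Lemma chaosD p a b : chaos p (fun s => a s + b s) = chaos p a + chaos p b.
Proof.
elim: p a b => [|p IH] a b /=; first by rewrite mpolyCD.
by rewrite -big_split; apply: eq_bigr => i _ /=; rewrite -deltaD -IH.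
Qed.

Lemma chaosZ p c a : chaos p (fun s => c * a s) = c *: chaos p a.
Proof.
elim: p a => [|p IH] a /=; first by rewrite -mul_mpolyC -mpolyCM.
by rewrite scaler_sumr; apply: eq_bigr => i _ /=; rewrite -deltaZ -IH.
Qed.

Definition perm_invariant a := forall s t, perm_eq s t -> a s = a t.

Lemma perm_invariant_cat a s : perm_invariant a -> perm_invariant (fun t => a (s ++ t)).
Proof. by move=> ai t t' tt'; apply: ai; rewrite perm_cat2l. Qed.

Lemma perm_invariant_cons a i : perm_invariant a -> perm_invariant (fun t => a (i :: t)).
Proof. exact: (@perm_invariant_cat a [:: i]). Qed.

Lemma mderiv_sum i (J : Type) (r : seq J) (P : pred J) (f : J -> poly) :
  mderiv i (\sum_(k <- r | P k) f k) = \sum_(k <- r | P k) mderiv i (f k).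
Proof. by apply: (big_morph (mderiv i)); [exact: mderivD|exact: mderiv0]. Qed.

(** The commutator with the outer [delta] yields one copy, and the derivatives of the inner chaos
    yield the others; symmetry of [a] makes all copies equal. *)
Lemma mderiv_chaos p a j : perm_invariant a ->
  mderiv j (chaos p a) = p%:R *: chaos p.-1 (fun s => a (j :: s)).
Proof.
elim: p a => [|p IH] a ai /=; first by rewrite mderivC scale0r.
rewrite mderiv_sum; under eq_bigr => i _ do rewrite mderiv_delta.
rewrite big_split /= [X in _ + X](bigD1 j)//= eqxx mul1r.
rewrite [X in _ + (_ + X)]big1 ?addr0; last first.
  by move=> i; rewrite eq_sym => /negbTE ->; rewrite mul0r.
rewrite -natr1 scalerDl scale1r [X in X + _](_ : _ = p%:R *: chaos p (fun s => a (j :: s)))//.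
under eq_bigr => i _ do rewrite (IH _ (perm_invariant_cons i ai)) deltaZ.
rewrite -scaler_sumr; case: p {IH} => [|p] /=; first by rewrite !scale0r.
congr (_ *: _); apply: eq_bigr => i _; congr (delta _ _); apply: eq_chaos => s _.
by apply: ai; exact/permPl/(perm_catCA [:: i] [:: j]).
Qed.

Lemma ders_chaos p a t : perm_invariant a ->
  ders t (chaos p a) = (p ^_ size t)%:R *: chaos (p - size t) (fun s => a (t ++ s)).
Proof.
elim: t p a => [|i t IH] p a ai /=; first by rewrite subn0 scale1r.
rewrite mderiv_chaos// dersZ IH; last exact: perm_invariant_cons.
rewrite scalerA -natrM -ffactnS.
by rewrite (_ : p.-1 - size t = p - (size t).+1)%N//; case: p => //= ; rewrite ?sub0n.
Qed.

Lemma mu_chaosM k a G :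
  mu (chaos k a * G) = \sum_(s <- words N k) a s * mu (ders s G).
Proof.
elim: k a G => [|k IH] a G; first by rewrite big_words0 /= mul_mpolyC muZ.
rewrite big_wordsS /= mulr_suml mu_sum; apply: eq_bigr => i _.
by rewrite mu_deltaM IH.
Qed.

Lemma mu_chaos k a : mu (chaos k a) = if k == 0%N then a [::] else 0.
Proof.
case: k => [|k] /=; first exact: muC.
by rewrite mu_sum big1// => i _; exact: mu_delta.
Qed.

(** Orthogonality and isometry of chaoses: the [k] operators of the first factor become [k]
    derivatives of the second, which leave a constant, a centred chaos or zero. *)
Lemma mu_chaos2 k l a b : perm_invariant b -> mu (chaos k a * chaos l b) =
  if k == l then k`!%:R * \sum_(s <- words N k) a s * b s else 0.
Proof.
move=> bi; rewrite mu_chaosM; case: eqVneq => [<-|kl].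
  rewrite mulr_sumr; apply: eq_words => s sk.
  by rewrite ders_chaos// sk muZ ffactnn subnn /= muC cats0 mulrCA.
rewrite big_seq big1// => s; rewrite mem_words => /eqP sk.
rewrite ders_chaos// sk muZ mu_chaos; case: (ltngtP k l) kl => // kl _.
  by rewrite subn_eq0 leqNgt kl /= !mulr0.
by rewrite ffact_small// mul0r mulr0.
Qed.

Definition contr k a b (x y : seq 'I_N) : R :=
  \sum_(s <- words N k) a (s ++ x) * b (s ++ y).

(** The Leibniz rule gives [c] letters of [t] to the first chaos and the others to the second. What
    remains are chaoses of orders [p - c] and [q - (size t - c)], and orthogonality forces both to
    be the same [k]. So at most one [k] contributes for a given length of [t]. *)
Lemma mu_ders_chaosM p q a b t : perm_invariant a -> perm_invariant b ->
  mu (ders t (chaos p a * chaos q b)) =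
  \sum_(k < (minn p q).+1 | (size t == p - k + (q - k))%N)
    (p ^_ (p - k) * q ^_ (q - k) * k`!)%:R *
    \sum_(m <- masks (size t) | (count id m == p - k)%N)
      contr k a b (mask m t) (mask (map negb m) t).
Proof.
move=> ai bi; rewrite ders_mul mu_sum.
rewrite [RHS](eq_bigr (fun k : 'I_(minn p q).+1 => \sum_(m <- masks (size t))
   if (count id m == p - k)%N then (p ^_ (p - k) * q ^_ (q - k) * k`!)%:R *
      contr k a b (mask m t) (mask (map negb m) t) else 0)); last first.
  by move=> k _; rewrite mulr_sumr big_mkcond.
rewrite exchange_big /=; apply: eq_masks => m mt _.
rewrite !ders_chaos// -scalerAl -scalerAr scalerA muZ mu_chaos2; last exact: perm_invariant_cat.
rewrite !size_mask ?size_map// count_negb mt.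
set c := count id m; set c' := (size t - c)%N.
have cc' : (c + c' = size t)%N by rewrite subnKC// -mt count_size.
have [cp|pc] := leqP c p; last first.
  rewrite ffact_small// mul0r mul0r big1// => k _; rewrite ifF//.
  by apply/negbTE; lia.
have [cq|qc] := leqP c' q; last first.
  rewrite (ffact_small qc) mulr0 mul0r big1// => k /eqP tk; rewrite ifF//.
  by apply/negbTE; move: tk; rewrite -cc'; lia.
have [pq|pq] := eqVneq (p - c)%N (q - c')%N; last first.
  rewrite mulr0 big1// => k /eqP tk; rewrite ifF//.
  by apply/negbTE/eqP => ck; move: tk pq; rewrite -cc' ck => /addnI ->; rewrite !subKn ?eqxx//; move: (ltn_ord k); lia.
have kl : (p - c < (minn p q).+1)%N by rewrite ltnS leq_min leq_subr pq leq_subr.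
rewrite (bigD1 (Ordinal kl)) /=; last by rewrite subKn// pq subKn// cc'.
rewrite subKn// eqxx [X in _ + X]big1 ?addr0.
  rewrite [in RHS]pq subKn// !natrM -!mulrA -pq; congr (_ * (_ * (_ * _))).
  rewrite /contr; apply: eq_words => s _; congr (_ * _).
    by apply: ai; rewrite perm_catC.
  by apply: bi; rewrite perm_catC.
move=> k /andP[/eqP tk kn]; rewrite ifF//; apply/negbTE; apply: contraNN kn => /eqP ck.
by rewrite -val_eqE /= ck subKn//; move: (ltn_ord k); lia.
Qed.

Definition symz M (A : seq 'I_N -> R) (t : M.-tuple 'I_N) : R :=
  M`!%:R^-1 * \sum_(s : 'S_M) A [tuple tnth t (s i) | i < M].

Lemma symz_perm M A (tau : 'S_M) (t : M.-tuple 'I_N) :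
  symz A [tuple tnth t (tau i) | i < M] = symz A t.
Proof.
rewrite /symz; congr (_ * _); rewrite [RHS](reindex_inj (mulIg tau)).
apply: eq_bigr => s _; congr A; apply: eq_map => i /=.
by rewrite tnth_mktuple permM.
Qed.

Lemma sum_symz M A B :
  \sum_(t : M.-tuple 'I_N) symz A t * symz B t =
  \sum_(t : M.-tuple 'I_N) symz A t * B t.
Proof.
under eq_bigr => t _ do rewrite {2}/symz mulrCA mulr_sumr mulr_sumr.
rewrite exchange_big /= (eq_bigr (fun=> M`!%:R^-1 * \sum_(t : M.-tuple 'I_N) symz A t * B t)).
  by rewrite sumr_const card_Sn -[LHS]mulr_natl mulrA divff ?mul1r// pnatr_eq0 -lt0n fact_gt0.
move=> s _; rewrite -mulr_sumr; congr (_ * _).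
pose h (u : 'S_M) (t : M.-tuple 'I_N) := [tuple tnth t (u i) | i < M].
have hK u : cancel (h u) (h u^-1%g).
  by move=> t; apply: eq_from_tnth => i; rewrite !tnth_mktuple permKV.
have hK' u : cancel (h u^-1%g) (h u) by move=> t; rewrite -{2}(hK u^-1%g t) invgK.
rewrite [RHS](reindex (h s)) /=; last by exists (h s^-1%g) => t _; rewrite ?hK ?hK'.
by apply: eq_bigr => t _; rewrite symz_perm.
Qed.

Definition ctensor p k a b (s : seq 'I_N) : R :=
  contr k a b (take (p - k) s) (drop (p - k) s).

(** The sum over the ways to share the letters of [t] is itself symmetric, hence equal to its
    average over permutations. After averaging, all masks with the same count contribute equally,
    and there are a binomial number of them. *)
Lemma masks_symz p q k a b (t : (p - k + (q - k)).-tuple 'I_N) :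
  perm_invariant a -> perm_invariant b -> (k <= minn p q)%N ->
  \sum_(m <- masks (p - k + (q - k)) | (count id m == p - k)%N)
    contr k a b (mask m t) (mask (map negb m) t) =
  'C(p - k + (q - k), p - k)%:R * symz (ctensor p k a b) t.
Proof.
move=> ai bi kpq; set M := (p - k + (q - k))%N in t *.
pose w (t : seq 'I_N) := \sum_(m <- masks M | (count id m == p - k)%N)
    contr k a b (mask m t) (mask (map negb m) t).
rewrite -/(w t).
(* Symmetry of [w] is not checked by hand: up to a nonzero factor [w u] is the mean of a mixed
   derivative, in which the order of the letters does not matter. *)
have w_mu (u : M.-tuple 'I_N) :
    w u = ((p ^_ (p - k) * q ^_ (q - k) * k`!)%:R)^-1 *
          mu (ders u (chaos p a * chaos q b)).
  have kl : (k < (minn p q).+1)%N by [].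
  rewrite mu_ders_chaosM// size_tuple (bigD1 (Ordinal kl)) //= [X in _ + X]big1 ?addr0.
    by rewrite mulrA mulVf ?mul1r// pnatr_eq0 -lt0n !muln_gt0 !ffact_gt0 fact_gt0 !leq_subr.
  move=> l /andP[/eqP Ml ln]; exfalso; move/negP: ln; apply; rewrite -val_eqE /=.
  by move: Ml (ltn_ord l); rewrite /M; lia.
have w_perm (s : 'S_M) (u : M.-tuple 'I_N) : w [tuple tnth u (s i) | i < M] = w u.
  rewrite !w_mu; congr (_ * mu _); apply: ders_perm; apply/tuple_permP.
  by exists s.
have -> : w t = M`!%:R^-1 * \sum_(s : 'S_M) w [tuple tnth t (s i) | i < M].
  under eq_bigr => s _ do rewrite w_perm.
  rewrite sumr_const card_Sn. by rewrite -[w t *+ _]mulr_natl mulrA mulVf ?mul1r// pnatr_eq0 -lt0n fact_gt0.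
rewrite /symz mulrCA; congr (_ * _); rewrite /w exchange_big /=.
rewrite (@eq_masks _ _ _ _ (fun=> \sum_(s : 'S_M) ctensor p k a b [tuple tnth t (s i) | i < M])).
  by rewrite big_const_seq iter_addr_0 -[LHS]mulr_natl count_masks.
(* Reading [t] through the mask [m] amounts to a fixed permutation [tau], which the average over all
   permutations absorbs. *)
move=> m mM /eqP cm; have [tau tauE] := mask_cat_perm mM.
rewrite [RHS](reindex_inj (mulgI tau)) /=; apply: eq_bigr => s _.
have -> : [seq tnth t ((tau * s)%g l) | l <- enum 'I_M] =
    val [tuple tnth [tuple tnth t (s i) | i < M] (tau i) | i < M].
  by apply: eq_map => l /=; rewrite tnth_mktuple permM.
rewrite -[val _](tauE _ [tuple tnth t (s i) | i < M]).
by rewrite /ctensor take_size_cat ?drop_size_cat// size_mask// size_tuple.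
Qed.

(** The product formula in disguise: the coefficient of the chaos of order [p + q - 2k] in the
    product is [k!] times two binomials, and differentiating that chaos completely gives the
    factorial of its order. *)
Lemma mu_ders_symz p q k a b (t : (p - k + (q - k)).-tuple 'I_N) :
  perm_invariant a -> perm_invariant b -> (k <= minn p q)%N ->
  mu (ders t (chaos p a * chaos q b)) =
  ((p - k + (q - k))`! * k`! * 'C(p, k) * 'C(q, k))%:R * symz (ctensor p k a b) t.
Proof.
move=> ai bi kpq; have kl : (k < (minn p q).+1)%N by [].
rewrite mu_ders_chaosM// size_tuple (bigD1 (Ordinal kl)) //= [X in _ + X]big1 ?addr0.
  rewrite masks_symz// mulrA -natrM; congr (_%:R * _).
  have [kp kq] : (k <= p)%N /\ (k <= q)%N by move: kpq; lia.
  rewrite -(bin_fact (leq_addr (q - k) (p - k))) addKn -!bin_ffact !bin_sub//.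
  by ring.
move=> l /andP[/eqP Ml ln]; exfalso; move/negP: ln; apply; rewrite -val_eqE /=.
by move: Ml (ltn_ord l); lia.
Qed.

Lemma mu_chaos4 p q a b a' b' :
  perm_invariant a -> perm_invariant b -> perm_invariant a' -> perm_invariant b' ->
  mu ((chaos p a * chaos q b - chaos p a' * chaos q b') ^+ 2) =
  \sum_(k < (minn p q).+1)
    (k`! ^ 2 * 'C(q, k) ^ 2 * 'C(p, k) ^ 2 * (p - k + (q - k))`!)%:R *
    \sum_(t : (p - k + (q - k)).-tuple 'I_N)
      (symz (ctensor p k a b) t - symz (ctensor p k a' b') t) ^+ 2.
Proof.
move=> ai bi a'i b'i; set Q := (_ - _).
have [K0 /(_ (maxn K0 (p + q).+1) Q)] := mu_stroock Q.
rewrite leq_maxl expr2 => -> //; set K := maxn _ _.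
have Kpq : (p + q < K)%N by rewrite leq_max leqnn orbT.
pose B k := (k`! ^ 2 * 'C(q, k) ^ 2 * 'C(p, k) ^ 2 * (p - k + (q - k))`!)%:R *
    \sum_(t : (p - k + (q - k)).-tuple 'I_N)
      (symz (ctensor p k a b) t - symz (ctensor p k a' b') t) ^+ 2.
transitivity (\sum_(M < K) \sum_(k < (minn p q).+1 | (M == p - k + (q - k) :> nat)%N) B k); last first.
  rewrite (exchange_big_dep xpredT)//=; apply: eq_bigr => k _.
  have Mk : (p - k + (q - k) < K)%N by lia.
  rewrite (bigD1 (Ordinal Mk))//= [X in _ + X]big1 ?addr0// => M /andP[/eqP Mk' nM].
  by exfalso; move/negP: nM; apply; apply/eqP/val_inj.
(* The order [p - k + (q - k)] determines [k], so an order carries at most one term; an order that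
   is not of this form contributes zero on both sides. *)
apply: eq_bigr => M _; have [/existsP[k /eqP Mk]|nk] :=
    boolP [exists k : 'I_(minn p q).+1, M == p - k + (q - k) :> nat]%N.
- rewrite (bigD1 k) ?Mk//= [X in _ + X]big1 ?addr0; last first.
    move=> l /andP[/eqP kl ln]; exfalso; move/negP: ln; apply; rewrite -val_eqE /=.
    by move: kl (ltn_ord l) (ltn_ord k); lia.
  have kpq : (k <= minn p q)%N by rewrite -ltnS.
  rewrite stroock_words big_words_tuple /B mulr_sumr mulr_sumr.
  apply: eq_bigr => t _; rewrite -expr2 dersB muB !mu_ders_symz// -mulrBr exprMn mulrA.
  (* The squared coefficient of [mu_ders_symz] contains the factorial of the order twice; Stroock's
     formula divides by it once. *)
  congr (_ * _); have Mf : (p - k + (q - k))`!%:R != 0 :> R.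
    by rewrite pnatr_eq0 -lt0n fact_gt0.
  by apply: (mulfI Mf); rewrite mulrA divff// mul1r -!natrX -!natrM; congr _%:R; ring.
- rewrite big_pred0; last by move=> k; apply: contraNF nk => h; apply/existsP; exists k.
  rewrite stroock_words big_seq big1 ?mulr0// => s; rewrite mem_words => /eqP sM.
  rewrite dersB muB !mu_ders_chaosM// !big_pred0 ?subrr ?mul0r// => k; rewrite sM.
    by apply: contraNF nk => h; apply/existsP; exists k.
  by apply: contraNF nk => h; apply/existsP; exists k.
Qed.

End GaussianFunctional.

(** * The term without contraction *)

Section ZeroContraction.
Variables (R : realType) (N : nat).
Notation poly := (mpoly N R).
Implicit Types (a b f g : seq 'I_N -> R).
Variable mu : poly -> R.
Hypothesis muD : forall F G, mu (F + G) = mu F + mu G.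
Hypothesis muZ : forall c F, mu (c *: F) = c * mu F.
Hypothesis mu1 : mu 1 = 1.
Hypothesis muX : forall i F, mu ((mpolyX R (mnm1 i) : poly) * F) = mu (mderiv i F).

(* In the scalar product of the symmetrizations of a (x) b and a' (x) b',
   contribution of the permutations for which r slots of a are matched with
   slots of b'. *)
Definition quad r p q a b a' b' : R :=
  \sum_(x <- words N (p - r)) \sum_(y <- words N r) \sum_(z <- words N r)
  \sum_(v <- words N (q - r))
    a (x ++ y) * b (z ++ v) * (a' (x ++ z) * b' (y ++ v)).

(** The masks tell which letters of [a'] and of [b'] are handed to [a]. Splitting the two words
    along them produces the four groups [x], [z] and [y], [v] of [quad]; since [a] takes [r] letters
    from [b'], it takes [p - r] from [a']. *)
Lemma quad_masks p q a b a' b' m1 m2 : perm_invariant a' -> perm_invariant b' ->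
  size m1 = p -> size m2 = q -> (count id m1 + count id m2 = p)%N ->
  \sum_(t1 <- words N p) \sum_(t2 <- words N q)
    a (mask m1 t1 ++ mask m2 t2) *
    b (mask (map negb m1) t1 ++ mask (map negb m2) t2) * (a' t1 * b' t2) =
  quad (count id m2) p q a b a' b'.
Proof.
move=> ai bi m1p m2q cp; set r := count id m2.
have c1 : count id m1 = (p - r)%N by rewrite -cp addnK.
have c1' : count id (map negb m1) = r by rewrite count_negb m1p c1 subKn// -cp leq_addl.
have c2' : count id (map negb m2) = (q - r)%N by rewrite count_negb m2q.
pose h x z t2 := a (x ++ mask m2 t2) * b (z ++ mask (map negb m2) t2) * (a' (x ++ z) * b' t2).
rewrite exchange_big /= (@eq_words _ _ _ _ (fun t2 => \sum_(x <- words N (p - r)) \sum_(z <- words N r) h x z t2)).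
  rewrite exchange_big; apply: eq_bigr => x _ /=.
  rewrite exchange_big /= [RHS]exchange_big; apply: eq_bigr => z _ /=.
  pose k y v := a (x ++ y) * b (z ++ v) * (a' (x ++ z) * b' (y ++ v)).
  transitivity (\sum_(t2 <- words N (size m2)) k (mask m2 t2) (mask (map negb m2) t2)).
    rewrite m2q; apply: eq_words => t2 t2q; rewrite /h /k; congr (_ * (_ * _)).
    by apply: bi; rewrite perm_sym perm_mask_cat// m2q.
  by rewrite big_words_mask c2'.
move=> t2 _; rewrite -[in RHS]c1 -[in RHS]c1' -(big_words_mask m1 (fun x z => h x z t2)) m1p.
apply: eq_words => t1 t1p; rewrite /h; congr (_ * (_ * _)).
by apply: ai; rewrite perm_sym perm_mask_cat// m1p.
Qed.

Lemma contr0 a b x y : contr 0 a b x y = a x * b y.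
Proof. by rewrite /contr big_words0. Qed.

(** One symmetrization is dropped by [sum_symz], the other is expanded as a sum over masks of
    [p + q] slots. A mask is then cut at position [p], and the two pieces are counted separately. *)
Lemma symz_inner p q a b a' b' : perm_invariant a -> perm_invariant b ->
  perm_invariant a' -> perm_invariant b' ->
  (p - 0 + (q - 0))`!%:R * (\sum_(t : (p - 0 + (q - 0)).-tuple 'I_N)
    symz (ctensor p 0 a b) t * symz (ctensor p 0 a' b') t) =
  \sum_(r < (minn p q).+1)
    (p`! * q`! * 'C(p, r) * 'C(q, r))%:R * quad r p q a b a' b'.
Proof.
move=> ai bi a'i b'i; rewrite sum_symz.
have k0 : (0 <= minn p q)%N by [].
(* The factorial of [p + q] is a binomial times [p! q!]; the binomial is used up by [masks_symz]. *)
rewrite -(bin_fact (leq_addr (q - 0) (p - 0))) addKn natrM mulrAC mulr_sumr.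
under eq_bigr => t _ do rewrite mulrA -(masks_symz muD muZ mu1 muX t ai bi k0).
transitivity ((p`! * q`!)%:R * \sum_(r < (minn p q).+1)
    ('C(p, r) * 'C(q, r))%:R * quad r p q a b a' b'); last first.
  by rewrite mulr_sumr; apply: eq_bigr => r _; rewrite mulrA -natrM mulnA.
rewrite mulrC !subn0; congr (_ * _).
pose w (t : seq 'I_N) := (\sum_(m <- masks (p + q) | count id m == p)
   a (mask m t) * b (mask (map negb m) t)) * (a' (take p t) * b' (drop p t)).
transitivity (\sum_(t : (p + q).-tuple 'I_N) w t).
  apply: eq_bigr => t _; rewrite /w /ctensor contr0 subn0; congr (_ * _).
  by apply: eq_bigr => m _; rewrite contr0.
rewrite -(big_words_tuple _ w) big_words_cat.
pose k (m1 m2 : bitseq) t1 t2 := a (mask m1 t1 ++ mask m2 t2) *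
    b (mask (map negb m1) t1 ++ mask (map negb m2) t2) * (a' t1 * b' t2).
transitivity (\sum_(t1 <- words N p) \sum_(t2 <- words N q)
  \sum_(m1 <- masks p) \sum_(m2 <- masks q | (count id m1 + count id m2)%N == p)
    k m1 m2 t1 t2).
  apply: eq_words => t1 t1p; apply: eq_words => t2 t2q.
  rewrite /w take_size_cat// drop_size_cat// mulr_suml big_mkcond big_masks_cat.
  apply: eq_masks => m1 m1p _; rewrite [RHS]big_mkcond; apply: eq_bigr => m2 _.
  by rewrite count_cat map_cat !mask_cat ?size_map ?m1p ?t1p.
transitivity (\sum_(m1 <- masks p) \sum_(m2 <- masks q | (count id m1 + count id m2)%N == p)
  quad (count id m2) p q a b a' b').
  under eq_bigr => t1 _ do rewrite exchange_big.
  rewrite exchange_big /=; apply: eq_masks => m1 m1p _.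
  under eq_bigr => t1 _ do rewrite exchange_big.
  rewrite exchange_big /=; apply: eq_masks => m2 m2q /eqP cp.
  exact: quad_masks.
under eq_bigr => m1 _ do rewrite big_mkcond.
rewrite exchange_big /=.
(* The second mask fixes [r]; then the first one has [p - r] marked slots, which leaves ['C(p, r)]
   choices, and ['C(q, r)] comes from the count of second masks. *)
transitivity (\sum_(m2 <- masks q) \sum_(r < (minn p q).+1)
   if count id m2 == r then 'C(p, r)%:R * quad r p q a b a' b' else 0).
  apply: eq_masks => m2 m2q _; set c := count id m2.
  have cq : (c <= q)%N by rewrite -m2q count_size.
  rewrite -big_mkcond /= big_const_seq iter_addr_0 -[LHS]mulr_natl.
  have [cp|pc] := leqP c p; last first.
    rewrite (@eq_count _ _ pred0) ?count_pred0 ?mul0r; last by move=> m /=; lia.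
    by rewrite big1// => r _; rewrite ifF//; apply/negbTE; move: (ltn_ord r); lia.
  have cl : (c < (minn p q).+1)%N by lia.
  rewrite (bigD1 (Ordinal cl))//= eqxx big1 ?addr0; last first.
    move=> r rc; rewrite ifF//; apply/negbTE; apply: contra rc => /eqP rc.
    by apply/eqP/val_inj.
  rewrite (@eq_count _ _ (fun m => count id m == (p - c)%N)); last by move=> m /=; lia.
  by rewrite count_masks bin_sub.
rewrite exchange_big /=; apply: eq_bigr => r _.
by rewrite -big_mkcond /= big_const_seq iter_addr_0 -[LHS]mulr_natl count_masks natrM mulrA (mulrC 'C(q, r)%:R).
Qed.

Definition contr_sqnorm r n m f g : R :=
  \sum_(x <- words N (n - r)) \sum_(y <- words N (m - r)) contr r f g x y ^+ 2.

Lemma sumrM (J K : Type) (r : seq J) (s : seq K) (F : J -> R) (G : K -> R) :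
  (\sum_(j <- r) F j) * (\sum_(k <- s) G k) =
  \sum_(j <- r) \sum_(k <- s) F j * G k.
Proof. by rewrite mulr_suml; apply: eq_bigr => j _; rewrite mulr_sumr. Qed.

(** The factors [f (i x y)], [g (l y v)] share only [y], and [f (i x z)], [g (l z v)] share only
    [z]: two equal contractions over [r] letters, with [i], [x], [l], [v] free. *)
Lemma quad_diag p q r f g : perm_invariant f -> perm_invariant g -> (r <= minn p q)%N ->
  \sum_(i < N) \sum_(l < N) quad r p q (fun s => f (i :: s)) (fun s => g (l :: s))
     (fun s => f (i :: s)) (fun s => g (l :: s)) = contr_sqnorm r p.+1 q.+1 f g.
Proof.
move=> fi gi rpq; rewrite /contr_sqnorm !subSn; [|lia|lia].
rewrite big_wordsS; apply: eq_bigr => i _.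
rewrite exchange_big /=; apply: eq_bigr => x _.
rewrite big_wordsS; apply: eq_bigr => l _.
rewrite (eq_bigr (fun y => \sum_(v <- words N (q - r)) \sum_(z <- words N r)
   f (i :: x ++ y) * g (l :: z ++ v) * (f (i :: x ++ z) * g (l :: y ++ v)))); last first.
  by move=> y _; rewrite exchange_big.
rewrite exchange_big /=; apply: eq_bigr => v _.
rewrite expr2 sumrM; apply: eq_bigr => y _; apply: eq_bigr => z _.
have fE u : f (u ++ i :: x) = f (i :: x ++ u) by apply: fi; rewrite perm_catC.
have gE u : g (u ++ l :: v) = g (l :: u ++ v).
  by apply: gi; exact/permPl/(perm_catCA u [:: l] v).
by rewrite !fE !gE; ring.
Qed.

(** With [i] and [l] exchanged in the second pair, [i] becomes common to the two factors that share
    [y], and [l] to those that share [z]. Each contraction gains one letter, whence the order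
    [r.+1]. *)
Lemma quad_cross p q r f g : perm_invariant f -> perm_invariant g -> (r <= minn p q)%N ->
  \sum_(i < N) \sum_(l < N) quad r p q (fun s => f (i :: s)) (fun s => g (l :: s))
     (fun s => f (l :: s)) (fun s => g (i :: s)) = contr_sqnorm r.+1 p.+1 q.+1 f g.
Proof.
move=> fi gi rpq; rewrite /contr_sqnorm !subSS.
rewrite (eq_bigr (fun i => \sum_(x <- words N (p - r)) \sum_(l < N)
  \sum_(y <- words N r) \sum_(z <- words N r) \sum_(v <- words N (q - r))
   f (i :: x ++ y) * g (l :: z ++ v) * (f (l :: x ++ z) * g (i :: y ++ v)))); last first.
  by move=> i _; rewrite exchange_big.
rewrite exchange_big; apply: eq_bigr => x _ /=.
transitivity (\sum_(y <- words N r.+1) \sum_(z <- words N r.+1) \sum_(v <- words N (q - r))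
   f (y ++ x) * g (y ++ v) * (f (z ++ x) * g (z ++ v))).
  rewrite big_wordsS; apply: eq_bigr => i _.
  rewrite exchange_big /=; apply: eq_bigr => y _.
  rewrite big_wordsS; apply: eq_bigr => l _.
  apply: eq_bigr => z _; apply: eq_bigr => v _.
  have fE u w : f (w :: x ++ u) = f (w :: u ++ x) by apply: fi; rewrite perm_cons perm_catC.
  by rewrite !fE /=; ring.
rewrite (eq_bigr (fun y => \sum_(v <- words N (q - r)) \sum_(z <- words N r.+1)
   f (y ++ x) * g (y ++ v) * (f (z ++ x) * g (z ++ v)))); last first.
  by move=> y _; rewrite exchange_big.
rewrite exchange_big /=; apply: eq_bigr => v _.
by rewrite expr2 sumrM.
Qed.

Lemma zero_contraction_term p q f g : perm_invariant f -> perm_invariant g ->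
  2^-1 * (\sum_(i < N) \sum_(l < N) ((p - 0 + (q - 0))`!%:R *
    \sum_(t : (p - 0 + (q - 0)).-tuple 'I_N)
    (symz (ctensor p 0 (fun s => f (i :: s)) (fun s => g (l :: s))) t -
     symz (ctensor p 0 (fun s => f (l :: s)) (fun s => g (i :: s))) t) ^+ 2)) =
  \sum_(r < (minn p q).+1) (p`! * q`! * 'C(p, r) * 'C(q, r))%:R *
    (contr_sqnorm r p.+1 q.+1 f g - contr_sqnorm r.+1 p.+1 q.+1 f g).
Proof.
move=> fi gi.
pose S i l i' l' := (p - 0 + (q - 0))`!%:R * \sum_(t : (p - 0 + (q - 0)).-tuple 'I_N)
    symz (ctensor p 0 (fun s => f (i :: s)) (fun s => g (l :: s))) t *
    symz (ctensor p 0 (fun s => f (i' :: s)) (fun s => g (l' :: s))) t.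
have SE i l i' l' : S i l i' l' = \sum_(r < (minn p q).+1)
    (p`! * q`! * 'C(p, r) * 'C(q, r))%:R *
    quad r p q (fun s => f (i :: s)) (fun s => g (l :: s))
               (fun s => f (i' :: s)) (fun s => g (l' :: s)).
  by rewrite /S symz_inner//; exact: perm_invariant_cons.
transitivity (2^-1 * (\sum_(i < N) \sum_(l < N)
    (S i l i l + S l i l i - (S i l l i + S i l l i)))).
  congr (_ * _); apply: eq_bigr => i _; apply: eq_bigr => l _.
  rewrite /S -!mulrDr -mulrBr; congr (_ * _).
  rewrite -!big_split -sumrB; apply: eq_bigr => t _ /=; ring.
(* Renaming [i] and [l] identifies the two squares of the expansion; together with the doubled cross
   term this cancels the factor one half. *)
transitivity (\sum_(i < N) \sum_(l < N) S i l i l - \sum_(i < N) \sum_(l < N) S i l l i).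
  have e : \sum_(i < N) \sum_(l < N) S l i l i = \sum_(i < N) \sum_(l < N) S i l i l.
    by rewrite exchange_big.
  under eq_bigr => i _ do rewrite sumrB !big_split /=.
  by rewrite sumrB !big_split /= e; field.
under [RHS]eq_bigr => r _ do rewrite mulrBr.
rewrite sumrB; congr (_ - _).
  under eq_bigr => i _ do (under eq_bigr => l _ do rewrite SE).
  under eq_bigr => i _ do rewrite exchange_big.
  rewrite exchange_big /=; apply: eq_bigr => r _.
  rewrite -quad_diag// ?mulr_sumr; last by rewrite -ltnS.
  by apply: eq_bigr => i _; rewrite mulr_sumr.
under eq_bigr => i _ do (under eq_bigr => l _ do rewrite SE).
under eq_bigr => i _ do rewrite exchange_big.
rewrite exchange_big /=; apply: eq_bigr => r _.
rewrite -quad_cross// ?mulr_sumr; last by rewrite -ltnS.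
by apply: eq_bigr => i _; rewrite mulr_sumr.
Qed.

End ZeroContraction.

(** * Ryser's formula for permanents *)

Section Ryser.
Local Open Scope set_scope.
Local Open Scope ring_scope.
Variable R : realType.

(** Toggling a fixed point outside [A] is a sign-reversing involution on the sets that contain
    [A]. *)
Lemma subset_alternating p (A : {set 'I_p}) : A != finset.setT ->
  \sum_(S : {set 'I_p} | A \subset S) (-1) ^+ #|~: S| = 0 :> R.
Proof.
rewrite -finset.subTset => /fintype.subsetPn[x _ xA].
pose h (S : {set 'I_p}) := if x \in S then S :\ x else x |: S.
have hK : involutive h.
  move=> S; rewrite /h; case: (boolP (x \in S)) => xS.
    by rewrite finset.setD11 finset.setD1K.
  by rewrite finset.setU11 finset.setU1K.
have hA S : (A \subset h S) = (A \subset S).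
  rewrite /h; case: ifPn => xS; first by rewrite finset.subsetD1 xA andbT.
  apply/idP/idP => [/fintype.subsetP AS|AS]; last exact: (fintype.subset_trans AS (finset.subsetUr _ _)).
  apply/fintype.subsetP => y yA; have /finset.setU1P[yx|//] := AS _ yA.
  by rewrite -yx yA in xA.
have hS S : (-1) ^+ #|~: h S| = - (-1) ^+ #|~: S| :> R.
  rewrite /h; case: ifPn => xS.
    by rewrite finset.setCD finset.setUC cardsU1 inE xS /= exprS mulN1r.
  rewrite [in RHS](cardsD1 x) inE xS exprS mulN1r opprK; congr (_ ^+ _).
  by congr #|_|%SET; rewrite finset.setCU finset.setDE finset.setIC.
set e := LHS; have : e = - e.
  rewrite {1}/e (reindex_inj (inv_inj hK)) /= (eq_bigl _ _ hA) /e -sumrN.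
  by apply: eq_bigr => S _; rewrite hS.
by move/eqP; rewrite -addr_eq0 -mulr2n mulrn_eq0 => /eqP.
Qed.

(** Expanding the right side over all maps, each map is weighted by the alternating sum over the
    sets containing its image, which vanishes unless the map is onto, that is a permutation. For
    matrices of zeros and ones this is the polarization identity. *)
Lemma ryser p (M : 'I_p -> 'I_p -> R) :
  \sum_(s : 'S_p) \prod_j M (s j) j =
  \sum_(S : {set 'I_p}) (-1) ^+ #|~: S| * \prod_j \sum_(i in S) M i j.
Proof.
under [RHS]eq_bigr => S _ do rewrite bigA_distr_big mulr_sumr.
rewrite (exchange_big_dep xpredT)//=.
rewrite (eq_bigr (fun f : {ffun 'I_p -> 'I_p} => if injectiveb f then \prod_j M (f j) j else 0)).
  rewrite -big_mkcond (reindex (@pval _)) /=; last first.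
    pose in_Sn := insubd (1%g : 'S_p).
    exists in_Sn => /= f; rewrite inE => Uf.
      by apply: val_inj; rewrite val_insubd Uf.
    by rewrite -[LHS]/(\val (in_Sn _)) val_insubd Uf.
  by apply: eq_big => [s|s _]; [case: s => f /= ->|apply: eq_bigr => j _; rewrite pvalE].
move=> f _; rewrite -mulr_suml.
rewrite (eq_bigl (fun S : {set 'I_p} => [set f j | j in 'I_p] \subset S)); last first.
  move=> S; apply/idP/fintype.subsetP => [/ffun_onP fS y /imsetP[j _ ->]//|fS].
  by apply/ffun_onP => j; apply: fS; exact: imset_f.
case: ifPn => [/injectiveP fI|fI].
  rewrite (big_pred1 finset.setT) ?finset.setCT ?cards0 ?expr0 ?mul1r// => S /=.
  have -> : [set f j | j in 'I_p] = finset.setT.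
    by apply/eqP; rewrite eqEcard finset.subsetT card_imset//= cardsT leqnn.
  by rewrite finset.subTset.
rewrite subset_alternating ?mul0r//; apply: contra fI => /eqP fT.
apply/injectiveP => x y; suff /imset_injP fi : #|[set f j | j in 'I_p]%SET| == #|'I_p| by exact: fi.
by rewrite fT cardsT.
Qed.

End Ryser.

(** * Polarization and Hermite polynomials *)

Section Polarization.
Variables (R : realType) (N : nat).

(** A symmetric tensor is the sum over words [t] of [a t] times the symmetrized elementary tensor of
    [t]. Ryser's formula writes the latter as a signed sum over sets [S] of powers of the vector
    [sum_(k in S) e_(t_k)]. Dividing this vector by its norm [nc] moves the factor [nc ^+ n] into
    the weight. *)
Lemma polarization p (a : seq 'I_N -> R) : (0 < N)%N -> perm_invariant a ->
  exists r : seq (R * {ffun 'I_N -> R}),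
    all (fun x : R * {ffun 'I_N -> R} => \sum_i x.2 i ^+ 2 == 1) r /\
    forall s, size s = p -> a s = \sum_(x <- r) x.1 * \prod_(i <- s) x.2 i.
Proof.
case: p => [|p] N0 ai.
  (* In order 0 every power is 1, so the first coordinate vector, available since [0 < N], will
     do. *)
  exists [:: (a [::], [ffun i => (i == Ordinal N0)%:R])]; split.
    rewrite /= andbT (bigD1 (Ordinal N0))//= ffunE eqxx expr1n big1 ?addr0//.
    by move=> i /negbTE iN; rewrite ffunE iN expr0n.
  by move=> s /size0nil ->; rewrite big_seq1 big_nil mulr1.
pose n := p.+1.
pose c (x : n.-tuple 'I_N * {set 'I_n}) (i : 'I_N) : R :=
  \sum_(k in x.2) (tnth x.1 k == i)%:R.
pose nc x := Num.sqrt (\sum_i c x i ^+ 2).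
have nc0 x : 0 <= \sum_i c x i ^+ 2 by apply: sumr_ge0 => i _; exact: sqr_ge0.
pose d (x : n.-tuple 'I_N * {set 'I_n}) : R :=
  n`!%:R^-1 * (a x.1 * (-1) ^+ #|~: x.2|).
exists [seq (d x * nc x ^+ n, [ffun i => c x i / nc x]) |
   x <- enum {: n.-tuple 'I_N * {set 'I_n}} & nc x != 0]; split.
  apply/allP => y /mapP[x] + ->; rewrite mem_filter => /andP[ncx _].
  apply/eqP; under eq_bigr => i _ do rewrite /= ffunE expr_div_n.
  rewrite -mulr_suml sqr_sqrtr// divff//.
  by apply: contra ncx => /eqP x0; rewrite /nc x0 sqrtr0.
move=> s sn; pose t0 : n.-tuple 'I_N := tcast sn (in_tuple s).
have st : s = t0 by rewrite val_tcast.
rewrite big_map big_filter big_enum_cond /= big_mkcond.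
transitivity (\sum_(x : n.-tuple 'I_N * {set 'I_n}) d x * \prod_(i <- s) c x i); last first.
  apply: eq_bigr => x _; case: ifPn => [ncx|/negPn/eqP ncx].
    rewrite -mulrA; congr (_ * _).
    rewrite (_ : n = size s)//; elim: s {sn t0 st} => [|i s IH] /=.
      by rewrite !big_nil mulr1.
    by rewrite !big_cons IH ffunE exprS; field.
  (* Zero vectors cannot be normalized and were filtered out; their powers vanish because the order
     is positive. *)
  have c0 i : c x i = 0.
    have : \sum_i c x i ^+ 2 == 0.
      by rewrite eq_le nc0 andbT -sqrtr_eq0 -/(nc x) ncx.
    rewrite psumr_eq0; last by move=> j _; exact: sqr_ge0.
    by move/allP/(_ i (mem_index_enum _)) => /=; rewrite sqrf_eq0 => /eqP.
  by case: s sn {t0 st} => // i s _; rewrite big_cons c0 mul0r mulr0.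
rewrite -(pair_bigA _ (fun t S => d (t, S) * \prod_(i <- s) c (t, S) i)) /=.
transitivity (\sum_(t : n.-tuple 'I_N) n`!%:R^-1 * (a t *
    \sum_(u : 'S_n) \prod_j (tnth t (u j) == tnth t0 j)%:R)); last first.
  apply: eq_bigr => t _; rewrite (ryser (fun k j => (tnth t k == tnth t0 j)%:R)).
  rewrite !mulr_sumr; apply: eq_bigr => S _; rewrite /d /= !mulrA; congr (_ * _).
  by rewrite st big_tuple.
under eq_bigr => t _ do rewrite !mulr_sumr.
rewrite exchange_big /=.
rewrite (eq_bigr (fun=> n`!%:R^-1 * a t0)).
  have nf : n`!%:R != 0 :> R by rewrite pnatr_eq0 -lt0n fact_gt0.
  by rewrite sumr_const card_Sn -[RHS]mulr_natl mulrA divff// mul1r [in LHS]st.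
(* For a fixed permutation only one word contributes, a rearrangement of [t0], and [a] takes the
   same value there. *)
move=> u _; rewrite (bigD1 [tuple tnth t0 (u^-1%g k) | k < n])//=.
rewrite [X in _ + X]big1 ?addr0; last first.
  move=> t tn; rewrite [\prod_j _](_ : _ = 0) ?mulr0//.
  have [j tj] : exists j, tnth t (u j) != tnth t0 j.
    apply/existsP; rewrite -negb_forall; apply: contra tn => /forallP tu.
    apply/eqP/eq_from_tnth => k; rewrite tnth_mktuple -(eqP (tu _)).
    by rewrite permKV.
  by rewrite (bigD1 j)//= (negbTE tj) mul0r.
rewrite [\prod_j _](_ : _ = 1) ?mulr1; last first.
  by apply: big1 => j _; rewrite tnth_mktuple permK eqxx.
congr (_ * _); apply: ai; apply/tuple_permP.
by exists (u^-1)%g.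
Qed.

Lemma deriv_hermite p : (hermite R p.+1)^`() = p.+1%:R *: hermite R p.
Proof.
elim: p => [|p IH].
  by rewrite /hermite /= mulr1 -polyC1 derivC subr0 derivX scale1r.
rewrite -[hermite R p.+2]/('X * hermite R p.+1 - (hermite R p.+1)^`()).
rewrite derivB derivM derivX IH derivZ mul1r.
rewrite -[in RHS]natr1 scalerDl scale1r addrC.
rewrite -[in X in _ = X + _]/('X * hermite R p - (hermite R p)^`()).
by rewrite scalerBr -scalerAr addrA; ring.
Qed.

Lemma hermiteSS p (x : R) : (hermite R p.+2).[x] =
  x * (hermite R p.+1).[x] - p.+1%:R * (hermite R p).[x].
Proof.
rewrite -[hermite R p.+2]/('X * hermite R p.+1 - (hermite R p.+1)^`()).
by rewrite deriv_hermite !hornerE.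
Qed.

(** Both sides satisfy the three-term recurrence of [hermiteSS] with the same first two values; unit
    norm makes the coefficient of the lower term equal to [q.+1]. *)
Lemma chaos_power p (c : 'I_N -> R) (x : 'I_N -> R) : \sum_i c i ^+ 2 = 1 ->
  meval x (chaos p (fun s => \prod_(i <- s) c i)) =
  (hermite R p).[\sum_i c i * x i].
Proof.
move=> c1; set a := fun s => _.
have ai : perm_invariant a by move=> s t; exact: perm_big.
have aS q i : chaos q (fun s => a (i :: s)) = c i *: chaos q a.
  by rewrite -chaosZ; apply: eq_chaos => s _; rewrite /a big_cons.
have mevals (f : 'I_N -> mpoly N R) : meval x (\sum_i f i) = \sum_i meval x (f i).
  by apply: (big_morph (meval x)); [exact: mevalD|exact: meval0].
have mS q : meval x (chaos q.+2 a) =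
    (\sum_i c i * x i) * meval x (chaos q.+1 a) - q.+1%:R * meval x (chaos q a).
  rewrite [chaos q.+2 a]/= -/(chaos q.+1) mevals.
  under eq_bigr => i _ do rewrite -[X in delta i X]/(chaos q.+1 (fun s => a (i :: s))) aS deltaZ mevalZ
    /delta mevalB mevalM mevalXU mderiv_chaos// aS !mevalZ /= mulrBr mulrA.
  rewrite sumrB mulr_suml; congr (_ - _); first by apply: eq_bigr => i _; exact: mulrA.
  transitivity ((\sum_i c i ^+ 2) * (q.+1%:R * meval x (chaos q a))).
    by rewrite mulr_suml; apply: eq_bigr => i _; ring.
  by rewrite c1 mul1r.
suff : meval x (chaos p a) = (hermite R p).[\sum_i c i * x i] /\
  meval x (chaos p.+1 a) = (hermite R p.+1).[\sum_i c i * x i] by case.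
elim: p => [|p [IH1 IH2]]; last by split => //; rewrite mS hermiteSS IH1 IH2.
split; first by rewrite /= mevalC /a big_nil hornerE.
rewrite mevals /hermite /= -polyC1 derivC subr0 mulr1 hornerX; apply: eq_bigr => i _.
by rewrite /delta mevalB mevalM mevalXU mderivC meval0 subr0 mevalC /a big_seq1 mulrC.
Qed.

End Polarization.

(** * Gaussian variables *)

Section RealIntegrals.
Context d (T : measurableType d) (R : realType).
Variable mu : {measure set T -> \bar R}.
Implicit Types (f g h : T -> R).

(** Integrability of real-valued functions, paired with [Rintegral] so that computations stay in [R]
    wherever finiteness is known. *)
Definition L1 f := mu.-integrable setT (EFin \o f).

Lemma L1_measurable f : L1 f -> measurable_fun setT f.
Proof. by move/measurable_int/measurable_EFinP. Qed.

Lemma L1_le f g : measurable_fun setT f -> (forall x, `|f x| <= g x) -> L1 g -> L1 f.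
Proof.
move=> mf fg; apply: le_integrable => //; first exact/measurable_EFinP.
by move=> x _; rewrite /= lee_fin (le_trans (fg x))// ler_norm.
Qed.

Lemma eq_L1 f g : f =1 g -> L1 f -> L1 g.
Proof. by move=> /funext ->. Qed.

Lemma L1D f g : L1 f -> L1 g -> L1 (fun x => f x + g x).
Proof. by move=> lf lg; apply: eq_integrable (integrableD measurableT lf lg). Qed.

Lemma L1Z c f : L1 f -> L1 (fun x => c * f x).
Proof. by move=> lf; apply: eq_integrable (integrableZl measurableT c lf). Qed.

Lemma L1N f : L1 f -> L1 (fun x => - f x).
Proof. by move=> lf; apply: eq_L1 (L1Z (-1) lf) => x; rewrite mulN1r. Qed.

Lemma L1B f g : L1 f -> L1 g -> L1 (fun x => f x - g x).
Proof. by move=> lf lg; apply: L1D lf (L1N lg). Qed.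

Lemma L1_0 : L1 (fun=> 0).
Proof. exact: integrable0. Qed.

Lemma L1_norm f : L1 f -> L1 (fun x => `|f x|).
Proof. by move=> lf; apply: eq_integrable (integrable_abse lf). Qed.

Lemma L1_sum (J : Type) (r : seq J) (F : J -> T -> R) :
  (forall j, L1 (F j)) -> L1 (fun x => \sum_(j <- r) F j x).
Proof.
move=> lF; elim: r => [|j r IH].
  by apply: eq_L1 L1_0 => x; rewrite big_nil.
by apply: eq_L1 (L1D (lF j) IH) => x; rewrite big_cons.
Qed.

Lemma RI0 : \int[mu]_(x in setT) (0 : R) = 0.
Proof. by rewrite /Rintegral integral0. Qed.

Lemma RI_sum (J : Type) (r : seq J) (F : J -> T -> R) :
  (forall j, L1 (F j)) ->
  \int[mu]_x (\sum_(j <- r) F j x) = \sum_(j <- r) \int[mu]_x F j x.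
Proof.
move=> lF; elim: r => [|j r IH].
  by rewrite big_nil -[RHS]RI0; apply: eq_Rintegral => x _; rewrite big_nil.
rewrite big_cons -IH -RintegralD//; [|exact: lF|exact: L1_sum].
by apply: eq_Rintegral => x _; rewrite big_cons.
Qed.


Lemma EFin_RI f : L1 f -> ((\int[mu]_x f x)%:E = \int[mu]_x (f x)%:E)%E.
Proof. by move=> lf; rewrite fineK//; apply: integrable_fin_num. Qed.

Lemma RI_le f g : L1 f -> L1 g -> (forall x, f x <= g x) ->
  \int[mu]_x f x <= \int[mu]_x g x.
Proof. by move=> lf lg fg; apply: le_Rintegral. Qed.

Lemma RI_norm f : L1 f -> `|\int[mu]_x f x| <= \int[mu]_x `|f x|.
Proof. exact: le_normr_Rintegral. Qed.

Lemma RI_ae f g : measurable_fun setT f -> measurable_fun setT g ->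
  f = g %[ae mu] -> \int[mu]_x f x = \int[mu]_x g x.
Proof.
move=> mf mg fg; congr fine; apply: ae_eq_integral => //.
- exact/measurable_EFinP.
- exact/measurable_EFinP.
- by apply: filterS fg => x /= fgx _; rewrite fgx.
Qed.

Lemma L1_ae f g : measurable_fun setT f -> L1 g ->
  f = g %[ae mu] -> L1 f.
Proof.
move=> mf lg fg; have [mg ig] := integrableP _ _ _ lg; apply/integrableP; split.
  exact/measurable_EFinP.
rewrite (ae_eq_integral (EFin \o (fun x => `|g x|)))//.
- by apply/measurable_EFinP; apply: measurableT_comp.
- by apply/measurable_EFinP; apply: measurableT_comp => //; exact: L1_measurable.
- by apply: filterS fg => x /= fgx _; rewrite fgx.
Qed.

Lemma RI_dct (f_ : nat -> T -> R) f g :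
  (forall n, measurable_fun setT (f_ n)) -> measurable_fun setT f ->
  (forall x, f_ ^~ x @ \oo --> f x) -> L1 g ->
  (forall n x, `|f_ n x| <= g x) ->
  L1 f /\ (fun n => \int[mu]_x f_ n x) @ \oo --> \int[mu]_x f x.
Proof.
move=> mf_ mf f_f lg fg.
have [] := @dominated_convergence _ T R mu setT measurableT
   (fun n => EFin \o f_ n) (EFin \o f) (EFin \o g).
- by move=> n; exact/measurable_EFinP.
- exact/measurable_EFinP.
- by apply: aeW => x _; apply: cvg_EFin; [exact: nearW|exact: f_f].
- exact: lg.
- by apply: aeW => x n _; rewrite /= lee_fin.
move=> lf _ cf; split=> //; apply: fine_cvg; rewrite EFin_RI//.
Qed.

End RealIntegrals.

(** * Integration against a measure with a density *)

Section Density.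
Context d (T : measurableType d) (R : realType).
Variables (mu nu : {measure set T -> \bar R}) (p : T -> R).
Hypothesis mp : measurable_fun setT p.
Hypothesis p0 : forall x, 0 <= p x.
Hypothesis nuE : forall A, measurable A -> (nu A = \int[mu]_(x in A) (p x)%:E)%E.
Import HBNNSimple.
Local Open Scope ereal_scope.

Lemma density_nnsfun (f : {nnsfun T >-> R}) :
  \int[nu]_x (f x)%:E = \int[mu]_x ((f x)%:E * (p x)%:E).
Proof.
under [LHS]eq_integral do rewrite fimfunE -fsumEFin//.
rewrite [LHS]ge0_integral_fsum//; last 2 first.
  - by move=> r; exact/measurable_EFinP/measurableT_comp.
  - by move=> n x _; rewrite EFinM nnfun_muleindic_ge0.
under [RHS]eq_integral.
  move=> x xD; rewrite fimfunE -fsumEFin// ge0_mule_fsuml; last first.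
    by move=> r; rewrite EFinM nnfun_muleindic_ge0.
  over.
rewrite [RHS]ge0_integral_fsum//; last 2 first.
  - move=> r; apply: emeasurable_funM; last exact/measurable_EFinP.
    by apply/measurable_EFinP/measurableT_comp.
  - by move=> n x _; rewrite mule_ge0 ?lee_fin// -lee_fin EFinM nnfun_muleindic_ge0.
apply: eq_fsbigr => r _.
have mr : measurable (f @^-1` [set r]) by exact: measurable_sfunP.
under [RHS]eq_integral do rewrite EFinM -muleA.
have [r0|r0] := ltP r 0%R.
  by rewrite preimage_nnfun0// indic0 !integral0_eq// => x _ /=; rewrite ?mulr0 ?mul0e ?mule0.
rewrite ge0_integralZl//; last 2 first.
- apply: emeasurable_funM; last exact/measurable_EFinP.
  exact/measurable_EFinP.
- by move=> x _; rewrite mule_ge0// lee_fin.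
rewrite integralZl_indic_nnsfun//= integral_indic// setIT nuE//; congr (_ * _).
rewrite [LHS]integral_mkcond; apply: eq_integral => x _.
by rewrite patchE indicE; case: ifPn => _; rewrite ?mul1e ?mul0e.
Qed.

Lemma ge0_integral_density (f : T -> \bar R) :
  measurable_fun setT f -> (forall x, 0 <= f x) ->
  \int[nu]_x f x = \int[mu]_x (f x * (p x)%:E).
Proof.
move=> mf f0; pose f_ := nnsfun_approx measurableT mf.
transitivity (lim (\int[nu]_x (f_ n x)%:E @[n --> \oo])).
  rewrite -monotone_convergence//=.
  - apply: eq_integral => ? /[!inE] xD; apply/esym/cvg_lim => //=.
    exact: cvg_nnsfun_approx.
  - by move=> n; exact/measurable_EFinP/measurable_funTS.
  - by move=> n ? _; rewrite lee_fin.
  - by move=> ? _ ? ? mn; rewrite lee_fin; exact/lefP/nd_nnsfun_approx.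
transitivity (lim (\int[mu]_x ((f_ n x)%:E * (p x)%:E) @[n --> \oo])).
  by apply: congr_lim; apply/funext => n /=; exact: density_nnsfun.
rewrite -monotone_convergence//=.
- apply: eq_integral => x _; apply/cvg_lim => //.
  by apply: cvgeZr => //; exact: cvg_nnsfun_approx.
- move=> n; apply: emeasurable_funM; last exact/measurable_EFinP.
  exact/measurable_EFinP/measurable_funTS.
- by move=> n x _; rewrite mule_ge0// lee_fin.
- move=> x _ m n mn; rewrite lee_wpmul2r ?lee_fin//.
  exact/lefP/nd_nnsfun_approx.
Qed.

Lemma integral_density (f : T -> R) : measurable_fun setT f ->
  (nu.-integrable setT (EFin \o f) <-> mu.-integrable setT (fun x => (f x * p x)%:E)) /\
  \int[nu]_x (f x)%:E = \int[mu]_x (f x * p x)%:E.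
Proof.
move=> mf; have mfp : measurable_fun setT (fun x => f x * p x)%R by exact: measurable_funM.
split.
  split=> /integrableP[_ i]; apply/integrableP; split => //;
    [exact/measurable_EFinP| |exact/measurable_EFinP|]; move: i.
    rewrite ge0_integral_density//; last by apply/measurable_EFinP; exact: measurableT_comp.
    apply: le_lt_trans; rewrite le_eqVlt; apply/orP; left; apply/eqP.
    by apply: eq_integral => x _; rewrite /= normrM (ger0_norm (p0 x)).
  apply: le_lt_trans; rewrite ge0_integral_density//; last by apply/measurable_EFinP; exact: measurableT_comp.
  rewrite le_eqVlt; apply/orP; left; apply/eqP.
  by apply: eq_integral => x _; rewrite /= normrM (ger0_norm (p0 x)).
rewrite [LHS]integralE [RHS]integralE !ge0_integral_density//.
- congr (_ - _); apply: eq_integral => x _.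
    by rewrite !funeposE /= -!EFin_max -EFinM maxr_pMl// mul0r.
  by rewrite !funenegE /= -!EFin_max -EFinM maxr_pMl// mul0r mulNr.
- by apply: measurable_funeneg; exact/measurable_EFinP.
- by apply: measurable_funepos; exact/measurable_EFinP.
Qed.

End Density.
Section DerivativeRules.
Variable R : realType.
Implicit Types (f g : R -> R) (x a b c : R).

Lemma derM f g x a b : is_derive x (1 : R) f a -> is_derive x (1 : R) g b ->
  is_derive x (1 : R) (fun y => f y * g y) (a * g x + f x * b).
Proof.
move=> df dg; have := is_deriveM df dg; rewrite -[f * g]/(fun y => f y * g y).
by move=> h; apply: (is_derive_eq h); rewrite -![_ *: _]/(_ * _) addrC mulrC.
Qed.

Lemma derZ c f x a : is_derive x (1 : R) f a ->
  is_derive x (1 : R) (fun y => c * f y) (c * a).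
Proof. exact: is_deriveZ. Qed.

Lemma derD f g x a b : is_derive x (1 : R) f a -> is_derive x (1 : R) g b ->
  is_derive x (1 : R) (fun y => f y + g y) (a + b).
Proof. exact: is_deriveD. Qed.

Lemma der_comp f g x a b : is_derive (g x) (1 : R) f a -> is_derive x (1 : R) g b ->
  is_derive x (1 : R) (fun y => f (g y)) (a * b).
Proof. exact: is_derive1_comp. Qed.

Lemma der_affine a b x : is_derive x (1 : R) (fun y => a * y + b) a.
Proof.
have h := derD (derZ a (is_derive_id x (1 : R))) (is_derive_cst b x (1 : R)).
by apply: (is_derive_eq h); rewrite mulr1 addr0.
Qed.

Lemma der_continuous f f' : (forall x, is_derive x (1 : R) f (f' x)) -> continuous f.
Proof.
by move=> df x; apply/differentiable_continuous/derivable1_diffP; case: (df x).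
Qed.

End DerivativeRules.

(** * Growth and decay of the normal density *)

Section NormalLaw.
Variable R : realType.
Implicit Types (x s C : R) (f : R -> R).
Local Notation leb := (@lebesgue_measure R).

Definition poly_bounded f := exists C (p : nat), forall x, `|f x| <= C * (1 + `|x|) ^+ p.

Variable s : R.
Hypothesis s0 : 0 < s.
Let s2 := Num.sqrt (s ^+ 2 *+ 2).
Notation rho := (normal_pdf 0 s).

Let s2_gt0 : 0 < s2.
Proof. by rewrite sqrtr_gt0 pmulrn_lgt0// exprn_gt0. Qed.

Let sqr_s2 : s2 ^+ 2 = s ^+ 2 *+ 2.
Proof. by rewrite sqr_sqrtr// mulrn_wge0// sqr_ge0. Qed.

Let rhoE x : rho x = normal_peak s * expR (- x ^+ 2 / (s ^+ 2 *+ 2)).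
Proof. by rewrite normal_pdfE ?gt_eqF// /normal_fun subr0. Qed.

Lemma exprn_le_expR (p : nat) x : 0 <= x -> x ^+ p <= p`!%:R * expR x.
Proof.
move=> x0; case: p => [|p].
  by rewrite expr0 fact0 mul1r (le_trans _ (expR_ge1Dx x))// lerDl.
rewrite mulrC -ler_pdivrMr ?ltr0n ?fact_gt0//.
by apply: le_trans (expR_ge1Dxn p x0); rewrite lerDr.
Qed.

(** A polynomial factor costs a factor [sqrt 2] in the standard deviation: the power is bounded by
    [p!] times an exponential, and completing the square gives [|x| - x^2 / (2 s^2) <= s^2 - x^2 /
    (4 s^2)]. This is where the constant [expR (1 + s ^+ 2)] comes from. *)
Lemma normal_pdf_growth (p : nat) : exists2 K, 0 <= K &
  forall x, (1 + `|x|) ^+ p * rho x <= K * normal_pdf 0 s2 x.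
Proof.
have k2 : 0 < normal_peak s2 by rewrite normal_peak_gt0// gt_eqF.
have k1 : 0 < normal_peak s by rewrite normal_peak_gt0// gt_eqF.
exists (p`!%:R * expR (1 + s ^+ 2) * normal_peak s / normal_peak s2).
  by rewrite !mulr_ge0// ?invr_ge0 ?expR_ge0// ltW.
move=> x; have -> : normal_pdf 0 s2 x =
    normal_peak s2 * expR (- x ^+ 2 / (s ^+ 2 *+ 2 *+ 2)).
  by rewrite normal_pdfE ?gt_eqF// /normal_fun subr0 sqr_s2.
have x1 : 0 <= 1 + `|x| by rewrite addr_ge0.
apply: (@le_trans _ _ (p`!%:R * expR (1 + `|x|) * rho x)).
  by rewrite ler_wpM2r ?normal_pdf_ge0//; exact: exprn_le_expR.
rewrite mulrA divfK ?gt_eqF// rhoE.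
set P := p`!%:R; set k := normal_peak s.
rewrite (_ : P * _ * _ = P * k * (expR (1 + `|x|) * expR (- x ^+ 2 / (s ^+ 2 *+ 2)))); last by ring.
rewrite (_ : P * _ * _ * _ = P * k * (expR (1 + s ^+ 2) * expR (- x ^+ 2 / (s ^+ 2 *+ 2 *+ 2)))); last by ring.
apply: ler_wpM2l; first by rewrite mulr_ge0// ltW.
rewrite -!expRD ler_expR -!addrA lerD2l -subr_ge0.
have -> : s ^+ 2 + - x ^+ 2 / (s ^+ 2 *+ 2 *+ 2) - (`|x| + - x ^+ 2 / (s ^+ 2 *+ 2)) =
    (`|x| / (s *+ 2) - s) ^+ 2.
  by rewrite -(real_normK (num_real x)); field; rewrite gt_eqF.
exact: sqr_ge0.
Qed.

Lemma integrable_poly_bounded f : measurable_fun setT f -> poly_bounded f ->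
  L1 leb (fun x => f x * rho x).
Proof.
move=> mf [C [p fC]]; have [K K0 hK] := normal_pdf_growth p.
have lK : L1 leb (fun x => C * K * normal_pdf 0 s2 x).
  by apply: L1Z; exact: integrable_normal_pdf.
have C0 : 0 <= C.
  have := fC 0; rewrite normr0 addr0 expr1n mulr1; apply: le_trans.
  exact: normr_ge0.
apply: (L1_le _ _ lK).
  by apply: measurable_funM => //; exact: measurable_normal_pdf.
move=> x; rewrite normrM (ger0_norm (normal_pdf_ge0 _ _ _)).
apply: (le_trans (ler_wpM2r (normal_pdf_ge0 _ _ _) (fC x))).
by rewrite -!mulrA ler_wpM2l.
Qed.

Lemma is_derive_normal_pdf x : is_derive x (1 : R) rho (- x / s ^+ 2 * rho x).
Proof.
pose c : R := - (s ^+ 2 *+ 2)^-1.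
have rE y : rho y = normal_peak s * expR (c * y ^+ 2).
  by rewrite rhoE; congr (_ * expR _); rewrite mulrC mulNr mulrN.
have h1 : is_derive x (1 : R) (fun y : R => c * (y * y)) (c * (1 * x + x * 1)).
  by apply/derZ/derM; exact: is_derive_id.
have := derZ (normal_peak s) (@der_comp R expR (fun y => c * (y * y)) x _ _ (is_derive_expR _) h1).
have -> : rho = fun y => normal_peak s * expR (c * (y * y)).
  by apply/funext => y; rewrite rE expr2.
by move=> h; apply: (is_derive_eq h); rewrite /c; field; rewrite gt_eqF.
Qed.

Lemma cvg_normal_pdf : rho n%:R @[n --> \oo] --> 0.
Proof.
have -> : (fun n : nat => rho n%:R) = (fun n => normal_peak s * gauss_fun (n%:R / s2)).
  apply/funext => n; rewrite rhoE /gauss_fun; congr (_ * expR _).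
  by rewrite expr_div_n sqr_s2 mulNr.
rewrite -[X in _ --> X](mulr0 (normal_peak s)); apply: cvgM; first exact: cvg_cst.
have i0 : 0 < s2^-1 by rewrite invr_gt0.
have c2 : (x / s2 : R) @[x --> +oo] --> +oo by apply: (gt0_cvgMly i0); exact: cvg_id.
exact: (cvg_comp _ _ cvgr_idn (cvg_comp _ _ c2 cvg_gauss_fun)).
Qed.

End NormalLaw.

Section NormalStein.
Variables (R : realType) (s : R).
Hypothesis s0 : 0 < s.
Implicit Types (x C : R) (f : R -> R).
Local Notation leb := (@lebesgue_measure R).
Notation rho := (normal_pdf 0 s).

(** [eta * rho] is a primitive of [(eta' - x eta / s^2) rho] and vanishes at both ends because [eta]
    grows polynomially. *)
Lemma normal_stein (eta eta' : R -> R) :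
  (forall x, is_derive x (1 : R) eta (eta' x)) -> continuous eta' ->
  poly_bounded eta -> poly_bounded eta' ->
  \int[leb]_x ((x * eta x) * rho x) = s ^+ 2 * \int[leb]_x (eta' x * rho x).
Proof.
move=> deta ceta' peta peta'.
have ceta := der_continuous deta.
have mC f : continuous f -> measurable_fun setT f by move=> ?; exact: continuous_measurable_fun.
have px : poly_bounded (fun x => x * eta x).
  have [C [p hC]] := peta; exists C, p.+1 => x; rewrite normrM exprS mulrCA.
  by apply: ler_pM => //; rewrite lerDr.
have lx : L1 leb (fun x => (x * eta x) * rho x).
  apply: (integrable_poly_bounded s0) px; apply: mC => x.
  by apply: cvgM; [exact: cvg_id|exact: ceta].
have l' : L1 leb (fun x => eta' x * rho x) by apply: (integrable_poly_bounded s0) peta'; exact: mC.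
have crho : continuous rho by apply: continuous_normal_pdf; rewrite gt_eqF.
pose h x := eta' x * rho x - s ^- 2 * (x * eta x * rho x).
have lh : L1 leb h by apply: L1B => //; exact: L1Z.
have ch : continuous h.
  move=> x; apply: cvgB; first by apply: cvgM; [exact: ceta'|exact: crho].
  apply: cvgM; first exact: cvg_cst.
  by apply: cvgM; [apply: cvgM; [exact: cvg_id|exact: ceta]|exact: crho].
pose G x := eta x * rho x.
have dG x : is_derive x (1 : R) G (h x).
  have := derM (deta x) (is_derive_normal_pdf s0 x).
  by move=> k; apply: (is_derive_eq k); rewrite /h; field; rewrite gt_eqF.
have cG := der_continuous dG.
suff h0 : \int[leb]_x h x = 0.
  move: h0; rewrite RintegralB//; last exact: L1Z.
  rewrite RintegralZl// => /eqP; rewrite subr_eq0 => /eqP ->.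
  by rewrite mulrA divff ?mul1r// gt_eqF// exprn_gt0.
pose I (n : nat) : set R := `[- n.+1%:R, n.+1%:R]%classic.
have mI n : measurable (I n) by exact: measurable_itv.
have [_ cvh] : L1 leb h /\ (fun n => \int[leb]_x (h x * \1_(I n) x)) @ \oo --> \int[leb]_x h x.
  apply: (@RI_dct _ _ _ leb (fun n x => h x * \1_(I n) x) h (fun x => `|h x|)).
  - by move=> n; apply: measurable_funM; [exact: mC|exact: (@measurable_indic _ _ _ setT (I n))].
  - exact: mC.
  - move=> x; apply: cvg_near_cst; near=> n.
    rewrite indicE mem_set ?mulr1// /I /= in_itv/= -ler_norml.
    rewrite (@le_trans _ _ n%:R) ?ler_nat//.
    by near: n; exact: nbhs_infty_ger.
  - exact: L1_norm.
  - by move=> n x; rewrite normrM ler_piMr// indicE; case: (x \in _); rewrite ?normr1 ?normr0.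
have IE n : \int[leb]_x (h x * \1_(I n) x) = G n.+1%:R - G (- n.+1%:R).
  transitivity (\int[leb]_(x in I n) h x).
    rewrite [RHS]Rintegral_mkcond; apply: eq_Rintegral => x _.
    by rewrite patchE indicE; case: ifPn; rewrite ?mulr1 ?mulr0.
  rewrite /Rintegral (@continuous_FTC2 R h G)//.
  - by rewrite -subr_gt0 opprK addr_gt0.
  - exact: continuous_subspaceT.
  - split; first by move=> x _; case: (dG x).
      exact/cvg_at_right_filter/cG.
    exact/cvg_at_left_filter/cG.
  - by move=> x _; rewrite derive1E; case: (dG x).
(* The values [e = 1] and [e = -1] treat the two ends of the interval at once. *)
have G0 (e : R) : `|e| = 1 -> (fun n : nat => G (e * n.+1%:R)) @ \oo --> 0.
  move=> e1; have [C [p hC]] := peta.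
  have [K K0 hK] := normal_pdf_growth s0 p.
  apply: norm_cvg0.
  apply: (@squeeze_cvgr _ _ _ _ (cst 0) (fun n => C * K * normal_pdf 0 (Num.sqrt (s ^+ 2 *+ 2)) n.+1%:R)).
  - apply: nearW => n; rewrite normr_ge0 /= normrM (ger0_norm (normal_pdf_ge0 _ _ _)).
    have -> : normal_pdf 0 s (e * n.+1%:R) = normal_pdf 0 s n.+1%:R.
      rewrite !normal_pdfE ?gt_eqF// /normal_fun !subr0 exprMn.
      by rewrite -(real_normK (num_real e)) e1 expr1n mul1r.
    apply: (le_trans (ler_wpM2r (normal_pdf_ge0 _ _ _) (hC _))).
    rewrite normrM e1 mul1r -!mulrA ler_wpM2l//.
    by have := hC 0; rewrite normr0 addr0 expr1n mulr1; apply: le_trans.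
  - exact: cvg_cst.
  - rewrite -[X in _ --> X](mulr0 (C * K)); apply: cvgM; first exact: cvg_cst.
    have s2 : 0 < Num.sqrt (s ^+ 2 *+ 2) by rewrite sqrtr_gt0 pmulrn_lgt0// exprn_gt0.
    by have := cvg_normal_pdf s2; rewrite -cvg_shiftS.
apply: (cvg_unique _ cvh) => //=.
rewrite (_ : (fun n => _) = (fun n => G (1 * n.+1%:R) - G (-1 * n.+1%:R))); last first.
  by apply/funext => n; rewrite IE mul1r mulN1r.
by rewrite -[X in _ --> X](subr0 0); apply: cvgB; apply: G0; rewrite ?normrN normr1.
Unshelve. all: by end_near. Qed.

End NormalStein.

(** * One centered Gaussian variable *)

Section GaussianVariable.
Context d (T : measurableType d) (R : realType) (P : probability T R).
Implicit Types (X : T -> R) (f : R -> R) (s t c : R).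
Local Notation leb := (@lebesgue_measure R).

Lemma cos_poly_bounded (g : R -> R) : (forall x, `|g x| <= 1) -> poly_bounded g.
Proof. by move=> g1; exists 1, 0%N => x; rewrite expr0 mulr1. Qed.

Lemma L1_cst c : L1 P (fun=> c).
Proof. exact: finite_measure_integrable_cst. Qed.

Lemma RI_cst c : \int[P]_(x in setT) c = c.
Proof.
rewrite /Rintegral integral_cst// (_ : _ setT = 1%E) ?mule1//.
exact: (@probability_setT _ _ _ P).
Qed.

Section Normal.
Variables (X : T -> R) (s : R).
Hypothesis mX : measurable_fun setT X.
Hypothesis s0 : 0 < s.
Hypothesis XE : forall A, measurable A -> P (X @^-1` A) = normal_prob 0 s A.

Let mX_mixin := isMeasurableFun.Build _ _ T (measurableTypeR R) X mX.
Let X' : {mfun T >-> measurableTypeR R} := HB.pack X mX_mixin.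

Let ge0_law (f : R -> \bar R) : measurable_fun setT f -> (forall x, 0 <= f x)%E ->
  (\int[P]_w f (X w) = \int[normal_prob 0 s]_x f x)%E.
Proof.
move=> mf f0; transitivity (\int[pushforward P X']_x f x)%E.
  by rewrite ge0_integral_pushforward.
by apply: (@eq_measure_integral _ _ R setT (normal_prob 0 s) (pushforward P X')) => A mA _; rewrite /= -XE.
Qed.

Let density f := @integral_density _ _ R leb (normal_prob 0 s) (normal_pdf 0 s)
  (measurable_normal_pdf 0 s) (normal_pdf_ge0 0 s) (fun A _ => erefl) f.

Let normal_L1 f : measurable_fun setT f -> poly_bounded f -> L1 P (f \o X).
Proof.
move=> mf pf; have [i _] := density mf.
have /i/integrableP[_ fi] := integrable_poly_bounded s0 mf pf.
apply/integrableP; split; first by apply/measurable_EFinP; exact: measurableT_comp.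
rewrite (ge0_law (f := fun x => `|(f x)%:E|%E))//.
by apply/measurable_EFinP; apply: measurableT_comp.
Qed.

Let normal_RI f : measurable_fun setT f -> poly_bounded f ->
  \int[P]_w f (X w) = \int[leb]_x (f x * normal_pdf 0 s x).
Proof.
move=> mf pf; have [_ fE] := density mf; rewrite /Rintegral -fE; congr fine.
transitivity (\int[pushforward P X']_x (f x)%:E)%E.
  by rewrite integral_pushforward//; [exact/measurable_EFinP|exact: normal_L1].
by apply: (@eq_measure_integral _ _ R setT (normal_prob 0 s) (pushforward P X')) => A mA _; rewrite /= -XE.
Qed.

Let cont_mf f : continuous f -> measurable_fun setT f.
Proof. exact: continuous_measurable_fun. Qed.

Let normal_var_stein (eta eta' : R -> R) :
  (forall x, is_derive x (1 : R) eta (eta' x)) -> continuous eta' ->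
  poly_bounded eta -> poly_bounded eta' ->
  \int[P]_w (X w * eta (X w)) = s ^+ 2 * \int[P]_w (eta' (X w)).
Proof.
move=> de ce pe pe'; rewrite (normal_RI (f := eta'))//; last exact: cont_mf.
rewrite (normal_RI (f := fun x => x * eta x)) ?(normal_stein s0 de)//.
  apply: cont_mf => x; apply: cvgM; first exact: cvg_id.
  exact: (der_continuous de).
have [C [p hC]] := pe; exists C, p.+1 => x; rewrite normrM exprS mulrCA.
by apply: ler_pM => //; rewrite lerDr.
Qed.

(** A characteristic function without complex numbers: the free phase [c] gives the real and the
    imaginary part. *)
Let normal_cos t c :
  \int[P]_w cos (t * X w + c) = cos c * expR (- (s ^+ 2 * t ^+ 2 / 2)).
Proof.
pose phi t := \int[P]_w cos (t * X w + c).
have mcos u : measurable_fun setT (fun x : R => cos (u * x + c)).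
  apply: cont_mf; apply: (@der_continuous _ _ (fun x => - sin (u * x + c) * u)) => x.
  by apply: (@der_comp _ cos (fun x => u * x + c)); exact: der_affine.
have L1cos u : L1 P (fun w => cos (u * X w + c)).
  apply: (normal_L1 (f := fun x => cos (u * x + c))) => //.
  by apply: cos_poly_bounded => x; rewrite cos_max.
have L1X : L1 P (fun w => `|X w|).
  apply: (normal_L1 (f := fun x => `|x|)); first by apply: cont_mf; exact: norm_continuous.
  by exists 1, 1%N => x; rewrite normr_id mul1r expr1 lerDr.
pose f (u : R) (w : T) := cos (u * X w + c).
have fdf u w : is_derive u (1 : R) (f ^~ w) (- sin (u * X w + c) * X w).
  apply: (@der_comp _ cos (fun u => u * X w + c)).
  have -> : (fun u => u * X w + c) = (fun u => X w * u + c) by apply/funext => v; rewrite mulrC.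
  exact: der_affine.
have d1f u w : (partial1of2 f) u w = - sin (u * X w + c) * X w.
  by rewrite /partial1of2 derive1E; case: (fdf u w).
(* Differentiation under the integral produces [- E[X sin (u X + c)]], which Stein's identity turns
   into the linear equation [phi' = - s^2 u phi]; [psi] below is its integrating factor at work. *)
have dphi u : is_derive u (1 : R) phi (- (s ^+ 2 * u) * phi u).
  have Iu : `]u - 1, u + 1[%classic u by rewrite /= in_itv/= ltrBlDr ltrDl ltr01.
  have h1 : forall x, `]u - 1, u + 1[%classic x -> P.-integrable setT (EFin \o f x).
    by move=> x _; exact: L1cos.
  have h2 x w : `]u - 1, u + 1[%classic x -> setT w -> derivable (f ^~ w) x 1.
    by move=> _ _; case: (fdf x w).
  have h3 x w : `]u - 1, u + 1[%classic x -> setT w -> `|(partial1of2 f) x w| <= `|X w|.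
    move=> _ _; rewrite d1f normrM normrN ler_piMl//.
    by rewrite ler_norml sin_geN1 sin_le1.
  apply: DeriveDef.
    exact: (@derivable_under_integral R d T P f setT measurableT u _ _ Iu h1 h2 (fun w => `|X w|) (fun=> normr_ge0 _) L1X h3).
  rewrite -derive1E (@differentiation_under_integral R d T P f setT measurableT u _ _ Iu h1 h2 (fun w => `|X w|) (fun=> normr_ge0 _) L1X h3).
  under eq_Rintegral => w _ do rewrite d1f mulrC mulrN -mulNr.
  transitivity (- \int[P]_w (X w * sin (u * X w + c))).
    rewrite -mulN1r -RintegralZl//.
      by apply: eq_Rintegral => w _; rewrite mulN1r mulNr.
    have mX2 : measurable_fun setT (fun w => X w * sin (u * X w + c)).
      apply: measurable_funM => //; apply: (measurableT_comp (f := fun x => sin (u * x + c))) => //.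
      apply: cont_mf; apply: (@der_continuous _ _ (fun x => cos (u * x + c) * u)) => x.
      by apply: (@der_comp _ sin (fun x => u * x + c)); exact: der_affine.
    apply: (L1_le mX2 _ L1X) => w; rewrite normrM ler_piMr//.
    by rewrite ler_norml sin_geN1 sin_le1.
  have -> : \int[P]_w (X w * sin (u * X w + c)) = s ^+ 2 * \int[P]_w (cos (u * X w + c) * u).
    apply: (@normal_var_stein (fun x => sin (u * x + c)) (fun x => cos (u * x + c) * u)).
    - by move=> x; apply: (@der_comp _ sin (fun x => u * x + c)); exact: der_affine.
    - apply: (@der_continuous _ _ (fun x => (- sin (u * x + c) * u) * u + cos (u * x + c) * 0)) => x.
      apply: derM.
      by apply: (@der_comp _ cos (fun x => u * x + c)); exact: der_affine.
    - by apply: cos_poly_bounded => x; rewrite ler_norml sin_geN1 sin_le1.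
    - exists `|u|, 0%N => x; rewrite expr0 mulr1 normrM ler_piMl//.
      by rewrite ler_norml cos_geN1 cos_le1.
  have -> : \int[P]_w (cos (u * X w + c) * u) = phi u * u by rewrite RintegralZr//; exact: L1cos.
  by ring.
pose psi u := phi u * expR (s ^+ 2 / 2 * (u * u)).
have dpsi u : is_derive u (1 : R) psi 0.
  have h : is_derive u (1 : R) (fun v : R => s ^+ 2 / 2 * (v * v)) (s ^+ 2 / 2 * (1 * u + u * 1)).
    by apply/derZ/derM; exact: is_derive_id.
  have k := derM (dphi u) (@der_comp _ expR _ u _ _ (is_derive_expR _) h).
  by apply: (is_derive_eq k); field.
have := @is_derive_0_is_cst _ psi t 0 dpsi; rewrite /psi !mulr0 expR0 mulr1.
have -> : phi 0 = cos c.
  rewrite /phi -[RHS](RI_cst (cos c)); apply: eq_Rintegral => w _; by rewrite mul0r add0r.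
move=> <-; rewrite -/(phi t) -[RHS]mulrA -expRD.
have -> : s ^+ 2 / 2 * (t * t) + - (s ^+ 2 * t ^+ 2 / 2) = 0 by field.
by rewrite expR0 mulr1.
Qed.

Lemma normal_variable :
  [/\ forall f, measurable_fun setT f -> poly_bounded f -> L1 P (fun w => f (X w)),
      forall eta eta' : R -> R, (forall x, is_derive x (1 : R) eta (eta' x)) ->
        continuous eta' -> poly_bounded eta -> poly_bounded eta' ->
        \int[P]_w (X w * eta (X w)) = s ^+ 2 * \int[P]_w (eta' (X w))
    & forall t c, \int[P]_w cos (t * X w + c) = cos c * expR (- (s ^+ 2 * t ^+ 2 / 2))].
Proof.
by split; [exact: normal_L1|exact: normal_var_stein|exact: normal_cos].
Qed.

End Normal.

Definition variance X := \int[P]_w (X w * X w).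

(** Written with the variance, the identities also cover the degenerate law, for which both sides of
    Stein's identity vanish and the cosine is almost surely constant. *)
Lemma gaussian_variable X : measurable_fun setT X -> centered_gaussian P X ->
  [/\ forall f, measurable_fun setT f -> poly_bounded f -> L1 P (fun w => f (X w)),
      forall eta eta' : R -> R, (forall x, is_derive x (1 : R) eta (eta' x)) ->
        continuous eta' -> poly_bounded eta -> poly_bounded eta' ->
        \int[P]_w (X w * eta (X w)) = variance X * \int[P]_w (eta' (X w))
    & forall t c, \int[P]_w cos (t * X w + c) = cos c * expR (- (variance X * t ^+ 2 / 2))].
Proof.
move=> mX [X0|[s s0 XE]].
  have fX0 f : measurable_fun setT f -> \int[P]_w f (X w) = f 0.
    move=> mf; rewrite -[RHS](RI_cst (f 0)); apply: RI_ae => //.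
      exact: measurableT_comp.
    by apply: filterS X0 => w /= ->.
  have v0 : variance X = 0.
    by rewrite /variance (fX0 (fun x => x * x)) ?mulr0//; exact: measurable_funM.
  split.
  - move=> f mf _; apply: (@L1_ae _ _ _ _ _ (fun=> f 0)).
    + exact: measurableT_comp.
    + exact: L1_cst.
    + by apply: filterS X0 => w /= ->.
  - move=> eta eta' de _ _ _; rewrite v0 mul0r (fX0 (fun x => x * eta x)) ?mul0r//.
    by apply: measurable_funM => //; apply: continuous_measurable_fun; exact: (der_continuous de).
  - move=> t c; rewrite v0 !mul0r oppr0 expR0 mulr1 (fX0 (fun x => cos (t * x + c))) ?mulr0 ?add0r//.
    apply: continuous_measurable_fun; apply: (@der_continuous _ _ (fun x => - sin (t * x + c) * t)) => x.
    by apply: (@der_comp _ cos (fun x => t * x + c)); exact: der_affine.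
have [h1 h2 h3] := normal_variable mX s0 XE.
suff -> : variance X = s ^+ 2 by [].
rewrite /variance (h2 id (fun=> 1)) ?RI_cst ?mulr1//.
- by move=> x; exact: cst_continuous.
- by exists 1, 1%N => x; rewrite mul1r expr1 lerDr.
- by exists 1, 0%N => x; rewrite normr1 mulr1.
Qed.

End GaussianVariable.

(** * Isonormal processes *)

Section InnerProduct.
Variables (R : realType) (H : completeNormedModType R) (ip : H -> H -> R).
Hypothesis ip_inner : inner_product ip.
Implicit Types (x y z : H) (a : R).

Lemma ipC x y : ip x y = ip y x. Proof. by case: ip_inner. Qed.
Lemma ip_norm x : ip x x = `|x| ^+ 2. Proof. by case: ip_inner. Qed.
Lemma ipDZl a x y z : ip (a *: x + y) z = a * ip x z + ip y z.
Proof. by case: ip_inner. Qed.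
Lemma ip0l z : ip 0 z = 0.
Proof.
have := ipDZl 1 0 0 z; rewrite scale1r addr0 mul1r => /eqP.
by rewrite -subr_eq0 opprD addNKr oppr_eq0 => /eqP.
Qed.
Lemma ipDl x y z : ip (x + y) z = ip x z + ip y z.
Proof. by rewrite -{1}(scale1r x) ipDZl mul1r. Qed.
Lemma ipZl a x z : ip (a *: x) z = a * ip x z.
Proof. by rewrite -(addr0 (a *: x)) ipDZl ip0l addr0. Qed.
Lemma ipBl x y z : ip (x - y) z = ip x z - ip y z.
Proof. by rewrite ipDl -scaleN1r ipZl mulN1r. Qed.
Lemma ipDr x y z : ip z (x + y) = ip z x + ip z y.
Proof. by rewrite ipC ipDl !(ipC z). Qed.
Lemma ipZr a x z : ip z (a *: x) = a * ip z x.
Proof. by rewrite ipC ipZl (ipC z). Qed.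
Lemma ipBr x y z : ip z (x - y) = ip z x - ip z y.
Proof. by rewrite ipC ipBl !(ipC z). Qed.
Lemma ip_suml (J : Type) (r : seq J) (F : J -> H) z :
  ip (\sum_(j <- r) F j) z = \sum_(j <- r) ip (F j) z.
Proof. exact: (big_morph (ip^~ z) (fun x y => ipDl x y z) (ip0l z)). Qed.
Lemma ip_ge0 x : 0 <= ip x x. Proof. by rewrite ip_norm sqr_ge0. Qed.

End InnerProduct.

Section Isonormal.
Variables (R : realType) (H : completeNormedModType R) (ip : H -> H -> R).
Context (d : measure_display) (T : measurableType d) (P : probability T R).
Variable W : H -> {RV P >-> R}.
Hypothesis ip_inner : inner_product ip.
Hypothesis W_isonormal : isonormal ip W.
Implicit Types (g h : H) (X theta : T -> R) (K : set H).

Lemma mW h : measurable_fun setT (W h). Proof. by []. Qed.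

Lemma W_gaussian h : centered_gaussian P (W h).
Proof.
have [/(_ 1%N (fun=> 1) (fun=> h)) + _] := W_isonormal; congr centered_gaussian.
by apply/funext => w; rewrite big_ord1 mul1r.
Qed.

Lemma L1WW h g : L1 P (fun w => W h w * W g w).
Proof.
have L2 k : L1 P (fun w => W k w * W k w).
  have [h1 _ _] := gaussian_variable (mW k) (W_gaussian k).
  apply: (h1 (fun x => x * x)); first exact: measurable_funM.
  by exists 1, 2%N => x; rewrite mul1r normrM -expr2 lerXn2r ?nnegrE ?addr_ge0// lerDr.
apply: (L1_le _ _ (L1D (L2 h) (L2 g))); first exact: measurable_funM.
move=> w; rewrite ler_norml; apply/andP; split.
  by rewrite -subr_ge0; have := sqr_ge0 (W h w + W g w); nra.
by rewrite -subr_ge0; have := sqr_ge0 (W h w - W g w); nra.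
Qed.

Lemma EWW h g : \int[P]_w (W h w * W g w) = ip h g.
Proof.
have [_ /(_ h g)] := W_isonormal; rewrite unlock => e.
by rewrite /Rintegral e.
Qed.

Lemma W_props h :
  [/\ forall f, measurable_fun setT f -> poly_bounded f -> L1 P (fun w => f (W h w)),
      forall eta eta' : R -> R, (forall x, is_derive x (1 : R) eta (eta' x)) ->
        continuous eta' -> poly_bounded eta -> poly_bounded eta' ->
        \int[P]_w (W h w * eta (W h w)) = ip h h * \int[P]_w (eta' (W h w))
    & forall t c, \int[P]_w cos (t * W h w + c) = cos c * expR (- (ip h h * t ^+ 2 / 2))].
Proof.
by have := gaussian_variable (mW h) (W_gaussian h); rewrite /variance EWW.
Qed.

Lemma L1_sqr_eq0 X : measurable_fun setT X -> L1 P (fun w => X w * X w) ->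
  \int[P]_w (X w * X w) = 0 -> X = cst 0 %[ae P].
Proof.
move=> mX lX X0.
have : (\int[P]_w `|(X w * X w)%:E| = 0)%E.
  rewrite -[RHS]/(0%:E) -X0 EFin_RI//; apply: eq_integral => w _.
  by rewrite gee0_abs// lee_fin -expr2 sqr_ge0.
move/(ae_eq_integral_abs P measurableT (measurable_int _ lX)).
by apply: filterS => w /= /(_ I) [] /eqP; rewrite mulf_eq0 orbb => /eqP.
Qed.

(** Linearity follows from the covariance: the second moment of the difference expands by
    bilinearity into [ip] of a null combination with itself. *)
Lemma W_linear (a : R) h g :
  W (a *: h + g) = (fun w => a * W h w + W g w) %[ae P].
Proof.
pose k := a *: h + g.
pose X w := W k w - (a * W h w + W g w).
have mX : measurable_fun setT X.
  apply: measurable_funB => //; apply: measurable_funD => //.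
  exact: measurable_funM.
pose s := [:: (1, k); (- a, h); (- 1, g)].
have XE w : X w = \sum_(x <- s) x.1 * W x.2 w.
  by rewrite /X /s !big_cons big_nil /=; ring.
have X2 w : X w * X w = \sum_(x <- s) \sum_(y <- s) (x.1 * y.1) * (W x.2 w * W y.2 w).
  by rewrite XE sumrM; apply: eq_bigr => x _; apply: eq_bigr => y _; ring.
have l1 x : L1 P (fun w => \sum_(y <- s) (x.1 * y.1) * (W x.2 w * W y.2 w)).
  by apply: L1_sum => y; apply: L1Z; exact: L1WW.
have l2 : L1 P (fun w => X w * X w).
  by apply: eq_L1 (L1_sum s l1) => w; rewrite X2.
suff X0 : X = cst 0 %[ae P].
  by apply: filterS X0 => w /= /(_ I) /eqP; rewrite subr_eq0 => /eqP e _.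
apply: L1_sqr_eq0 => //.
transitivity (\sum_(x <- s) \sum_(y <- s) (x.1 * y.1) * ip x.2 y.2).
  under eq_Rintegral => w _ do rewrite X2.
  rewrite RI_sum//; apply: eq_bigr => x _; rewrite RI_sum; last first.
    by move=> y; apply: L1Z; exact: L1WW.
  apply: eq_bigr => y _; rewrite RintegralZl//; last exact: L1WW.
  by rewrite EWW.
rewrite /s !big_cons !big_nil /= /k.
rewrite !(ipDl ip_inner, ipDr ip_inner, ipZl ip_inner, ipZr ip_inner) (ipC ip_inner g h).
by ring.
Qed.

Lemma W0 : W 0 = cst 0 %[ae P].
Proof.
apply: L1_sqr_eq0 => //; first exact: L1WW.
by rewrite EWW (ip0l ip_inner).
Qed.

End Isonormal.

(** * Events generated by part of the process *)

Section Annihilators.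
Variables (R : realType) (H : completeNormedModType R) (ip : H -> H -> R).
Context (d : measure_display) (T : measurableType d) (P : probability T R).
Variable W : H -> {RV P >-> R}.
Hypothesis ip_inner : inner_product ip.
Hypothesis W_isonormal : isonormal ip W.
Implicit Types (g h : H) (X theta : T -> R) (c s : R).

Variable K : set H.
Hypothesis K0 : K 0.
Hypothesis KD : forall s g h, K g -> K h -> K (s *: g + h).

Lemma mW_cos s g c : measurable_fun setT (fun w => cos (s * W g w + c)).
Proof.
apply: (measurableT_comp (f := cos)).
  by apply: continuous_measurable_fun; exact: continuous_cos.
by apply: measurable_funD => //; exact: measurable_funM.
Qed.

Lemma L1M_bounded X theta M : L1 P X -> measurable_fun setT theta ->
  (forall w, `|theta w| <= M) -> L1 P (fun w => X w * theta w).
Proof.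
move=> lX mt tM; apply: (L1_le _ _ (L1Z M (L1_norm lX))).
  by apply: measurable_funM => //; exact: L1_measurable lX.
by move=> w; rewrite normrM mulrC ler_wpM2r.
Qed.

(* Multipliers are stable under sums, products and bounded limits, and the
   indicator of W g <= a is a limit of expressions exp (- exp _) in
   trigonometric functions of W g. So the events generated by the W g, g in K,
   are multipliers: this replaces the injectivity of the Fourier transform, both
   for the independence of orthogonal Gaussian variables and for the totality of
   the trigonometric functions. *)
Definition annihilates X := L1 P X /\
  forall g c, K g -> \int[P]_w (X w * cos (W g w + c)) = 0.

Definition multiplier theta := [/\ measurable_fun setT theta,
  exists M, forall w, `|theta w| <= M
  & forall X, annihilates X -> annihilates (fun w => X w * theta w)].

Let L1cos X g c : L1 P X -> L1 P (fun w => X w * cos (W g w + c)).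
Proof.
move=> lX; apply: (@L1M_bounded _ _ 1) => //.
  by apply: eq_measurable_fun (mW_cos 1 g c) => w _; rewrite mul1r.
by move=> w; rewrite cos_max.
Qed.

Lemma multiplier_cst c : multiplier (fun=> c).
Proof.
split=> //; first by exists `|c|.
move=> X [lX X0]; split; first by apply: eq_L1 (L1Z c lX) => w; rewrite mulrC.
move=> g c' Kg; transitivity (c * \int[P]_w (X w * cos (W g w + c'))).
  rewrite -RintegralZl//; last exact: L1cos.
  by apply: eq_Rintegral => w _; rewrite mulrA (mulrC c).
by rewrite X0// mulr0.
Qed.

Lemma multiplierM theta theta' : multiplier theta -> multiplier theta' ->
  multiplier (fun w => theta w * theta' w).
Proof.
move=> [m1 [M1 h1] a1] [m2 [M2 h2] a2]; split; first exact: measurable_funM.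
  by exists (M1 * M2) => w; rewrite normrM ler_pM.
move=> X aX; have := a2 _ (a1 _ aX); congr annihilates.
by apply/funext => w; rewrite mulrA.
Qed.

Lemma multiplierD theta theta' : multiplier theta -> multiplier theta' ->
  multiplier (fun w => theta w + theta' w).
Proof.
move=> [m1 [M1 h1] a1] [m2 [M2 h2] a2]; split; first exact: measurable_funD.
  by exists (M1 + M2) => w; rewrite (le_trans (ler_normD _ _))// lerD.
move=> X aX; have [l1 z1] := a1 _ aX; have [l2 z2] := a2 _ aX; split.
  by apply: eq_L1 (L1D l1 l2) => w; rewrite mulrDr.
move=> g c Kg; rewrite -[RHS]addr0 -{1}(z1 g c Kg) -(z2 g c Kg) -RintegralD//;
  [|exact: L1cos..].
by apply: eq_Rintegral => w _; rewrite mulrDr mulrDl.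
Qed.

Lemma multiplier_lim (t_ : nat -> T -> R) theta M :
  (forall n, multiplier (t_ n)) -> (forall n w, `|t_ n w| <= M) ->
  (forall w, t_ ^~ w @ \oo --> theta w) -> multiplier theta.
Proof.
move=> at_ tM tt.
have mth : measurable_fun setT theta.
  by apply: (measurable_fun_cvg (h := t_)) => // n; have [] := at_ n.
have thM w : `|theta w| <= M.
  apply: (cvgr_to_le (cvg_norm (tt w))).
  by apply: nearW => n; exact: tM.
split=> //; first by exists M.
move=> X aX; have [lX X0] := aX.
have lXt : L1 P (fun w => X w * theta w) by exact: (L1M_bounded _ _ thM).
split=> // g c Kg.
have [_ cv] : L1 P (fun w => X w * theta w * cos (W g w + c)) /\
    (fun n => \int[P]_w (X w * t_ n w * cos (W g w + c))) @ \oo -->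
    \int[P]_w (X w * theta w * cos (W g w + c)).
  apply: (@RI_dct _ _ _ P (fun n w => X w * t_ n w * cos (W g w + c)) _ (fun w => M * `|X w|)).
  - move=> n; have [aX1 _] : annihilates (fun w => X w * t_ n w) by case: (at_ n) => _ _; exact.
    exact: L1_measurable (L1cos g c aX1).
  - exact: L1_measurable (L1cos g c lXt).
  - move=> w; apply: cvgM; last exact: cvg_cst.
    by apply: cvgM; [exact: cvg_cst|exact: tt].
  - by apply: L1Z; exact: L1_norm.
  - move=> n w; rewrite !normrM -[leRHS]mulr1; apply: ler_pM => //; last exact: cos_max.
    by rewrite mulrC ler_wpM2r.
apply: (cvg_unique _ cv) => //=.
rewrite (_ : (fun n => _) = cst 0); first exact: cvg_cst.
by apply/funext => n; case: (at_ n) => _ _ /(_ _ aX)[_ ->].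
Qed.

(** The product of two cosines is half the sum of two cosines whose arguments are [W (s g + g')] and
    [W (- s g + g')] up to phases; stability of [K] keeps both vectors in [K]. *)
Lemma multiplier_cos s g c : K g -> multiplier (fun w => cos (s * W g w + c)).
Proof.
move=> Kg; split; first exact: mW_cos.
  by exists 1 => w; rewrite cos_max.
move=> X aX; have [lX X0] := aX.
have lXc : L1 P (fun w => X w * cos (s * W g w + c)).
  by apply: (@L1M_bounded _ _ 1) => //; [exact: mW_cos|move=> w; rewrite cos_max].
split=> // g' c' Kg'.
have Kp : K (s *: g + g') by exact: KD.
have Km : K (- s *: g + g') by exact: KD.
pose Y w := 2^-1 * (X w * cos (W (s *: g + g') w + (c + c')) + X w * cos (W (- s *: g + g') w + (c' - c))).
transitivity (\int[P]_w Y w).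
  apply: RI_ae.
  - exact: L1_measurable (L1cos g' c' lXc).
  - apply: measurable_funM => //.
    by apply: measurable_funD; apply: L1_measurable; exact: L1cos.
  - have := W_linear ip_inner W_isonormal s g g'.
    apply: filterS2 (W_linear ip_inner W_isonormal (- s) g g') => w /= /(_ I) e2 /(_ I) e1 _.
    rewrite /Y e1 e2.
    rewrite (_ : s * W g w + W g' w + (c + c') = (s * W g w + c) + (W g' w + c')); last by ring.
    rewrite (_ : - s * W g w + W g' w + (c' - c) = (W g' w + c') - (s * W g w + c)); last by ring.
    move: (s * W g w + c) (W g' w + c') => y z.
    by rewrite cosB cosD; field.
rewrite /Y RintegralZl//; last by apply: L1D; exact: L1cos.
rewrite RintegralD//; [|exact: L1cos..].
by rewrite !X0// addr0 mulr0.
Qed.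

Lemma multiplier_sum (J : Type) (r : seq J) (F : J -> T -> R) :
  (forall j, multiplier (F j)) -> multiplier (fun w => \sum_(j <- r) F j w).
Proof.
move=> mF; elim: r => [|j r IH].
  have -> : (fun w => \sum_(j <- [::]) F j w) = (fun=> 0) by apply/funext => w; rewrite big_nil.
  exact: multiplier_cst.
have -> : (fun w => \sum_(k <- j :: r) F k w) = (fun w => F j w + \sum_(k <- r) F k w).
  by apply/funext => w; rewrite big_cons.
exact: multiplierD.
Qed.

Lemma multiplierX theta n : multiplier theta -> multiplier (fun w => theta w ^+ n).
Proof.
move=> mt; elim: n => [|n IH].
  by under eq_fun do rewrite expr0; exact: multiplier_cst.
by under eq_fun do rewrite exprS; exact: multiplierM.
Qed.

Lemma multiplierZ c theta : multiplier theta -> multiplier (fun w => c * theta w).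
Proof. exact: multiplierM (multiplier_cst c). Qed.

(** Partial sums of the exponential series are polynomials in [theta], uniformly bounded by
    [expR M]. *)
Lemma multiplier_exp theta : multiplier theta -> multiplier (fun w => expR (theta w)).
Proof.
move=> mt; have [_ [M tM] _] := mt.
have M0 (w : T) : 0 <= M by exact: le_trans (normr_ge0 _) (tM w).
apply: (@multiplier_lim (fun n w => series (exp_coeff (theta w)) n) _ (expR M)).
- move=> n; rewrite [X in multiplier X](_ : _ = (fun w => \sum_(k <- index_iota 0 n) k`!%:R^-1 * theta w ^+ k)).
    by apply: multiplier_sum => k; apply: multiplierZ; exact: multiplierX.
  by apply/funext => w; apply: eq_bigr => k _; rewrite /exp_coeff mulrC.
- move=> n w; apply: (@le_trans _ _ (series (exp_coeff M) n)).
    rewrite (le_trans (ler_norm_sum _ _ _))//; apply: ler_sum => k _.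
    rewrite /exp_coeff /= normrM normrX normfV normr_nat ler_wpM2r ?invr_ge0//.
    by rewrite lerXn2r ?nnegrE// (M0 w).
  apply: (nondecreasing_cvgn_le (u_ := series (exp_coeff M))).
    by apply: nondecreasing_series => k _ _; rewrite exp_coeff_ge0// (M0 w).
  exact: is_cvg_series_exp_coeff.
- by move=> w; exact: is_cvg_series_exp_coeff.
Qed.

Lemma multiplier_le0 theta : multiplier theta ->
  multiplier (fun w => (theta w <= 0)%R%:R).
Proof.
move=> mt.
(* The shift by [n] decides the case [x = 0]: there the inner exponential is [expR (- n)] and the
   limit is 1. For [x > 0] the quadratic coefficient outweighs the shift and the limit is 0. *)
pose f (n : nat) (x : R) := expR (- expR (n%:R ^+ 2 * x - n%:R)).
apply: (@multiplier_lim (fun n w => f n (theta w)) _ 1).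
- move=> n; apply/multiplier_exp.
  have := multiplierZ (-1) (multiplier_exp (multiplierD (multiplierZ (n%:R ^+ 2) mt) (multiplier_cst (- n%:R)))).
  by under eq_fun do rewrite mulN1r.
- move=> n w; rewrite ger0_norm ?expR_ge0// -expR0 ler_expR oppr_le0.
  exact: expR_ge0.
- move=> w; move: (theta w) => x.
  have expN (y : R) (n : nat) : n%:R <= y -> expR (- y) <= harmonic n.
    move=> ny; rewrite expRN /harmonic /= lef_pV2 ?posrE ?expR_gt0//.
    by rewrite -natr1 addrC (le_trans _ (expR_ge1Dx _))// lerD2l.
  have [x0|x0] := lerP x 0.
    apply: (@squeeze_cvgr _ _ _ _ (fun n => 1 - harmonic n) (cst 1)); last 2 first.
    - by rewrite -[X in _ --> X]subr0; apply: cvgB; [exact: cvg_cst|exact: cvg_harmonic].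
    - exact: cvg_cst.
    apply: nearW => n; rewrite /f /=; apply/andP; split; last first.
      by rewrite -[leRHS]expR0 ler_expR oppr_le0 expR_ge0.
    rewrite (le_trans _ (expR_ge1Dx _))// lerD2l lerN2.
    rewrite -[X in expR X]opprK; apply: expN.
    by rewrite opprB lerDl oppr_ge0 mulr_ge0_le0// sqr_ge0.
  apply: (@squeeze_cvgr _ _ _ _ (cst 0) harmonic); last 2 first.
  - exact: cvg_cst.
  - exact: cvg_harmonic.
  near=> n; rewrite /f /= expR_ge0 /=; apply: expN.
  rewrite (@le_trans _ _ (1 + (n%:R ^+ 2 * x - n%:R)))//; last exact: expR_ge1Dx.
  have nx : 2 <= n%:R * x.
    by rewrite -ler_pdivrMr//; near: n; exact: nbhs_infty_ger.
  have n0 : 0 <= n%:R :> R by [].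
  by nra.
Unshelve. all: by end_near. Qed.

(** Once [m] is large the argument [(W g w - a) / m.+1] lies within a quarter period, where the sine
    has the sign of its argument; the sine is a cosine with a phase, hence a multiplier. *)
Lemma multiplier_ray g a : K g -> multiplier (fun w => (W g w <= a)%R%:R).
Proof.
move=> Kg.
apply: (@multiplier_lim (fun m w => (sin (m.+1%:R^-1 * W g w + (- (m.+1%:R^-1 * a))) <= 0)%R%:R) _ 1).
- move=> m; apply: multiplier_le0.
  have := multiplier_cos m.+1%:R^-1 (- (m.+1%:R^-1 * a) - pi / 2) Kg; congr multiplier.
  by apply/funext => w; rewrite addrA cosBpihalf.
- by move=> n w; case: (sin _ <= 0); rewrite ?normr1 ?normr0.
- move=> w; apply: cvg_near_cst; near=> m.
  rewrite -mulrBr -[W g w <= a]subr_le0; set x := W g w - a.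
  have mx : `|x| < m.+1%:R.
    by rewrite (@le_lt_trans _ _ m%:R) ?ltr_nat//; near: m; exact: nbhs_infty_ger.
  have m0 : 0 < m.+1%:R^-1 :> R by rewrite invr_gt0.
  have small : m.+1%:R^-1 * `|x| < pi / 2.
    apply: (@lt_le_trans _ _ 1); last exact: pihalf_ge1.
    by rewrite mulrC ltr_pdivrMr// mul1r.
  have [x0|x0] := lerP x 0.
    rewrite (_ : (sin _ <= 0) = true)// -[_ * x]opprK sinN oppr_le0 -mulrN.
    have [->|xn0] := eqVneq x 0; first by rewrite oppr0 mulr0 sin0 lexx.
    have xl : x < 0 by rewrite lt_neqAle xn0.
    by rewrite ltW// sin_gt0_pihalf// mulr_gt0 ?oppr_gt0//=; move: small; rewrite ltr0_norm.
  rewrite (_ : (sin _ <= 0) = false)//; apply/negbTE; rewrite -ltNge sin_gt0_pihalf//.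
  by rewrite mulr_gt0//=; move: small; rewrite gtr0_norm.
Unshelve. all: by end_near. Qed.

Definition multiplier_set A := measurable A /\ multiplier (\1_A : T -> R).

(** Complements come from [1 - theta], and countable intersections are bounded limits of finite
    products of indicators. *)
Lemma multiplier_set_sigma : sigma_algebra setT multiplier_set.
Proof.
have mD A : multiplier_set A -> multiplier_set (~` A).
  move=> [mA aA]; split; first exact: measurableC.
  have := multiplierD (multiplier_cst 1) (multiplierZ (-1) aA); congr multiplier.
  by apply/funext => w; rewrite !indicE in_setC; case: (w \in A) => /=; ring.
split.
- split; first exact: measurable0.
  by rewrite indic0; exact: multiplier_cst.
- by move=> A mA; rewrite setTD; exact: mD.
- move=> F mF; rewrite -[X in multiplier_set X]setCK setC_bigcup; apply: (mD _).
  split; first by apply: bigcap_measurable => // n _; case: (mD _ (mF n)).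
  apply: (@multiplier_lim (fun n w => \prod_(k < n) \1_(~` F k) w) _ 1).
  - elim=> [|n IH].
      by under eq_fun do rewrite big_ord0; exact: multiplier_cst.
    under eq_fun do rewrite big_ord_recr /=.
    by apply: multiplierM => //; case: (mD _ (mF n)).
  - move=> n w; rewrite normr_prod; apply: prodr_ile1 => k _.
    by rewrite normr_ge0 indicE; case: (w \in _); rewrite ?normr1 ?normr0 ?lexx ?ler01.
  - move=> w; apply: cvg_near_cst; rewrite indicE; case: (boolP (w \in _)) => [|].
      rewrite inE => wF; apply: nearW => n; rewrite big1// => k _.
      by rewrite indicE mem_set//; exact: wF.
    rewrite notin_setE => /existsNP[k /not_implyP[_ wk]].
    exists k.+1 => // n /= kn; rewrite (bigD1 (Ordinal kn))//= indicE.
    rewrite (_ : (w \in _) = false) ?mul0r//; apply/negbTE; rewrite notin_setE.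
    by move=> Fw; apply: wk.
Qed.

Lemma multiplier_set_preimage g B : K g -> measurable B ->
  multiplier_set (W g @^-1` B).
Proof.
move=> Kg; pose S := [set B : set R | multiplier_set (W g @^-1` B)].
have [S0 SC SU] := multiplier_set_sigma.
have sS : sigma_algebra setT S.
  split; first by rewrite /S /= preimage_set0.
    by move=> A; rewrite /S /= setTD preimage_setC -setTD; exact: SC.
  by move=> F FS; rewrite /S /= preimage_bigcup; exact: SU.
move=> mB; suff : S B by [].
have : (@RGenOInfty.G R).-sigma.-measurable B by rewrite -RGenOInfty.measurableE.
apply: smallest_sub => // _ [x ->].
rewrite /S /= (_ : _ @^-1` _ = ~` [set w | W g w <= x]); last first.
  apply/seteqP; split=> w /=; rewrite in_itv/= andbT ltNge => h; exact/negP.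
have mr : measurable [set w | W g w <= x].
  have : measurable (setT `&` W g @^-1` `]-oo, x]%classic).
    by apply: mW => //; exact: measurable_itv.
  by rewrite setTI; congr measurable; apply/seteqP; split=> w /=; rewrite in_itv.
have := SC [set w | W g w <= x]; rewrite setTD; apply; split=> //.
have := multiplier_ray x Kg; congr multiplier; apply/funext => w; rewrite indicE.
by have [h|/negP h] := boolP (W g w <= x); [rewrite mem_set|rewrite memNset].
Qed.

End Annihilators.
Section AnnihilatorConsequences.
Variables (R : realType) (H : completeNormedModType R) (ip : H -> H -> R).
Context (d : measure_display) (T : measurableType d) (P : probability T R).
Variable W : H -> {RV P >-> R}.
Hypothesis ip_inner : inner_product ip.
Hypothesis W_isonormal : isonormal ip W.
Implicit Types (g h : H) (X theta : T -> R) (c s : R).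

(** [K 0] provides the constant test function, since [cos (W 0 + 0)] is almost surely 1. *)
Lemma annihilates_set (K : set H) X A : K 0 ->
  annihilates W K X -> multiplier_set W K A -> \int[P]_w (X w * \1_A w) = 0.
Proof.
move=> K0 aX [mA [_ _ aA]]; have [lX /(_ 0 0 K0) X0] := aA _ aX.
rewrite -X0; apply: RI_ae.
- exact: L1_measurable lX.
- apply: measurable_funM; first exact: L1_measurable lX.
  by apply: eq_measurable_fun (mW_cos W 1 0 0) => w _; rewrite mul1r.
- apply: filterS (W0 ip_inner W_isonormal) => w /= /(_ I) -> _.
  by rewrite addr0 cos0 mulr1.
Qed.

Lemma annihilates_eq0 X : generated_by W -> annihilates W setT X ->
  X = cst 0 %[ae P].
Proof.
move=> gW aX; have [lX _] := aX.
have KD s g h : [set: H] g -> [set: H] h -> [set: H] (s *: g + h) by [].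
have mS A : measurable A -> multiplier_set W setT A.
  rewrite gW; apply: smallest_sub; first exact: multiplier_set_sigma.
  by move=> _ [h [B [mB ->]]]; exact: (multiplier_set_preimage ip_inner W_isonormal KD).
have : ae_eq P setT (EFin \o X) (cst 0%E).
  apply: integral_ae_eq => //.
  - move=> E _ mE; rewrite integral0.
    have l1 : L1 P (fun w => X w * \1_E w).
      apply: (@L1M_bounded _ _ _ _ _ _ 1) => // w.
      by rewrite indicE; case: (w \in E); rewrite ?normr1 ?normr0.
    rewrite integral_mkcond -[RHS]/(0%:E) -(annihilates_set _ aX (mS _ mE))// EFin_RI//.
    apply: eq_integral => w _; rewrite patchE indicE.
    by case: ifPn => _; rewrite ?mulr1 ?mulr0.
by apply: filterS => w /= h _; have [] := h I.
Qed.

End AnnihilatorConsequences.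

(** * Freezing a random vector on a grid *)

Section Discretization.
Context (R : realType) (d : measure_display) (T : measurableType d).
Variable P : probability T R.
Variable k : nat.
Implicit Types (v : 'rV[R]_k) (n : nat).

(* The cells of mesh 1/(n+1) partition [-(n+1), n+1[. *)
Definition cell_left n (j : nat) : R := j%:R / n.+1%:R - n.+1%:R.
Definition cell n j : set R := `[cell_left n j, cell_left n j.+1[%classic.
Definition cells n := (2 * n.+1 ^ 2)%N.

Lemma cellP n j x : cell n j x -> 0 <= x - cell_left n j < n.+1%:R^-1.
Proof.
rewrite /cell /= in_itv/= /cell_left => /andP[xl xr]; rewrite subr_ge0 xl /=.
move: xr; rewrite -[j.+1%:R]natr1 mulrDl mul1r => xr.
by rewrite ltrBlDr addrA (addrC _^-1).
Qed.

Lemma cell_uniq n i j x : cell n i x -> cell n j x -> i = j.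
Proof.
have n0 : 0 < n.+1%:R :> R by [].
have key a : cell n a x -> a%:R <= (x + n.+1%:R) * n.+1%:R < a.+1%:R.
  by rewrite /cell /= in_itv/= /cell_left lerBlDr ler_pdivrMr// ltrBrDr ltr_pdivlMr.
move=> /key/andP[i0 i1] /key/andP[j0 j1]; apply/eqP.
have ij : (i < j.+1)%N by rewrite -(ltr_nat R) (le_lt_trans i0 j1).
have ji : (j < i.+1)%N by rewrite -(ltr_nat R) (le_lt_trans j0 i1).
by rewrite eqn_leq -(ltnS i) ij -(ltnS j) ji.
Qed.

Lemma cell_exists n x : `|x| < n.+1%:R -> exists2 j, (j < cells n)%N & cell n j x.
Proof.
rewrite ltr_norml => /andP[x1 x2]; have n0 : 0 < n.+1%:R :> R by [].
pose y := (x + n.+1%:R) * n.+1%:R.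
have y0 : 0 <= y by rewrite mulr_ge0// -lerBlDr sub0r ltW.
have /andP[t1 t2] := truncn_itv y0.
exists (Num.truncn y).
  rewrite -(ltr_nat R) (le_lt_trans t1)// /cells /y natrM natrX expr2 mulrA ltr_pM2r//.
  by rewrite mulr_natl mulr2n ltrD2r.
rewrite /cell /= in_itv/= /cell_left.
by rewrite lerBlDr ler_pdivrMr// ltrBrDr ltr_pdivlMr// t1.
Qed.

Definition grid n (v : {ffun 'I_k -> 'I_(cells n)}) : 'rV[R]_k :=
  \row_i cell_left n (v i).

Variable U : 'I_k -> T -> R.

Definition box n (v : {ffun 'I_k -> 'I_(cells n)}) : set T :=
  [set w | forall i, cell n (v i) (U i w)].

Variable Psi : T -> 'rV[R]_k -> R.

Definition discretized n w : R :=
  \sum_(v : {ffun 'I_k -> 'I_(cells n)}) Psi w (grid v) * \1_(box v) w.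

Lemma discretizedP n w :
  (exists2 v : {ffun 'I_k -> 'I_(cells n)}, box v w & discretized n w = Psi w (grid v)) \/
  discretized n w = 0 /\ exists i, n.+1%:R <= `|U i w|.
Proof.
have [[v bv]|nv] := pselect (exists v : {ffun 'I_k -> 'I_(cells n)}, box v w).
  left; exists v => //; rewrite /discretized (bigD1 v)//= big1 ?addr0.
    by rewrite indicE mem_set// mulr1.
  move=> u uv; rewrite indicE memNset ?mulr0// => bu.
  move/eqP: uv; apply; apply/ffunP => i; apply/val_inj.
  exact: cell_uniq (bu i) (bv i).
right; split.
  rewrite /discretized big1// => v _; rewrite indicE memNset ?mulr0// => bv.
  by apply: nv; exists v.
apply: contrapT => /forallNP hU; apply: nv.
have /choice[v hv] i : exists j : 'I_(cells n), cell n j (U i w).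
  have : `|U i w| < n.+1%:R by rewrite ltNge; apply/negP; exact: hU.
  by move=> /cell_exists[j jn cj]; exists (Ordinal jn).
by exists [ffun i => v i] => i; rewrite ffunE.
Qed.

Lemma grid_close n (v : {ffun 'I_k -> 'I_(cells n)}) w : box v w ->
  forall i, `|U i w - grid v 0 i| <= n.+1%:R^-1.
Proof.
move=> bv i; rewrite mxE; have /andP[h1 h2] := cellP (bv i).
by rewrite ger0_norm// ltW.
Qed.

Lemma cvg_discretized w : {for \row_i U i w, continuous (Psi w)} ->
  discretized ^~ w @ \oo --> Psi w (\row_i U i w).
Proof.
move=> cP; apply/cvgrPdist_le => e e0.
have /cvgrPdist_le/(_ e e0) := cP; rewrite /= => /nbhs_ballP[r /= r0 hr].
have [M hM] : exists M : nat, forall i, `|U i w| < M%:R.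
  exists (Num.truncn (\sum_i `|U i w|)).+1 => i.
  apply: le_lt_trans (truncnS_gt _).
  by rewrite (bigD1 i)//= lerDl sumr_ge0.
have [N hN] : exists N : nat, N.+1%:R^-1 < r.
  exists (Num.truncn r^-1); rewrite invf_plt ?posrE//.
  exact: truncnS_gt.
near=> n.
have [[v bv ->]|[_ [i]]] := discretizedP n w; last first.
  rewrite leNgt (lt_le_trans (hM i))// ler_nat leqW//.
  by near: n; exact: nbhs_infty_ge.
apply: hr; rewrite -ball_normE /ball_ /= (@le_lt_trans _ _ n.+1%:R^-1)//; last first.
  apply: le_lt_trans hN; rewrite lef_pV2 ?posrE// ler_nat ltnS.
  by near: n; exact: nbhs_infty_ge.
have [M0|M0] := eqVneq `|\row_i U i w - grid v| 0; first by rewrite M0 invr_ge0.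
have [[a i] /= aiE] := mx_norm_neq0 M0.
rewrite [leLHS]aiE.
by have := grid_close bv i; rewrite (ord1 a) !mxE.
Unshelve. all: by end_near. Qed.

(** A sigma-algebra is closed under sequences of sets whereas the coordinates form a finite type:
    [F] pads the family with empty sets, and complements turn the union into the intersection. *)
Lemma box_sigma (S : set (set T)) n (v : {ffun 'I_k -> 'I_(cells n)}) :
  sigma_algebra setT S -> (forall i B, measurable B -> S (U i @^-1` B)) ->
  S (box v).
Proof.
move=> [S0 SC SU] SB.
pose F (m : nat) : set T :=
  if insub m is Some i then setT `\` (U i @^-1` cell n (v i)) else set0.
have -> : box v = setT `\` \bigcup_m F m.
  apply/seteqP; split=> [w bw|w [_ nF] i].
    split=> // -[m _]; rewrite /F; case: insubP => // i _ _ [_]; apply; exact: bw.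
  apply: contrapT => h; apply: nF; exists i => //.
  by rewrite /F valK; split.
apply: (SC _); apply: SU => m; rewrite /F; case: insubP => // i _ _.
by apply: SC; apply: SB; exact: measurable_itv.
Qed.

Hypothesis mU : forall i, measurable_fun setT (U i).
Hypothesis mPsi : forall v, measurable_fun setT (Psi^~ v).
Hypothesis cPsi : forall w, {for \row_i U i w, continuous (Psi w)}.

Lemma measurable_box n (v : {ffun 'I_k -> 'I_(cells n)}) : measurable (box v).
Proof.
apply: box_sigma; first exact: sigma_algebra_measurable.
by move=> i B mB; rewrite -[X in measurable X]setTI; apply: mU.
Qed.

Lemma measurable_discretized n : measurable_fun setT (discretized n).
Proof.
apply: measurable_sum => v; apply: measurable_funM => //.
by apply: measurable_indic; exact: measurable_box.
Qed.

Lemma measurable_comp_row : measurable_fun setT (fun w => Psi w (\row_i U i w)).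
Proof.
apply: (measurable_fun_cvg (h := discretized)).
  exact: measurable_discretized.
by move=> w _; exact: cvg_discretized.
Qed.

Lemma integral_discretized (B : T -> R) : L1 P B ->
  (forall w v, (forall i, `|v 0 i| <= `|U i w| + 1) -> `|Psi w v| <= B w) ->
  (forall n (v : {ffun 'I_k -> 'I_(cells n)}),
     \int[P]_w (Psi w (grid v) * \1_(box v) w) = 0) ->
  L1 P (fun w => Psi w (\row_i U i w)) /\ \int[P]_w Psi w (\row_i U i w) = 0.
Proof.
move=> lB PB P0.
have gB n (v : {ffun 'I_k -> 'I_(cells n)}) w : box v w -> `|Psi w (grid v)| <= B w.
  move=> bv; apply: PB => i; have := grid_close bv i; rewrite distrC => h.
  have -> : grid v 0 i = U i w + (grid v 0 i - U i w) by rewrite addrC subrK.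
  rewrite (le_trans (ler_normD _ _))// lerD2l (le_trans h)// invf_le1//.
  by rewrite ler1n.
have B0 w : 0 <= B w.
  apply: le_trans (PB w 0 _); first exact: normr_ge0.
  by move=> i; rewrite mxE normr0 addr_ge0.
have lt n (v : {ffun 'I_k -> 'I_(cells n)}) : L1 P (fun w => Psi w (grid v) * \1_(box v) w).
  apply: (L1_le _ _ lB).
    by apply: measurable_funM => //; apply: measurable_indic; exact: measurable_box.
  move=> w; rewrite indicE; case: (boolP (w \in _)); last by rewrite mulr0 normr0.
  by rewrite inE mulr1 => /gB.
have [lP cv] : L1 P (fun w => Psi w (\row_i U i w)) /\
    (fun n => \int[P]_w discretized n w) @ \oo --> \int[P]_w Psi w (\row_i U i w).
  apply: (@RI_dct _ _ _ P discretized _ B).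
  - exact: measurable_discretized.
  - exact: measurable_comp_row.
  - by move=> w; exact: cvg_discretized.
  - exact: lB.
  - move=> n w; have [[v bv ->]|[-> _]] := discretizedP n w; first exact: gB.
    by rewrite normr0.
split=> //; apply: (cvg_unique _ cv) => //=.
rewrite (_ : (fun n => _) = cst 0); first exact: cvg_cst.
by apply/funext => n; rewrite RI_sum// big1.
Qed.

End Discretization.

(** * Moments of several Gaussian variables *)

Section PolynomialGrowth.
Variables (R : realType) (H : completeNormedModType R) (ip : H -> H -> R).
Context (d : measure_display) (T : measurableType d) (P : probability T R).
Variable W : H -> {RV P >-> R}.
Hypothesis ip_inner : inner_product ip.
Hypothesis W_isonormal : isonormal ip W.
Implicit Types (g h : H) (X theta : T -> R) (c : R).

(** The witness is the maximum, or 0 for the empty list; the exponent is a successor because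
    [0 ^+ 0 = 1] exceeds an empty sum. *)
Lemma max_le_sum (J : Type) (r : seq J) (y : J -> R) : (forall j, 0 <= y j) ->
  exists2 m, 0 <= m & (forall q, m ^+ q.+1 <= \sum_(j <- r) y j ^+ q.+1) /\
    \sum_(j <- r) y j <= (size r)%:R * m.
Proof.
move=> y0; elim: r => [|j r [m m0 [hm hs]]].
  by exists 0 => //; split=> [q|]; rewrite ?expr0n ?big_nil ?mul0r.
have [mj|jm] := lerP m (y j).
  exists (y j) => //; split=> [q|].
    by rewrite big_cons lerDl; apply: sumr_ge0 => i _; exact: exprn_ge0.
  rewrite big_cons /= -natr1 mulrDl mul1r addrC lerD2r (le_trans hs)//.
  by rewrite ler_wpM2l.
exists m => //; split=> [q|].
  by rewrite big_cons (le_trans (hm q))// lerDr exprn_ge0.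
by rewrite big_cons /= -natr1 mulrDl mul1r addrC lerD// ltW.
Qed.

Definition gauss_size (s : seq H) (w : T) : R := 1 + \sum_(h <- s) `|W h w|.

Lemma gauss_size_ge1 s w : 1 <= gauss_size s w.
Proof. by rewrite lerDl sumr_ge0. Qed.

Lemma measurable_gauss_size s : measurable_fun setT (gauss_size s).
Proof.
apply: measurable_funD => //; elim: s => [|h s IH].
  by under eq_fun do rewrite big_nil; exact: measurable_cst.
under eq_fun do rewrite big_cons.
by apply: measurable_funD => //; exact: measurableT_comp.
Qed.

(** A power of the sum is bounded by sums of powers, which reduces joint moments to those of single
    Gaussian variables. *)
Lemma L1_gauss_size s q : L1 P (fun w => gauss_size s w ^+ q).
Proof.
have L1W (h : H) (n : nat) : L1 P (fun w => `|W h w| ^+ n).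
  have [h1 _ _] := W_props W_isonormal h.
  apply: (h1 (fun x => `|x| ^+ n)).
    by apply: measurable_funX; apply: continuous_measurable_fun; exact: norm_continuous.
  exists 1, n => x; rewrite mul1r normrX normr_id.
  by apply: lerXn2r; rewrite ?nnegrE ?addr_ge0// lerDr.
apply: (@L1_le _ _ _ _ _ (fun w => (1 + (size s)%:R) ^+ q * (1 + \sum_(h <- s) `|W h w| ^+ q.+1))).
- by apply: measurable_funX; exact: measurable_gauss_size.
- move=> w; have [m m0 [hm hs]] := max_le_sum s (fun h => normr_ge0 (W h w)).
  have g0 : 0 <= gauss_size s w by apply: le_trans (gauss_size_ge1 s w).
  rewrite ger0_norm ?exprn_ge0//.
  have [m1|m1] := lerP m 1.
    apply: (@le_trans _ _ ((1 + (size s)%:R) ^+ q * 1)); last first.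
      by rewrite ler_wpM2l ?exprn_ge0 ?addr_ge0// lerDl sumr_ge0// => h _; exact: exprn_ge0.
    rewrite mulr1 lerXn2r ?nnegrE ?addr_ge0//.
      by rewrite sumr_ge0.
    by rewrite lerD2l (le_trans hs)// ler_piMr.
  apply: (@le_trans _ _ ((1 + (size s)%:R) ^+ q * m ^+ q)).
    rewrite -exprMn lerXn2r ?nnegrE ?mulr_ge0 ?addr_ge0 ?sumr_ge0//.
    by rewrite mulrDl mul1r lerD// ltW.
  rewrite ler_wpM2l ?exprn_ge0 ?addr_ge0//.
  apply: (@le_trans _ _ (m ^+ q.+1)).
    by rewrite exprSr ler_peMr ?exprn_ge0// ltW.
  by rewrite (le_trans (hm q))// lerDr.
- apply: L1Z; apply: L1D; first exact: L1_cst.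
  by apply: L1_sum => h; exact: L1W.
Qed.

Lemma row_norm_le k (x : 'rV[R]_k) : `|x| <= \sum_i `|x 0 i|.
Proof.
have [->|x0] := eqVneq `|x| 0; first exact: sumr_ge0.
have [[a i] /= aiE] := mx_norm_neq0 x0.
by rewrite [leLHS]aiE (ord1 a) (bigD1 i)//= lerDl sumr_ge0.
Qed.

Variables (k : nat) (hs : 'I_k -> H).
Notation xi w := (\row_i W (hs i) w).
Notation ss := [seq hs i | i <- enum 'I_k].

Lemma xi_norm_le w : 1 + `|xi w| <= gauss_size ss w.
Proof.
rewrite lerD2l (le_trans (row_norm_le _))// big_map big_enum.
by apply: ler_sum => i _; rewrite mxE.
Qed.

Lemma measurable_xi (phi : 'rV[R]_k -> R) : continuous phi ->
  measurable_fun setT (fun w => phi (xi w)).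
Proof.
move=> cphi.
by apply: (measurable_comp_row (U := fun i => W (hs i)) (Psi := fun=> phi)) => // w; exact: cphi.
Qed.

Lemma xi_bound (phi : 'rV[R]_k -> R) (C : R) p :
  (forall x, `|phi x| <= C * (1 + `|x|) ^+ p) ->
  forall w, `|phi (xi w)| <= C * gauss_size ss w ^+ p.
Proof.
move=> phiC w; apply: (le_trans (phiC _)).
have C0 : 0 <= C.
  have := phiC 0; rewrite normr0 addr0 expr1n mulr1; apply: le_trans.
  exact: normr_ge0.
have g0 : 0 <= gauss_size ss w := le_trans ler01 (gauss_size_ge1 _ _).
by rewrite ler_wpM2l// lerXn2r ?nnegrE ?xi_norm_le ?g0 ?addr_ge0.
Qed.

Lemma L1_gauss_bound X (C : R) s p : measurable_fun setT X ->
  (forall w, `|X w| <= C * gauss_size s w ^+ p) -> L1 P X.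
Proof.
by move=> mX hX; apply: (L1_le mX hX); apply: L1Z; exact: L1_gauss_size.
Qed.

End PolynomialGrowth.

(** * Independence of orthogonal directions *)

Section IntegrationByParts.
Variables (R : realType) (H : completeNormedModType R) (ip : H -> H -> R).
Context (d : measure_display) (T : measurableType d) (P : probability T R).
Variable W : H -> {RV P >-> R}.
Hypothesis ip_inner : inner_product ip.
Hypothesis W_isonormal : isonormal ip W.
Implicit Types (g h : H) (X : T -> R) (c : R) (theta : R -> R).

Lemma cos_expectation g c : \int[P]_w cos (W g w + c) = cos c * expR (- (ip g g / 2)).
Proof.
have [_ _ /(_ 1 c)] := W_props W_isonormal g; rewrite expr1n mulr1 => <-.
by apply: eq_Rintegral => w _; rewrite mul1r.
Qed.

Let L1cos g c : L1 P (fun w => cos (W g w + c)).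
Proof.
have := @L1M_bounded _ _ _ P _ _ 1 (L1_cst P 1) (mW_cos W 1 g c) (fun w => cos_max _).
by apply: eq_L1 => w; rewrite !mul1r.
Qed.

Let mcos g c : measurable_fun setT (fun w => cos (W g w + c)).
Proof. exact: L1_measurable (L1cos g c). Qed.

(** Product-to-sum again: [g + k] and [g - k], with [k = b h], have the same squared norm
    [|g|^2 + |k|^2], so the two exponentials factor. *)
Lemma cos_independent g h (b c c' : R) : ip g h = 0 ->
  \int[P]_w (cos (W g w + c) * cos (W (b *: h) w + c')) =
  (\int[P]_w cos (W g w + c)) * \int[P]_w cos (W (b *: h) w + c').
Proof.
move=> gh; rewrite !cos_expectation.
have : ip g (b *: h) = 0 by rewrite (ipZr ip_inner) gh mulr0.
move: (b *: h) => k gk.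
transitivity (\int[P]_w (2^-1 * (cos (W (1 *: g + k) w + (c + c')) +
                         cos (W (-1 *: k + g) w + (c - c'))))).
  apply: RI_ae.
  - exact: measurable_funM.
  - by apply: measurable_funM => //; exact: measurable_funD.
  - apply: filterS2 (W_linear ip_inner W_isonormal 1 g k) (W_linear ip_inner W_isonormal (-1) k g) => w /= /(_ I) -> /(_ I) -> _.
    rewrite (_ : 1 * W g w + W k w + (c + c') = (W g w + c) + (W k w + c')); last by ring.
    rewrite (_ : -1 * W k w + W g w + (c - c') = (W g w + c) - (W k w + c')); last by ring.
    move: (W g w + c) (W k w + c') => y z.
    by rewrite cosB cosD; field.
rewrite RintegralZl//; last by apply: L1D.
rewrite RintegralD//; [|exact: L1cos..].
have gk' : ip k g = 0 by rewrite (ipC ip_inner).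
have e1 : ip (1 *: g + k) (1 *: g + k) = ip g g + ip k k.
  by rewrite !(ipDl ip_inner, ipDr ip_inner, ipZl ip_inner, ipZr ip_inner) gk gk'; ring.
have e2 : ip (-1 *: k + g) (-1 *: k + g) = ip g g + ip k k.
  by rewrite !(ipDl ip_inner, ipDr ip_inner, ipZl ip_inner, ipZr ip_inner) gk gk'; ring.
rewrite !cos_expectation e1 e2.
by rewrite mulrDl opprD expRD cosB cosD; field.
Qed.

(** The centered cosine of [W g] annihilates all cosines of [W (b h)], hence every event of [W h];
    discretizing [W h] then reaches an unbounded [theta]. *)
Lemma independent_integral g h theta c : ip g h = 0 ->
  continuous theta -> poly_bounded theta -> \int[P]_w theta (W h w) = 0 ->
  \int[P]_w (theta (W h w) * cos (W g w + c)) = 0.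
Proof.
move=> gh ct [C [p hC]] t0.
set m := \int[P]_w cos (W g w + c).
pose X w := cos (W g w + c) - m.
pose K := [set k | exists b : R, k = b *: h].
have KD s k l : K k -> K l -> K (s *: k + l).
  by move=> [b ->] [b' ->]; exists (s * b + b'); rewrite scalerDl scalerA.
have lX : L1 P X by apply: L1B => //; exact: L1_cst.
have aX : annihilates W K X.
  split=> // k c' [b ->]; rewrite /X.
  transitivity (\int[P]_w (cos (W g w + c) * cos (W (b *: h) w + c') - m * cos (W (b *: h) w + c'))).
    by apply: eq_Rintegral => w _; rewrite mulrBl.
  have l1 : L1 P (fun w => cos (W g w + c) * cos (W (b *: h) w + c')).
    by apply: (@L1M_bounded _ _ _ _ _ _ 1) => // w; exact: cos_max.
  rewrite RintegralB//; last exact: L1Z.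
  rewrite [X in _ - X]RintegralZl//; last exact: L1cos.
  by apply/eqP; rewrite subr_eq0; apply/eqP; exact: cos_independent.
have mt : measurable_fun setT theta by exact: continuous_measurable_fun.
have Xm w : `|X w| <= 1 + `|m|.
  by rewrite (le_trans (ler_normB _ _))// lerD2r cos_max.
have tW : L1 P (fun w => theta (W h w)).
  by have [h1 _ _] := W_props W_isonormal h; apply: h1 => //; exists C, p.
have C0 : 0 <= C.
  have := hC 0; rewrite normr0 addr0 expr1n mulr1; apply: le_trans.
  exact: normr_ge0.
have [l0] : L1 P (fun w => X w * theta ((\row_(i < 1) W h w) 0 0)) /\
    \int[P]_w (X w * theta ((\row_(i < 1) W h w) 0 0)) = 0.
  apply: (@integral_discretized _ _ _ P 1 (fun=> W h) (fun w v => X w * theta (v 0 0)) _ _ _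
     (fun w => (1 + `|m|) * C * 2 ^+ p * gauss_size W [:: h] w ^+ p)).
  - by [].
  - by move=> v; apply: measurable_funM => //; exact: L1_measurable lX.
  - move=> w; apply: (@continuousM _ _ (fun=> X w) (fun v : 'rV[R]_1 => theta (v 0 0))).
      exact: cst_continuous.
    apply: (@continuous_comp _ _ _ (fun v : 'rV[R]_1 => v 0 0) theta); last exact: ct.
    exact: coord_continuous.
  - exact: (L1Z _ (L1_gauss_size W_isonormal [:: h] p)).
  - move=> w v /(_ 0) vW; rewrite normrM -!mulrA ler_pM//.
    apply: (le_trans (hC _)); rewrite ler_wpM2l// -exprMn lerXn2r ?nnegrE ?addr_ge0//.
      by rewrite mulr_ge0// (le_trans _ (gauss_size_ge1 _ _ _)).
    rewrite /gauss_size big_seq1; move: vW; have := normr_ge0 (W h w); lra.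
  - move=> n v; set A := box _ v.
    have SA : multiplier_set W K A.
      apply: box_sigma; first exact: multiplier_set_sigma.
      move=> _ B mB; apply: (multiplier_set_preimage ip_inner W_isonormal KD) => //.
      by exists 1; rewrite scale1r.
    set t := theta _.
    transitivity (t * \int[P]_w (X w * \1_A w)); last first.
      by rewrite (annihilates_set ip_inner W_isonormal _ aX SA) ?mulr0//; exists 0; rewrite scale0r.
    rewrite -RintegralZl//; first by apply: eq_Rintegral => w _; ring.
    apply: (@L1M_bounded _ _ _ _ _ _ 1) => //.
      by apply: measurable_indic; case: SA.
    by move=> w; rewrite indicE; case: (w \in A); rewrite ?normr1 ?normr0.
under eq_Rintegral => w _ do rewrite mxE.
move=> e; have l2 : L1 P (fun w => cos (W g w + c) * theta (W h w)).
  apply: eq_L1 (L1M_bounded tW (mcos g c) (fun w => cos_max _)) => w; exact: mulrC.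
move: e; rewrite /X; under eq_Rintegral => w _ do rewrite mulrBl.
rewrite RintegralB//; last exact: L1Z.
rewrite RintegralZl// t0 mulr0 subr0 => e; rewrite -[RHS]e.
by apply: eq_Rintegral => w _; rewrite mulrC.
Qed.

End IntegrationByParts.

(** * Integration by parts and closability *)

Lemma derive_line (R : realType) k (phi : 'rV[R]_k -> R) (a y : 'rV[R]_k) (z : R) :
  differentiable phi (z *: a + y) ->
  is_derive z (1 : R) (fun z => phi (z *: a + y))
    (\sum_i a 0 i * 'D_(delta_mx 0 i) phi (z *: a + y)).
Proof.
move=> dphi; set x := z *: a + y in dphi *.
have E : (fun h : R => h^-1 *: (((fun z => phi (z *: a + y)) \o shift z) (h *: (1 : R)) - phi x)) =
         (fun h : R => h^-1 *: ((phi \o shift x) (h *: a) - phi x)).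
  apply/funext => h /=; congr (_ *: (phi _ - _)).
  by rewrite /x -[h *: 1]/(h * 1) mulr1 scalerDl addrA.
have dE : \sum_i a 0 i * 'D_(delta_mx 0 i) phi x = 'D_a phi x.
  rewrite [in RHS]deriveE// [in RHS](row_sum_delta a) linear_sum.
  by apply: eq_bigr => i _; rewrite linearZ deriveE.
rewrite dE; apply: DeriveDef; last by rewrite /derive E.
by rewrite /derivable E; exact: diff_derivable.
Qed.

Section IntegrationByParts.
Variables (R : realType) (H : completeNormedModType R) (ip : H -> H -> R).
Context (d : measure_display) (T : measurableType d) (P : probability T R).
Variable W : H -> {RV P >-> R}.
Hypothesis ip_inner : inner_product ip.
Hypothesis W_isonormal : isonormal ip W.
Variables (k : nat) (hs : 'I_k -> H) (phi : 'rV[R]_k -> R) (C : R) (p : nat).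
Hypothesis dphi : forall x, differentiable phi x.
Hypothesis cdphi : forall i, continuous (fun x => 'D_(delta_mx 0 i) phi x).
Hypothesis bphi : forall x, `|phi x| <= C * (1 + `|x|) ^+ p.
Hypothesis bdphi : forall i x, `|'D_(delta_mx 0 i) phi x| <= C * (1 + `|x|) ^+ p.
Implicit Types (g h : H) (c z : R).
Notation xi w := (\row_i W (hs i) w).

Let cphi : continuous phi.
Proof. by move=> x; exact/differentiable_continuous. Qed.

Let C0 : 0 <= C.
Proof.
have := bphi 0; rewrite normr0 addr0 expr1n mulr1; apply: le_trans.
exact: normr_ge0.
Qed.

Variables (h g : H) (c : R).
Hypothesis h1 : ip h h = 1.
(** [z] stands for [W h]. The vector [v] holds frozen values of the parts orthogonal to [h]: slot 0
    for [g], slot [i + 1] for [hs i]. With the components [a] and [b] along [h], [arg] and [ang]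
    recover the arguments of [phi] and of the cosine. *)
Let a : 'rV[R]_k := \row_i ip (hs i) h.
Let b := ip g h.
Let arg (v : 'rV[R]_k.+1) z : 'rV[R]_k := z *: a + \row_i v 0 (lift ord0 i).
Let ang (v : 'rV[R]_k.+1) z : R := b * z + (v 0 ord0 + c).
Let dir x : R := \sum_i a 0 i * 'D_(delta_mx 0 i) phi x.
Let eta v z := phi (arg v z) * cos (ang v z).
Let eta' v z := dir (arg v z) * cos (ang v z) + phi (arg v z) * (- sin (ang v z) * b).
(** Stein's identity for the unit vector [h] says that [Th v (W h)] has mean zero. *)
Let Th v z := z * eta v z - eta' v z.

Let A : R := \sum_i `|a 0 i| + `|b|.

Let bdir x : `|dir x| <= (\sum_i `|a 0 i|) * (C * (1 + `|x|) ^+ p).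
Proof.
rewrite (le_trans (ler_norm_sum _ _ _))// mulr_suml; apply: ler_sum => i _.
by rewrite normrM ler_wpM2l.
Qed.

Let cdir : continuous dir.
Proof.
rewrite /dir; elim: (index_enum _) => [|i r IH] x.
  rewrite (_ : (fun x => _) = cst 0); first exact: cst_continuous.
  by apply/funext => y; rewrite big_nil.
rewrite (_ : (fun x => _) = (fun x => a 0 i * 'D_(delta_mx 0 i) phi x) \+
    (fun x => \sum_(j <- r) a 0 j * 'D_(delta_mx 0 j) phi x)).
  apply: continuousD; last exact: IH.
  by apply: continuousM; [exact: cst_continuous|exact: cdphi].
by apply/funext => y; rewrite big_cons.
Qed.

Let deta v z : is_derive z (1 : R) (eta v) (eta' v z).
Proof.
rewrite /eta /eta'; apply: derM; first exact: derive_line.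
by apply: (@der_comp _ cos (ang v)); exact: der_affine.
Qed.

Let carg v : continuous (arg v).
Proof.
move=> z; apply: cvgD; last exact: cvg_cst.
by apply: cvgZr_tmp; exact: cvg_id.
Qed.

Let cang v : continuous (ang v).
Proof. by apply: (@der_continuous _ _ (fun=> b)) => z; exact: der_affine. Qed.

Let ceta' v : continuous (eta' v).
Proof.
move=> z; apply: cvgD; apply: cvgM.
- by apply: (cvg_comp _ dir); [exact: carg|exact: cdir].
- by apply: (cvg_comp _ cos); [exact: cang|exact: continuous_cos].
- by apply: (cvg_comp _ phi); [exact: carg|exact: cphi].
- apply: cvgM; last exact: cvg_cst.
  by apply: cvgN; apply: (cvg_comp _ sin); [exact: cang|exact: continuous_sin].
Qed.

Let ceta v : continuous (eta v).
Proof. exact: (der_continuous (deta v)). Qed.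

Let barg v z : 1 + `|arg v z| <= (1 + `|a| + \sum_i `|v 0 (lift ord0 i)|) * (1 + `|z|).
Proof.
have h2 := row_norm_le (\row_i v 0 (lift ord0 i)).
have h3 : `|arg v z| <= `|z| * `|a| + \sum_i `|v 0 (lift ord0 i)|.
  rewrite (le_trans (ler_normD _ _))// normrZ lerD2l (le_trans h2)//.
  by apply: ler_sum => i _; rewrite mxE.
have s0 : 0 <= \sum_i `|v 0 (lift ord0 i)| by exact: sumr_ge0.
have := normr_ge0 z; have := normr_ge0 a; nra.
Qed.

Let beta v z : `|eta v z| <= C * (1 + `|arg v z|) ^+ p.
Proof.
by rewrite normrM -[leRHS]mulr1 ler_pM ?cos_max.
Qed.

Let beta' v z : `|eta' v z| <= A * (C * (1 + `|arg v z|) ^+ p).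
Proof.
rewrite (le_trans (ler_normD _ _))// /A mulrDl lerD//.
  by rewrite normrM -[leRHS]mulr1 ler_pM ?cos_max.
rewrite !normrM normrN [leRHS]mulrC ler_pM ?mulr_ge0//.
by rewrite ler_piMl// sin_max.
Qed.

Let A0 : 0 <= A.
Proof. by rewrite addr_ge0// sumr_ge0. Qed.

Let barg_exp v z : (1 + `|arg v z|) ^+ p <=
  ((1 + `|a| + \sum_i `|v 0 (lift ord0 i)|) * (1 + `|z|)) ^+ p.
Proof.
have h2 : 0 <= 1 + `|arg v z| by rewrite addr_ge0.
by apply: lerXn2r; rewrite ?nnegrE ?barg ?h2// (le_trans h2 (barg v z)).
Qed.

Let bTh v z : `|Th v z| <= (`|z| + A) * (C * ((1 + `|a| + \sum_i `|v 0 (lift ord0 i)|) * (1 + `|z|)) ^+ p).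
Proof.
apply: (@le_trans _ _ ((`|z| + A) * (C * (1 + `|arg v z|) ^+ p))).
  rewrite (le_trans (ler_normB _ _))// mulrDl lerD// ?beta'//.
  by rewrite normrM ler_wpM2l// beta.
apply: ler_wpM2l; first by rewrite addr_ge0.
by apply: ler_wpM2l => //; exact: barg_exp.
Qed.

Let mC (f : R -> R) : continuous f -> measurable_fun setT f.
Proof. exact: continuous_measurable_fun. Qed.

Let poly_bounded_arg v (K : R) (f : R -> R) : 0 <= K ->
  (forall z, `|f z| <= K * (C * (1 + `|arg v z|) ^+ p)) -> poly_bounded f.
Proof.
move=> K0 hf; set S := 1 + `|a| + \sum_i `|v 0 (lift ord0 i)|.
exists (K * (C * S ^+ p)), p => z; apply: (le_trans (hf z)).
rewrite -[leRHS]mulrA (ler_wpM2l K0)// -mulrA (ler_wpM2l C0)// -exprMn.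
exact: barg_exp.
Qed.

Let pb_eta v : poly_bounded (eta v).
Proof. by apply: (@poly_bounded_arg v 1) => // z; rewrite mul1r beta. Qed.

Let pb_eta' v : poly_bounded (eta' v).
Proof. by apply: (@poly_bounded_arg v A) => // z; exact: beta'. Qed.

Let cTh v : continuous (Th v).
Proof.
move=> z; apply: cvgB; last exact: ceta'.
by apply: cvgM; [exact: cvg_id|exact: ceta].
Qed.

Let pbTh v : poly_bounded (Th v).
Proof.
set S := 1 + `|a| + \sum_i `|v 0 (lift ord0 i)|.
have S0 : 0 <= S by rewrite !addr_ge0// sumr_ge0.
exists ((1 + A) * (C * S ^+ p)), p.+1 => z; apply: (le_trans (bTh v z)).
rewrite exprMn exprS.
have -> : (1 + A) * (C * S ^+ p) * ((1 + `|z|) * (1 + `|z|) ^+ p) =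
  ((1 + A) * (1 + `|z|)) * (C * (S ^+ p * (1 + `|z|) ^+ p)) by ring.
apply: ler_wpM2r; first by rewrite !mulr_ge0// ?exprn_ge0// addr_ge0.
by rewrite mulrDl mul1r lerD// ?lerDr// ler_peMr// lerDl.
Qed.

Let ETh v : \int[P]_w Th v (W h w) = 0.
Proof.
have [l1 st _] := W_props W_isonormal h.
rewrite /Th RintegralB//; first by rewrite (st _ _ (deta v))// h1 mul1r subrr.
- apply: (l1 (fun z => z * eta v z)).
    by apply: mC => z; apply: cvgM; [exact: cvg_id|exact: ceta].
  have [D [q hD]] := pb_eta v; exists D, q.+1 => z; rewrite normrM exprS mulrCA.
  by apply: ler_pM => //; rewrite lerDr.
- by apply: (l1 (eta' v)) => //; exact: mC.
Qed.

Let K : set H := [set x | ip x h = 0].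
(** The residuals after projection on [h], in the form [c *: h + x] to which [W_linear] applies. *)
Let gs (j : 'I_k.+1) : H :=
  if unlift ord0 j is Some i then - ip (hs i) h *: h + hs i else - b *: h + g.

Let KD s x y : K x -> K y -> K (s *: x + y).
Proof.
by rewrite /K /= => x0 y0; rewrite (ipDl ip_inner) (ipZl ip_inner) x0 y0 mulr0 addr0.
Qed.

Let Kgs j : K (gs j).
Proof.
by rewrite /gs /K /=; case: unliftP => [i _|_]; rewrite (ipDl ip_inner) (ipZl ip_inner) h1 mulr1 addNr.
Qed.

Let Th_annihilates v : annihilates W K (fun w => Th v (W h w)).
Proof.
have [l1 _ _] := W_props W_isonormal h.
split; first by apply: (l1 (Th v)) => //; exact: mC.
by move=> x c' Kx; apply: (independent_integral ip_inner W_isonormal) => //.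
Qed.

Let Psi w (v : 'rV[R]_k.+1) := Th v (W h w).

Let cPsi w v : {for v, continuous (Psi w)}.
Proof.
have cl j : continuous (fun v : 'rV[R]_k.+1 => v 0 j) by exact: coord_continuous.
have ca : continuous (fun v : 'rV[R]_k.+1 => arg v (W h w)).
  move=> x; rewrite /arg.
  apply: (@continuousD _ _ _ (fun=> W h w *: a) (fun v : 'rV[R]_k.+1 => \row_i v 0 (lift ord0 i))).
    exact: cst_continuous.
  have -> : (fun v : 'rV[R]_k.+1 => \row_i v 0 (lift ord0 i)) =
    (fun v => \sum_i v 0 (lift ord0 i) *: delta_mx 0 i).
    by apply/funext => y; rewrite [LHS]row_sum_delta; apply: eq_bigr => i _; rewrite mxE.
  elim: (index_enum _) => [|i r IH].
    rewrite (_ : (fun x => _) = cst 0); first exact: cst_continuous.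
    by apply/funext => y; rewrite big_nil.
  rewrite (_ : (fun x => _) = (fun v : 'rV[R]_k.+1 => v 0 (lift ord0 i) *: delta_mx 0 i) \+
     (fun v => \sum_(j <- r) v 0 (lift ord0 j) *: (delta_mx 0 j : 'rV[R]_k))); last first.
    by apply/funext => y; rewrite big_cons.
  by apply: (@continuousD _ _ _ (fun v : 'rV[R]_k.+1 => v 0 (lift ord0 i) *: delta_mx 0 i)) IH; exact: (cvgZr_tmp (cl (lift ord0 i) x)).
have cg : continuous (fun v : 'rV[R]_k.+1 => ang v (W h w)).
  move=> x; apply: (@continuousD _ _ _ (fun=> b * W h w) (fun v : 'rV[R]_k.+1 => v 0 ord0 + c)).
    exact: cst_continuous.
  apply: (@continuousD _ _ _ (fun v : 'rV[R]_k.+1 => v 0 ord0) (fun=> c)); first exact: cl.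
  exact: cst_continuous.
have c1 : {for v, continuous (fun v => phi (arg v (W h w)))}.
  by apply: (continuous_comp (ca v)); exact: cphi.
have c2 : {for v, continuous (fun v => dir (arg v (W h w)))}.
  by apply: (continuous_comp (ca v)); exact: cdir.
have c3 : {for v, continuous (fun v => cos (ang v (W h w)))}.
  by apply: (continuous_comp (cg v)); exact: continuous_cos.
have c4 : {for v, continuous (fun v => sin (ang v (W h w)))}.
  by apply: (continuous_comp (cg v)); exact: continuous_sin.
have cM (u u' : 'rV[R]_k.+1 -> R) : {for v, continuous u} -> {for v, continuous u'} ->
    {for v, continuous (fun x => u x * u' x)} by exact: continuousM.
have cD (u u' : 'rV[R]_k.+1 -> R) : {for v, continuous u} -> {for v, continuous u'} ->
    {for v, continuous (fun x => u x + u' x)} by exact: continuousD.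
have cN (u : 'rV[R]_k.+1 -> R) : {for v, continuous u} ->
    {for v, continuous (fun x => - u x)} by exact: continuousN.
have cC (r : R) : {for v, continuous (fun _ : 'rV[R]_k.+1 => r)} by exact: cst_continuous.
rewrite /Psi /Th /eta /eta'; apply: (cD _ _).
  by apply: (cM _ _); [exact: cC|apply: (cM _ _); [exact: c1|exact: c3]].
apply: (cN _); apply: (cD _ _); first by apply: (cM _ _); [exact: c2|exact: c3].
apply: (cM _ _); first exact: c1.
by apply: (cM _ _); [apply: (cN _); exact: c4|exact: cC].
Qed.

Let G w := gauss_size W (h :: [seq gs j | j <- enum 'I_k.+1]) w.

Let bW w : `|W h w| <= G w.
Proof. by rewrite /G /gauss_size big_cons addrCA lerDl addr_ge0// sumr_ge0. Qed.

Let G1 w : 1 <= G w. Proof. exact: gauss_size_ge1. Qed.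

Let bU w : \sum_j `|W (gs j) w| <= G w.
Proof.
by rewrite /G /gauss_size big_cons addrA -[leLHS]add0r lerD ?addr_ge0// big_map big_enum.
Qed.

Let B w := (1 + A) * (C * (2 + `|a| + k%:R) ^+ p * 2 ^+ p) * G w ^+ (1 + (p + p)).

Let bPsi w (v : 'rV[R]_k.+1) : (forall j, `|v 0 j| <= `|W (gs j) w| + 1) -> `|Psi w v| <= B w.
Proof.
move=> hv; apply: (le_trans (bTh _ _)).
have G0 : 0 <= G w by exact: le_trans (G1 w).
have h2 : \sum_i `|v 0 (lift ord0 i)| <= G w + k%:R.
  apply: (@le_trans _ _ (\sum_i (`|W (gs (lift ord0 i)) w| + 1))); first exact: ler_sum.
  rewrite big_split/= sumr_const card_ord lerD2r.
  by apply: le_trans (bU w); rewrite big_ord_recl lerDr.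
have S0 : 0 <= \sum_i `|v 0 (lift ord0 i)| by exact: sumr_ge0.
have h3 : `|W h w| + A <= (1 + A) * G w.
  by rewrite mulrDl mul1r lerD// ler_peMr.
have h4 : (1 + `|a| + \sum_i `|v 0 (lift ord0 i)|) * (1 + `|W h w|) <=
   ((2 + `|a| + k%:R) * G w) * (2 * G w).
  apply: ler_pM; rewrite ?addr_ge0//; last by have := bW w; have := G1 w; lra.
  have k0 : 0 <= k%:R :> R by [].
  have p1 : `|a| <= `|a| * G w by rewrite ler_peMr.
  have p2 : k%:R <= k%:R * G w by rewrite ler_peMr.
  by rewrite !mulrDl; move: h2 p1 p2 (G1 w); lra.
have h5 := lerXn2r p _ _ h4.
apply: (@le_trans _ _ ((1 + A) * G w * (C * (((2 + `|a| + k%:R) * G w) * (2 * G w)) ^+ p))).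
  apply: ler_pM => //; first by rewrite addr_ge0.
    by rewrite mulr_ge0// exprn_ge0// mulr_ge0 ?addr_ge0.
  apply: ler_wpM2l => //; apply: lerXn2r => //; rewrite nnegrE.
    by rewrite mulr_ge0 ?addr_ge0.
  by rewrite !mulr_ge0// !addr_ge0.
by rewrite /B !exprMn !exprD expr1 le_eqVlt; apply/orP; left; apply/eqP; ring.
Qed.

Let Psi0 : L1 P (fun w => Psi w (\row_j W (gs j) w)) /\
  \int[P]_w Psi w (\row_j W (gs j) w) = 0.
Proof.
have [l1 _ _] := W_props W_isonormal h.
apply: (@integral_discretized _ _ _ _ _ (fun j => W (gs j)) Psi _ _ _ B) => //.
- by move=> v; apply: L1_measurable; apply: (l1 (Th v)) => //; exact: mC.
- by rewrite /B; apply: (L1Z _ (L1_gauss_size W_isonormal _ _)).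
- move=> n v; apply: (annihilates_set ip_inner W_isonormal _ (Th_annihilates _)).
    exact: ip0l.
  apply: box_sigma; first exact: multiplier_set_sigma.
  by move=> i A' mA'; apply: (multiplier_set_preimage ip_inner W_isonormal KD).
Qed.

Let G' w := gauss_size W (h :: [seq hs i | i <- enum 'I_k]) w.

Let G1' w : 1 <= G' w. Proof. exact: gauss_size_ge1. Qed.

Let L1xi (f : 'rV[R]_k -> R) (K' : R) (X : T -> R) : continuous f ->
  (forall x, `|f x| <= K' * (C * (1 + `|x|) ^+ p)) ->
  measurable_fun setT X -> (forall w, `|X w| <= G' w) ->
  L1 P (fun w => f (xi w) * X w).
Proof.
move=> cf bf mX bX.
apply: (L1_gauss_bound W_isonormal (C := `|K'| * C) (s := h :: [seq hs i | i <- enum 'I_k]) (p := p.+1)).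
  by apply: (@measurable_funM _ _ _ _ (fun w => f (xi w)) X) => //; exact: (measurable_xi W hs cf).
move=> w; rewrite normrM exprSr mulrA; apply: ler_pM => //.
apply: (le_trans (bf _)); rewrite -mulrA.
have n0 : 0 <= C * (1 + `|xi w|) ^+ p by rewrite mulr_ge0// exprn_ge0// addr_ge0.
apply: (le_trans (ler_wpM2r n0 (ler_norm K'))); rewrite ler_wpM2l// ler_wpM2l//.
apply: lerXn2r; rewrite ?nnegrE; [by rewrite addr_ge0|exact: (le_trans ler01 (G1' w))|].
apply: (le_trans (xi_norm_le W hs w)).
by rewrite /gauss_size lerD2l big_cons lerDr.
Qed.

Let mangle : measurable_fun setT (fun w => W g w + c).
Proof. by apply: measurable_funD => //; exact: measurable_cst. Qed.

Let mcos : measurable_fun setT (fun w => cos (W g w + c)).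
Proof. by apply: (measurableT_comp _ mangle); apply: mC; exact: continuous_cos. Qed.

Let msin : measurable_fun setT (fun w => sin (W g w + c)).
Proof. by apply: (measurableT_comp _ mangle); apply: mC; exact: continuous_sin. Qed.

Let bphi1 x : `|phi x| <= 1 * (C * (1 + `|x|) ^+ p).
Proof. by rewrite mul1r. Qed.

(* Each hs i is the sum of a multiple of h and of a vector gs i orthogonal to h.
   For frozen values of the W (gs i), which are independent of W h, the identity
   is Stein's identity for W h; a discretization of the W (gs i) unfreezes them. *)
Lemma integration_by_parts :
  [/\ L1 P (fun w => phi (xi w) * (W h w * cos (W g w + c))),
      L1 P (fun w => phi (xi w) * sin (W g w + c)),
      L1 P (fun w => (\sum_i ip (hs i) h * 'D_(delta_mx 0 i) phi (xi w)) * cos (W g w + c))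
    & \int[P]_w (phi (xi w) * (W h w * cos (W g w + c))) + ip g h * \int[P]_w (phi (xi w) * sin (W g w + c)) =
      \int[P]_w ((\sum_i ip (hs i) h * 'D_(delta_mx 0 i) phi (xi w)) * cos (W g w + c))].
Proof.
have l1 : L1 P (fun w => phi (xi w) * (W h w * cos (W g w + c))).
  apply: (L1xi cphi bphi1); first exact: measurable_funM.
  move=> w; rewrite normrM (@le_trans _ _ (`|W h w|))//; first by rewrite ler_piMr// cos_max.
  by rewrite /G' /gauss_size big_cons addrCA lerDl addr_ge0// sumr_ge0.
have l2 : L1 P (fun w => phi (xi w) * sin (W g w + c)).
  by apply: (L1xi cphi bphi1) => // w; rewrite (le_trans (sin_max _)).
have dirE w : \sum_i ip (hs i) h * 'D_(delta_mx 0 i) phi (xi w) = dir (xi w).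
  by rewrite /dir; apply: eq_bigr => i _; rewrite mxE.
have l3 : L1 P (fun w => (\sum_i ip (hs i) h * 'D_(delta_mx 0 i) phi (xi w)) * cos (W g w + c)).
  apply: (@eq_L1 _ _ _ _ (fun w => dir (xi w) * cos (W g w + c))); first by move=> w; rewrite dirE.
  by apply: (L1xi cdir bdir) => // w; rewrite (le_trans (cos_max _)).
split=> //; have [lP P0] := Psi0.
have lS : L1 P (fun w => phi (xi w) * (W h w * cos (W g w + c)) + b * (phi (xi w) * sin (W g w + c))).
  by apply: L1D => //; exact: L1Z.
have E : (fun w => Psi w (\row_j W (gs j) w)) = (fun w => phi (xi w) * (W h w * cos (W g w + c)) + b * (phi (xi w) * sin (W g w + c))
    - (\sum_i ip (hs i) h * 'D_(delta_mx 0 i) phi (xi w)) * cos (W g w + c)) %[ae P].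
  (* [W] is linear only up to null sets, so the arguments are reassembled from the residuals almost
     surely. *)
  have Hi : \forall x \ae P, forall i, W (hs i) x = ip (hs i) h * W h x + W (gs (lift ord0 i)) x.
    apply: filter_forall => i.
    have := W_linear ip_inner W_isonormal (- ip (hs i) h) h (hs i).
    by apply: filterS => x Hx; rewrite /gs liftK Hx// mulNr addNKr.
  have Hg := W_linear ip_inner W_isonormal (- b) h g.
  apply: filterS2 Hi Hg => x Hi Hg _.
  have ax : arg (\row_j W (gs j) x) (W h x) = xi x.
    by apply/rowP => i; rewrite !mxE Hi mulrC.
  have nx : ang (\row_j W (gs j) x) (W h x) = W g x + c.
    by rewrite /ang mxE /gs unlift_none Hg// mulNr; ring.
  by rewrite /Psi /Th /eta /eta' ax nx dirE; ring.
have := RI_ae (L1_measurable lP) (L1_measurable (L1B lS l3)) E.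
rewrite P0 RintegralB// RintegralD//; last exact: L1Z.
by rewrite RintegralZl// => /esym/eqP; rewrite subr_eq0 => /eqP.
Qed.

End IntegrationByParts.

(** * Orthonormal expansions *)

Section Hilbert.
Variables (R : realType) (H : completeNormedModType R) (ip : H -> H -> R) (e : nat -> H).
Hypothesis ip_inner : inner_product ip.
Hypothesis e_basis : complete_orthonormal_system ip e.
Implicit Types (x y : H) (c : nat -> R).

Lemma ip_cauchy_schwarz x y : ip x y ^+ 2 <= `|x| ^+ 2 * `|y| ^+ 2.
Proof.
have [y0|y0] := eqVneq (ip y y) 0.
  have -> : ip x y = 0.
    have -> : y = 0.
      by apply/eqP; rewrite -normr_eq0 -sqrf_eq0 -(ip_norm ip_inner) y0.
    by rewrite (ipC ip_inner) (ip0l ip_inner).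
  by rewrite expr0n /= mulr_ge0.
have h := ip_ge0 ip_inner (ip y y *: x - ip x y *: y).
rewrite -!(ip_norm ip_inner).
have : 0 <= ip y y * (ip x x * ip y y - ip x y ^+ 2).
  apply: (le_trans h); rewrite le_eqVlt; apply/orP; left; apply/eqP.
  rewrite !(ipBl ip_inner, ipBr ip_inner, ipZl ip_inner, ipZr ip_inner) (ipC ip_inner y x); ring.
have y1 : 0 < ip y y by rewrite lt_def y0 ip_ge0.
by rewrite pmulr_rge0// subr_ge0.
Qed.

Lemma ip_sum_basis c (r : seq nat) j : uniq r ->
  ip (\sum_(i <- r) c i *: e i) (e j) = if j \in r then c j else 0.
Proof.
elim: r => [|i r IH]; first by rewrite big_nil (ip0l ip_inner).
move=> /andP[ir /IH E]; rewrite big_cons (ipDl ip_inner) (ipZl ip_inner) e_basis.1 E inE eq_sym.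
have [->|ij] := eqVneq j i; first by rewrite (negbTE ir) mulr1 addr0.
by rewrite mulr0 add0r.
Qed.

Lemma norm_sum_basis c (r : seq nat) : uniq r ->
  `|\sum_(i <- r) c i *: e i| ^+ 2 = \sum_(i <- r) c i ^+ 2.
Proof.
move=> ur; rewrite -(ip_norm ip_inner).
have E y (s : seq nat) : ip y (\sum_(i <- s) c i *: e i) = \sum_(i <- s) c i * ip y (e i).
  elim: s => [|i s IH]; first by rewrite !big_nil (ipC ip_inner) (ip0l ip_inner).
  by rewrite !big_cons (ipDr ip_inner) (ipZr ip_inner) IH.
rewrite E big_seq [RHS]big_seq; apply: eq_bigr => i ir.
by rewrite ip_sum_basis// ir expr2.
Qed.

Lemma cvg_ip_l (s : nat -> H) x y : s @ \oo --> x -> (fun n => ip (s n) y) @ \oo --> ip x y.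
Proof.
move=> sx; apply/cvgrPdist_le => ep ep0.
have d0 : 0 < ep / (1 + `|y|) by rewrite divr_gt0// ltr_pwDl.
move/cvgrPdist_le : sx => /(_ _ d0); apply: filterS => n hn.
rewrite -(ipBl ip_inner).
have y0 : 0 < 1 + `|y| by rewrite ltr_pwDl.
have : ip (x - s n) y ^+ 2 <= ep ^+ 2.
  apply: (le_trans (ip_cauchy_schwarz _ _)); rewrite -exprMn.
  apply: lerXn2r; rewrite ?nnegrE ?mulr_ge0 ?(ltW ep0)//.
  rewrite ler_pdivlMr// in hn; apply: le_trans hn.
  by rewrite ler_wpM2l// lerDr.
by rewrite -(ler_sqr (x := `|_|)) ?nnegrE ?(ltW ep0)// real_normK ?num_real.
Qed.

(** The Riesz-Fischer theorem: by orthonormality the Cauchy criterion for the vectors is the one for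
    the sums of squares. *)
Lemma basis_sum_exists c (M : R) : (forall n, \sum_(i < n) c i ^+ 2 <= M) ->
  exists y, (fun n => \sum_(0 <= i < n) c i *: e i) @ \oo --> y /\ forall j, ip y (e j) = c j.
Proof.
move=> hM.
have cs : cvgn (series (fun i => c i ^+ 2)).
  apply: nondecreasing_is_cvgn.
    by apply: nondecreasing_series => i _ _; exact: sqr_ge0.
  by exists M => _ [n _ <-]; rewrite /series /= big_mkord.
have cy : cvgn (series (fun i => c i *: e i)).
  apply/cauchy_cvgP/cauchy_seriesP => ep ep0.
  have ep2 : 0 < ep ^+ 2 by rewrite exprn_gt0.
  move/cauchy_cvgP/cauchy_seriesP : cs => /(_ _ ep2); apply: filterS => -[a b] /=.
  rewrite -norm_sum_basis ?iota_uniq// (ger0_norm (sqr_ge0 _)).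
  by rewrite ltr_sqr ?nnegrE ?(ltW ep0).
exists (limn (series (fun i => c i *: e i))); split; first exact: cy.
move=> j; set y := limn _; apply: (@cvg_unique _ _ _ _ _ _ (cvg_ip_l (y := e j) cy)) => //=.
apply: (cvg_near_cst); exists j.+1 => // n /= jn.
by rewrite /series /= ip_sum_basis ?iota_uniq// mem_index_iota jn.
Qed.

Lemma bessel x n : \sum_(i < n) ip x (e i) ^+ 2 <= `|x| ^+ 2.
Proof.
rewrite -[X in X <= _](big_mkord xpredT (fun i => ip x (e i) ^+ 2)).
set s := \sum_(0 <= i < n) ip x (e i) *: e i.
have E : ip s x = \sum_(0 <= i < n) ip x (e i) ^+ 2.
  rewrite /s (ip_suml ip_inner); apply: eq_bigr => i _.
  by rewrite (ipZl ip_inner) (ipC ip_inner) expr2.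
have N : ip s s = \sum_(0 <= i < n) ip x (e i) ^+ 2.
  by rewrite (ip_norm ip_inner) norm_sum_basis ?iota_uniq.
have := ip_ge0 ip_inner (x - s).
rewrite !(ipBl ip_inner, ipBr ip_inner) (ipC ip_inner x s) E N subrr subr0 (ip_norm ip_inner).
by rewrite subr_ge0.
Qed.

(** The sum of the expansion has the same coefficients as [x], so it is [x] by completeness of the
    system. *)
Lemma parseval x : (fun n => \sum_(0 <= i < n) ip x (e i) ^+ 2) @ \oo --> `|x| ^+ 2.
Proof.
have [y [sy ey]] := basis_sum_exists (c := fun i => ip x (e i)) (bessel x).
have xy : x = y.
  apply/eqP; rewrite -subr_eq0; apply/eqP; apply: e_basis.2 => j.
  by rewrite (ipBl ip_inner) ey subrr.
have hn := cvg_norm sy; rewrite -xy in hn.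
have -> : (fun n => \sum_(0 <= i < n) ip x (e i) ^+ 2) =
  (fun n => `|\sum_(0 <= i < n) ip x (e i) *: e i| * `|\sum_(0 <= i < n) ip x (e i) *: e i|).
  by apply/funext => n; rewrite -expr2 norm_sum_basis ?iota_uniq.
by rewrite expr2; apply: cvgM; exact: hn.
Qed.

Lemma parseval_ip x y :
  (fun n => \sum_(0 <= i < n) ip x (e i) * ip y (e i)) @ \oo --> ip x y.
Proof.
have -> : ip x y = 2^-1 * (`|x + y| ^+ 2 - `|x| ^+ 2 - `|y| ^+ 2).
  rewrite -!(ip_norm ip_inner) !(ipDl ip_inner, ipDr ip_inner) (ipC ip_inner y x); lra.
have -> : (fun n => \sum_(0 <= i < n) ip x (e i) * ip y (e i)) =
  (fun n => 2^-1 * (\sum_(0 <= i < n) ip (x + y) (e i) ^+ 2 -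
     \sum_(0 <= i < n) ip x (e i) ^+ 2 - \sum_(0 <= i < n) ip y (e i) ^+ 2)).
  apply/funext => n; rewrite -!sumrB mulr_sumr; apply: eq_bigr => i _.
  by rewrite (ipDl ip_inner); field.
apply: cvgM; first exact: cvg_cst.
by apply: cvgB; [apply: cvgB|]; exact: parseval.
Qed.

End Hilbert.

(** * Polynomials as smooth functions *)

Section Polynomials.
Variables (R : realType) (N : nat).
Notation poly := (mpoly N R).
Notation Xv i := (mpolyX R (mnm1 i) : poly).
Implicit Types (p q : poly) (x : 'rV[R]_N).

Definition polyfun p x : R := meval (fun i => x 0 i) p.

(** Differentiability and growth bounds pass through sums and products, so this induction suits them
    better than one on monomials. *)
Lemma mpoly_ring_ind (Q : poly -> Prop) : (forall c, Q (mpolyC N c)) -> (forall i, Q (Xv i)) ->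
  (forall p q, Q p -> Q q -> Q (p + q)) -> (forall p q, Q p -> Q q -> Q (p * q)) ->
  forall p, Q p.
Proof.
move=> QC QX QD QM p; rewrite (mpolyE p).
have Q0 : Q 0 by rewrite -(mpolyC0 N R); exact: QC.
have Q1 : Q 1 by exact: QC.
elim: (msupp p) => [|m r IH]; first by rewrite big_nil.
rewrite big_cons; apply: (QD _ _ _ IH); rewrite -mul_mpolyC; apply: (QM _ _ (QC _)).
rewrite mpolyXE_id; elim: (index_enum _) => [|i s IHs]; first by rewrite big_nil.
rewrite big_cons; apply: (QM _ _ _ IHs); elim: (m i) => [|k IHk]; first by rewrite expr0.
by rewrite exprS; exact: QM.
Qed.

Lemma differentiable_polyfun p x : differentiable (polyfun p) x.
Proof.
elim/mpoly_ring_ind: p => [c|i|p q dp dq|p q dp dq].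
- rewrite (_ : polyfun _ = cst c); first exact: differentiable_cst.
  by apply/funext => y; rewrite /polyfun mevalC.
- rewrite (_ : polyfun _ = (fun y => y 0 i)); first exact: differentiable_coord.
  by apply/funext => y; rewrite /polyfun mevalXU.
- rewrite (_ : polyfun _ = polyfun p + polyfun q); first exact: differentiableD.
  by apply/funext => y; rewrite /polyfun mevalD.
- rewrite (_ : polyfun _ = polyfun p * polyfun q); first exact: differentiableM.
  by apply/funext => y; rewrite /polyfun mevalM.
Qed.

Lemma derive_polyfun j p x : 'D_(delta_mx 0 j) (polyfun p) x = polyfun (mderiv j p) x.
Proof.
elim/mpoly_ring_ind: p => [c|i|p q dp dq|p q dp dq].
- rewrite (_ : polyfun (mpolyC _ _) = cst c) ?derive_cst ?mderivC ?/polyfun ?meval0//.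
  by apply/funext => y; rewrite /polyfun mevalC.
- rewrite (_ : polyfun (mpolyX _ _) = (fun y => y 0 i)).
    set c := fun y : 'rV[R]_N => y 0 i.
    have cl : linear c by move=> a y z; rewrite /c !mxE.
    pose cL := HB.pack_for {linear 'rV[R]_N -> R} c (GRing.isLinear.Build _ _ _ _ c cl).
    rewrite -[c]/(cL : _ -> _) deriveE; last exact/linear_differentiable/coord_continuous.
    rewrite diff_lin; last exact: coord_continuous.
    by rewrite /polyfun mderivXU /= /c mxE eqxx/= eq_sym; case: eqP => _; rewrite ?meval1 ?meval0.
  by apply/funext => y; rewrite /polyfun mevalXU.
- rewrite (_ : polyfun (p + q) = polyfun p + polyfun q).
    rewrite deriveD ?dp ?dq; try exact/diff_derivable/differentiable_polyfun.
    by rewrite /polyfun mderivD mevalD.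
  by apply/funext => y; rewrite /polyfun mevalD.
- rewrite (_ : polyfun (p * q) = polyfun p * polyfun q).
    rewrite deriveM ?dp ?dq; try exact/diff_derivable/differentiable_polyfun.
    by rewrite /polyfun mderivM mevalD !mevalM /= -![_ *: _]/(_ * _); ring.
  by apply/funext => y; rewrite /polyfun mevalM.
Qed.

Lemma iter_partial_polyfun s p : iter_partial s (polyfun p) = polyfun (foldr (@mderiv N R) p s).
Proof.
elim: s => //= i s IH; apply/funext => x.
by rewrite /iter_partial /= -/(iter_partial s _) IH derive_polyfun.
Qed.

Lemma polyfun_bound p : exists (C : R) (k : nat), forall x, `|polyfun p x| <= C * (1 + `|x|) ^+ k.
Proof.
have n1 x : 1 <= 1 + `|x| by rewrite lerDl.
have n0 x : 0 <= 1 + `|x| by rewrite addr_ge0.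
suff [C [k [_ h]]] : exists (C : R) (k : nat), 0 <= C /\ forall x, `|polyfun p x| <= C * (1 + `|x|) ^+ k.
  by exists C, k.
elim/mpoly_ring_ind: p => [c|i|p q [C [k [C0 hp]]] [D [l [D0 hq]]]|p q [C [k [C0 hp]]] [D [l [D0 hq]]]].
- by exists `|c|, 0%N; split=> // x; rewrite /polyfun mevalC mulr1.
- exists 1, 1%N; split=> // x; rewrite /polyfun mevalXU mul1r expr1.
  apply: (@le_trans _ _ `|x|); last by rewrite lerDr.
  rewrite [leRHS]mx_normrE; exact: (le_bigmax _ (fun ij : 'I_1 * 'I_N => `|x ij.1 ij.2|) (0, i)).
- exists (C + D), (k + l)%N; split=> [|x]; first exact: addr_ge0.
  rewrite /polyfun mevalD (le_trans (ler_normD _ _))// mulrDl lerD//.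
    by apply: (le_trans (hp x)); rewrite ler_wpM2l// ler_weXn2l// leq_addr.
  by apply: (le_trans (hq x)); rewrite ler_wpM2l// ler_weXn2l// leq_addl.
- exists (C * D), (k + l)%N; split=> [|x]; first exact: mulr_ge0.
  by rewrite /polyfun mevalM normrM exprD mulrACA; apply: ler_pM => //; [exact: hp|exact: hq].
Qed.

Lemma smooth_polyfun p : smooth_poly_growth (polyfun p).
Proof.
move=> s; rewrite iter_partial_polyfun; split; first exact: differentiable_polyfun.
exact: polyfun_bound.
Qed.

End Polynomials.

Lemma uniform_growth (R : realType) (k : nat) (J : finType) (F : J -> 'rV[R]_k -> R) :
  (forall j, exists (C : R) (p : nat), forall x, `|F j x| <= C * (1 + `|x|) ^+ p) ->
  exists (C : R) (p : nat), forall j x, `|F j x| <= C * (1 + `|x|) ^+ p.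
Proof.
move=> /choice[C /choice[p hF]].
exists (\sum_j `|C j|), (\sum_j p j)%N => j x; apply: (le_trans (hF j x)).
have n1 : 1 <= 1 + `|x| by rewrite lerDl.
have n0 : 0 <= 1 + `|x| by rewrite addr_ge0.
apply: (@le_trans _ _ (`|C j| * (1 + `|x|) ^+ p j)).
  by rewrite ler_wpM2r ?exprn_ge0// ler_norm.
apply: ler_pM; rewrite ?exprn_ge0//.
  by rewrite (bigD1 j)//= lerDl sumr_ge0.
by rewrite ler_weXn2l// (bigD1 j)//= leq_addr.
Qed.

Section SmoothIntegrationByParts.
Variables (R : realType) (H : completeNormedModType R) (ip : H -> H -> R).
Context (d : measure_display) (T : measurableType d) (P : probability T R).
Variable W : H -> {RV P >-> R}.
Hypothesis ip_inner : inner_product ip.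
Hypothesis W_isonormal : isonormal ip W.

Lemma smooth_growth k (phi : 'rV[R]_k -> R) : smooth_poly_growth phi ->
  [/\ continuous phi, forall i, continuous (fun x => 'D_(delta_mx 0 i) phi x) &
  exists (C : R) (p : nat), (forall x, `|phi x| <= C * (1 + `|x|) ^+ p) /\
    forall i x, `|'D_(delta_mx 0 i) phi x| <= C * (1 + `|x|) ^+ p].
Proof.
move=> sphi; split.
- by move=> x; apply: differentiable_continuous; have [h _] := sphi [::]; exact: h.
- by move=> i x; apply: differentiable_continuous; have [h _] := sphi [:: i]; exact: h.
pose F (o : option 'I_k) := if o is Some i then (fun x => 'D_(delta_mx 0 i) phi x) else phi.
have [|C [p hC]] := @uniform_growth _ _ _ F.
  by case=> [i|]; [have [_ h] := sphi [:: i]|have [_ h] := sphi [::]]; exact: h.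
by exists C, p; split=> [x|i x]; [exact: (hC None)|exact: (hC (Some i))].
Qed.

Lemma smooth_integration_by_parts k (hs : 'I_k -> H) (phi : 'rV[R]_k -> R) (h g : H) (c : R) :
  smooth_poly_growth phi -> ip h h = 1 ->
  [/\ L1 P (fun w => phi (\row_i W (hs i) w) * (W h w * cos (W g w + c))),
      L1 P (fun w => phi (\row_i W (hs i) w) * sin (W g w + c)),
      L1 P (fun w => (\sum_i ip (hs i) h * 'D_(delta_mx 0 i) phi (\row_i W (hs i) w)) * cos (W g w + c))
    & \int[P]_w (phi (\row_i W (hs i) w) * (W h w * cos (W g w + c))) +
        ip g h * \int[P]_w (phi (\row_i W (hs i) w) * sin (W g w + c)) =
      \int[P]_w ((\sum_i ip (hs i) h * 'D_(delta_mx 0 i) phi (\row_i W (hs i) w)) * cos (W g w + c))].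
Proof.
move=> sphi h1; have [_ cd [C [p [b bd]]]] := smooth_growth sphi.
have dphi x : differentiable phi x by have [+ _] := sphi [::]; exact.
by apply: integration_by_parts.
Qed.

End SmoothIntegrationByParts.

(** * The Gaussian mean of polynomials *)

Section PolynomialExpectation.
Variables (R : realType) (H : completeNormedModType R) (ip : H -> H -> R) (e : nat -> H).
Context (d : measure_display) (T : measurableType d) (P : probability T R).
Variable W : H -> {RV P >-> R}.
Hypothesis ip_inner : inner_product ip.
Hypothesis e_basis : complete_orthonormal_system ip e.
Hypothesis W_isonormal : isonormal ip W.
Variable N : nat.
Implicit Types (p q : mpoly N R).

Definition gauss_poly p w : R := meval (fun i : 'I_N => W (e i) w) p.

Lemma gauss_polyE p w : gauss_poly p w = polyfun p (\row_(i < N) W (e i) w).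
Proof. by apply: meval_eq => i; rewrite mxE. Qed.

Lemma measurable_gauss_poly p : measurable_fun setT (gauss_poly p).
Proof.
rewrite (_ : gauss_poly p = (fun w => polyfun p (\row_(i < N) W (e i) w))).
  by apply: measurable_xi => x; exact/differentiable_continuous/differentiable_polyfun.
by apply/funext => w; exact: gauss_polyE.
Qed.

Lemma L1_gauss_poly p : L1 P (gauss_poly p).
Proof.
have [C [k h]] := polyfun_bound p.
apply: (L1_gauss_bound W_isonormal (measurable_gauss_poly p)) => w.
by rewrite gauss_polyE; exact: (xi_bound W (fun i : 'I_N => e i) h).
Qed.

Definition gauss_mean p : R := \int[P]_w gauss_poly p w.

Lemma gauss_meanD p q : gauss_mean (p + q) = gauss_mean p + gauss_mean q.
Proof.
rewrite /gauss_mean -RintegralD//; try exact: L1_gauss_poly.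
by apply: eq_Rintegral => w _; rewrite /gauss_poly mevalD.
Qed.

Lemma gauss_meanZ c p : gauss_mean (c *: p) = c * gauss_mean p.
Proof.
rewrite /gauss_mean -RintegralZl//; last exact: L1_gauss_poly.
by apply: eq_Rintegral => w _; rewrite /gauss_poly mevalZ.
Qed.

Lemma gauss_mean1 : gauss_mean 1 = 1.
Proof.
rewrite -[RHS](RI_cst P 1) /gauss_mean.
by apply: eq_Rintegral => w _; rewrite /gauss_poly meval1.
Qed.

(** Integration by parts with [g = 0] and [c = 0]: the cosine is almost surely 1 and the sine term
    has coefficient 0. It provides the last hypothesis made on [mu]. *)
Lemma gauss_meanX i p : gauss_mean (mpolyX R (mnm1 i) * p) = gauss_mean (mderiv i p).
Proof.
have e1 : ip (e i) (e i) = 1 by rewrite e_basis.1 eqxx.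
have [l1 _ l3] := smooth_integration_by_parts ip_inner W_isonormal (fun j : 'I_N => e j) 0 0
  (smooth_polyfun p) e1.
rewrite (ip0l ip_inner) mul0r addr0 => E.
have W0e : W 0 = cst 0 %[ae P] := W0 ip_inner W_isonormal.
transitivity (\int[P]_w (polyfun p (\row_(j < N) W (e j) w) * (W (e i) w * cos (W 0 w + 0)))).
  apply: RI_ae; [exact: measurable_gauss_poly|exact: (L1_measurable l1)|].
  apply: filterS W0e => w W0w wT.
  by rewrite W0w//= addr0 cos0 mulr1 /gauss_poly mevalM mevalXU -/(gauss_poly p w) gauss_polyE mulrC.
rewrite E; apply: RI_ae; [exact: (L1_measurable l3)|exact: measurable_gauss_poly|].
apply: filterS W0e => w W0w wT.
rewrite W0w//= addr0 cos0 mulr1 (bigD1 i)//= big1 => [|j ji]; last first.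
  by rewrite e_basis.1 (negbTE (ji : (j : nat) != i)) mul0r.
by rewrite e1 mul1r addr0 derive_polyfun gauss_polyE.
Qed.

End PolynomialExpectation.

(** * Square integrable variables *)

Section SquareIntegrable.
Context (d : measure_display) (T : measurableType d) (R : realType) (P : probability T R).
Implicit Types (f g : T -> R).

Definition L2 f := measurable_fun setT f /\ L1 P (fun w => f w ^+ 2).

Lemma L2_mul f g : L2 f -> L2 g -> L1 P (fun w => f w * g w).
Proof.
move=> [mf f2] [mg g2]; apply: (L1_le (g := fun w => f w ^+ 2 + g w ^+ 2)).
- exact: measurable_funM.
- move=> w; rewrite normrM -(real_normK (num_real (f w))) -(real_normK (num_real (g w))).
  by have := normr_ge0 (f w); have := normr_ge0 (g w); nra.
- exact: L1D.
Qed.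

Lemma L2Z c f : L2 f -> L2 (fun w => c * f w).
Proof.
move=> [mf f2]; split; first exact: measurable_funM.
by apply: (eq_L1 (f := fun w => c ^+ 2 * f w ^+ 2)) (L1Z _ f2) => w; rewrite exprMn.
Qed.

Lemma L2D f g : L2 f -> L2 g -> L2 (fun w => f w + g w).
Proof.
move=> hf hg; split; first by apply: measurable_funD; [case: hf|case: hg].
apply: (eq_L1 (f := fun w => f w ^+ 2 + g w ^+ 2 + 2 * (f w * g w))).
  by move=> w; ring.
apply: L1D; first by apply: L1D; [case: hf|case: hg].
by apply: L1Z; exact: L2_mul.
Qed.

Lemma L2B f g : L2 f -> L2 g -> L2 (fun w => f w - g w).
Proof.
move=> hf hg; have [m2 l2] := L2D hf (L2Z (-1) hg).
have E : (fun w => f w + -1 * g w) = (fun w => f w - g w).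
  by apply/funext => w; rewrite mulN1r.
by rewrite -E.
Qed.

Lemma L2_bounded_mul f g (M : R) : measurable_fun setT g -> (forall w, `|g w| <= M) -> L2 f ->
  L2 (fun w => f w * g w).
Proof.
move=> mg bg [mf f2]; split; first exact: measurable_funM.
apply: (L1_le (g := fun w => M ^+ 2 * f w ^+ 2)).
- by apply: measurable_funX; exact: measurable_funM.
- move=> w; rewrite ger0_norm ?sqr_ge0// exprMn mulrC ler_wpM2r ?sqr_ge0//.
  rewrite -(real_normK (num_real (g w))); apply: lerXn2r; rewrite ?nnegrE//.
  exact: (le_trans _ (bg w)).
- exact: L1Z.
Qed.

Lemma L2_cst c : L2 (fun=> c).
Proof. by split; [exact: measurable_cst|exact: L1_cst]. Qed.

Lemma L2_L1 f : L2 f -> L1 P f.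
Proof. by move=> hf; apply: eq_L1 (L2_mul hf (L2_cst 1)) => w; rewrite mulr1. Qed.

Lemma L2_finite f : measurable_fun setT f -> (\int[P]_w (f w ^+ 2)%:E < +oo)%E -> L2 f.
Proof.
move=> mf f2; split=> //; apply/integrableP; split.
  by apply/measurable_EFinP; exact: measurable_funX.
by under eq_integral do rewrite /comp /= ger0_norm ?sqr_ge0//.
Qed.

(** Young's inequality [|x y| <= x^2 / (2 t) + t y^2 / 2] plays the part of Cauchy-Schwarz; [t] is
    chosen from the norm of [g] so that the second term stays below [ep / 2]. The integrals are
    extended because early terms of the sequence may be infinite. *)
Lemma L2_cvg_mul (X : nat -> T -> R) g : (forall j, measurable_fun setT (X j)) -> L2 g ->
  (fun j => (\int[P]_w (X j w ^+ 2)%:E)%E) @ \oo --> 0%E ->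
  (fun j => \int[P]_w (X j w * g w)) @ \oo --> (0 : R).
Proof.
move=> mX g2 X0; apply/cvgrPdist_le => ep ep0.
set K := \int[P]_w (g w ^+ 2).
have K0 : 0 <= K by apply: Rintegral_ge0 => w _; exact: sqr_ge0.
set t := ep / (K + 1).
have K1 : 0 < K + 1 by rewrite ltr_wpDl.
have t0 : 0 < t by rewrite divr_gt0.
have tK : t * K <= ep.
  by rewrite /t -mulrA ler_piMr ?(ltW ep0)// mulrC ler_pdivrMr// mul1r lerDl.
have et0 : (0 < (ep * t)%:E)%E by rewrite lte_fin mulr_gt0.
have hn : \forall j \near \oo, (\int[P]_w (X j w ^+ 2)%:E < (ep * t)%:E)%E.
  exact: (X0 _ (open_ereal_lt' et0)).
move: hn; apply: filterS => j hj.
have X2 : L2 (X j) by apply: L2_finite => //; exact: lt_trans hj (ltry _).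
have lX : \int[P]_w (X j w ^+ 2) <= ep * t.
  by rewrite -lee_fin EFin_RI ?(ltW hj)//; case: X2.
rewrite sub0r normrN; apply: (le_trans (RI_norm (L2_mul X2 g2))).
have l1 : L1 P (fun w => (2 * t)^-1 * X j w ^+ 2) by apply: L1Z; case: X2.
have l2 : L1 P (fun w => t / 2 * g w ^+ 2) by apply: L1Z; case: g2.
apply: (@le_trans _ _ (\int[P]_w ((2 * t)^-1 * X j w ^+ 2 + t / 2 * g w ^+ 2))).
  apply: RI_le; [exact/L1_norm/L2_mul|exact: L1D|move=> w].
  rewrite normrM -(real_normK (num_real (X j w))) -(real_normK (num_real (g w))).
  move: `|X j w| `|g w| => x y.
  rewrite -subr_ge0 (_ : _ - _ = (2 * t)^-1 * (x - t * y) ^+ 2).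
    by rewrite mulr_ge0 ?sqr_ge0// invr_ge0 mulr_ge0// ltW.
  by field; rewrite gt_eqF.
rewrite RintegralD// RintegralZl//; last by case: X2.
rewrite RintegralZl//; last by case: g2.
have -> : ep = (2 * t)^-1 * (ep * t) + ep / 2 by field; rewrite gt_eqF.
apply: lerD; first by rewrite ler_pM2l// invr_gt0 mulr_gt0.
by rewrite mulrAC ler_pM2r.
Qed.

Lemma L2_cvg_mean (X : nat -> T -> R) f g : (forall j, measurable_fun setT (X j)) ->
  measurable_fun setT f -> L2 g -> (forall j, L2 (X j)) ->
  (fun j => (\int[P]_w ((X j w - f w) ^+ 2)%:E)%E) @ \oo --> 0%E ->
  L2 f /\ (fun j => \int[P]_w (X j w * g w)) @ \oo --> \int[P]_w (f w * g w).
Proof.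
move=> mX mf g2 X2 Xf.
have mB j : measurable_fun setT (fun w => X j w - f w) by exact: measurable_funB.
have f2 : L2 f.
  have e0 : (0 < 1%:E :> \bar R)%E by rewrite lte_fin.
  have [j _ /(_ j (leqnn j)) hj] : \forall j \near \oo, (\int[P]_w ((X j w - f w) ^+ 2)%:E < 1%:E)%E.
    exact: (Xf _ (open_ereal_lt' e0)).
  have := L2B (X2 j) (L2_finite (mB j) (lt_trans hj (ltry _))).
  by rewrite (_ : (fun w => _) = f)//; apply/funext => w; rewrite opprB addrC subrK.
split=> //; have := L2_cvg_mul mB g2 Xf.
rewrite (_ : (fun j => _) = (fun j => \int[P]_w (X j w * g w) - \int[P]_w (f w * g w))).
  by move=> h; apply/subr_cvg0.
apply/funext => j; rewrite -RintegralB//; try exact: L2_mul.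
by apply: eq_Rintegral => w _; rewrite mulrBl.
Qed.

End SquareIntegrable.

(** * Uniqueness of the Malliavin derivative *)

Section Closability.
Variables (R : realType) (H : completeNormedModType R) (ip : H -> H -> R) (e : nat -> H).
Context (d : measure_display) (T : measurableType d) (P : probability T R).
Variable W : H -> {RV P >-> R}.
Hypothesis ip_inner : inner_product ip.
Hypothesis e_basis : complete_orthonormal_system ip e.
Hypothesis W_isonormal : isonormal ip W.

Lemma measurable_sqr_norm (u : T -> H) : (forall h, measurable_fun setT (fun w => ip (u w) h)) ->
  measurable_fun setT (fun w => `|u w| ^+ 2).
Proof.
move=> mu.
apply: (measurable_fun_cvg (h := fun n w => \sum_(0 <= i < n) ip (u w) (e i) ^+ 2)).
  by move=> n; apply: measurable_sum => i; exact: measurable_funX.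
by move=> w _; exact: (parseval ip_inner e_basis).
Qed.

Lemma smooth_L2 k (hs : 'I_k -> H) (phi : 'rV[R]_k -> R) (C : R) (p : nat) : continuous phi ->
  (forall x, `|phi x| <= C * (1 + `|x|) ^+ p) -> L2 P (fun w => phi (\row_i W (hs i) w)).
Proof.
move=> cphi b; split; first exact: (measurable_xi W hs cphi).
apply: (L1_gauss_bound W_isonormal (C := C ^+ 2) (s := [seq hs i | i <- enum 'I_k]) (p := (p * 2)%N)).
  by apply: measurable_funX; exact: (measurable_xi W hs cphi).
move=> w; rewrite normrX exprM -exprMn; apply: lerXn2r; rewrite ?nnegrE//; last exact: xi_bound.
exact: (le_trans (normr_ge0 _) (xi_bound W hs b w)).
Qed.

(** The left side depends on [F] alone, so the coordinates of any two derivatives of [F] have the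
    same integrals against all cosines. The smooth identity passes to the limit because the test
    variables are square integrable. *)
Lemma malliavin_integration_by_parts (F : {RV P >-> R}) (u : T -> H) i g c :
  is_malliavin_derivative ip W F u ->
  L2 P F /\ L2 P (fun w => ip (u w) (e i)) /\
  \int[P]_w (F w * (W (e i) w * cos (W g w + c) + ip g (e i) * sin (W g w + c))) =
  \int[P]_w (ip (u w) (e i) * cos (W g w + c)).
Proof.
move=> [mu [Fs [us [sm FF uu]]]].
have e1 : ip (e i) (e i) = 1 by rewrite e_basis.1 eqxx.
have ma : measurable_fun setT (fun w => W g w + c).
  by apply: measurable_funD => //; exact: measurable_cst.
have mcos : measurable_fun setT (fun w => cos (W g w + c)).
  by apply: (measurableT_comp _ ma); apply: continuous_measurable_fun; exact: continuous_cos.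
have msin : measurable_fun setT (fun w => sin (W g w + c)).
  by apply: (measurableT_comp _ ma); apply: continuous_measurable_fun; exact: continuous_sin.
have c2 : L2 P (fun w => cos (W g w + c)).
  have := L2_bounded_mul mcos (fun w => cos_max _) (L2_cst P 1).
  by under eq_fun do rewrite mul1r.
have s2 : L2 P (fun w => sin (W g w + c)).
  have := L2_bounded_mul msin (fun w => sin_max _) (L2_cst P 1).
  by under eq_fun do rewrite mul1r.
have wc2 : L2 P (fun w => W (e i) w * cos (W g w + c)).
  apply: L2_bounded_mul => //; first by move=> w; exact: cos_max.
  by split=> //; apply: eq_L1 (L1WW W_isonormal (e i) (e i)) => w; rewrite expr2.
have y2 : L2 P (fun w => W (e i) w * cos (W g w + c) + ip g (e i) * sin (W g w + c)).
  by apply: L2D => //; exact: L2Z.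
have smj j : [/\ L2 P (Fs j), L2 P (fun w => ip (us j w) (e i)),
    \int[P]_w (Fs j w * (W (e i) w * cos (W g w + c) + ip g (e i) * sin (W g w + c))) =
    \int[P]_w (ip (us j w) (e i) * cos (W g w + c)) &
    forall h, measurable_fun setT (fun w => ip (us j w) h)].
  have [k [phi [hs [sphi -> ->]]]] := sm j.
  have [cphi cd [C [p [b bd]]]] := smooth_growth sphi.
  have ipE h : (fun w => ip (\sum_(l < k) 'D_(delta_mx 0 l) phi (\row_j W (hs j) w) *: hs l) h) =
      (fun w => \sum_l ip (hs l) h * 'D_(delta_mx 0 l) phi (\row_j W (hs j) w)).
    apply/funext => w; rewrite (ip_suml ip_inner); apply: eq_bigr => l _.
    by rewrite (ipZl ip_inner) mulrC.
  have l2 l : L2 P (fun w => 'D_(delta_mx 0 l) phi (\row_j W (hs j) w)).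
    exact: (smooth_L2 hs (cd l) (bd l)).
  have L2s h (r : seq 'I_k) : L2 P (fun w => \sum_(l <- r) ip (hs l) h * 'D_(delta_mx 0 l) phi (\row_j W (hs j) w)).
    elim: r => [|l r IH]; first by under eq_fun do rewrite big_nil; exact: L2_cst.
    by under eq_fun do rewrite big_cons; apply: L2D => //; exact: L2Z.
  have f2 : L2 P (fun w => phi (\row_i W (hs i) w)) by exact: (smooth_L2 hs cphi b).
  split=> //; first by rewrite ipE; exact: L2s.
    have [l1 l1' l3 E] := smooth_integration_by_parts ip_inner W_isonormal hs g c sphi e1.
    rewrite [RHS](_ : _ = \int[P]_w ((\sum_l ip (hs l) (e i) * 'D_(delta_mx 0 l) phi (\row_j W (hs j) w)) * cos (W g w + c))).
      rewrite -E -RintegralZl// -RintegralD//; last exact: L1Z.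
      by apply: eq_Rintegral => w _; ring.
    by apply: eq_Rintegral => w _; have /(congr1 (fun f => f w)) -> := ipE (e i).
  by move=> h; rewrite ipE; case: (L2s h (index_enum _)).
have [F2 cF] : L2 P F /\ (fun j => \int[P]_w (Fs j w * (W (e i) w * cos (W g w + c) + ip g (e i) * sin (W g w + c))))
    @ \oo --> \int[P]_w (F w * (W (e i) w * cos (W g w + c) + ip g (e i) * sin (W g w + c))).
  apply: L2_cvg_mean => //; first by move=> j; have [[]] := smj j.
    by move=> j; have [] := smj j.
  by move: FF; under eq_fun do rewrite unlock.
have [u2 cu] : L2 P (fun w => ip (u w) (e i)) /\ (fun j => \int[P]_w (ip (us j w) (e i) * cos (W g w + c)))
    @ \oo --> \int[P]_w (ip (u w) (e i) * cos (W g w + c)).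
  apply: L2_cvg_mean => //; first by move=> j; have [_ []] := smj j.
    by move=> j; have [] := smj j.
  move: uu; under eq_fun do rewrite unlock.
  (* Convergence of the vectors dominates that of each coordinate, by Cauchy-Schwarz with a unit
     vector. *)
  apply: (@squeeze_cvge _ _ _ _ (fun=> 0%E)); last exact: cvg_cst.
  near=> j; apply/andP; split; first by apply: integral_ge0 => w _; rewrite lee_fin sqr_ge0.
  have mB h : measurable_fun setT (fun w => ip (us j w - u w) h).
    have [_ _ _ mj] := smj j.
    by under eq_fun do rewrite (ipBl ip_inner); exact: measurable_funB.
  apply: ge0_le_integral => //.
  - by move=> w _; rewrite lee_fin sqr_ge0.
  - apply/measurable_EFinP; apply: measurable_funX.
    by have := mB (e i); under eq_fun do rewrite (ipBl ip_inner).
  - by apply/measurable_EFinP; exact: measurable_sqr_norm.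
  - move=> w _; rewrite lee_fin -(ipBl ip_inner).
    by have := ip_cauchy_schwarz ip_inner (us j w - u w) (e i); rewrite -(ip_norm ip_inner (e i)) e1 mulr1.
split=> //; split=> //.
have EE : (fun j => \int[P]_w (Fs j w * (W (e i) w * cos (W g w + c) + ip g (e i) * sin (W g w + c)))) =
    (fun j => \int[P]_w (ip (us j w) (e i) * cos (W g w + c))).
  by apply/funext => j; have [_ _ -> _] := smj j.
rewrite EE in cF; exact: (cvg_unique _ cF cu).
Unshelve. all: by end_near. Qed.

Lemma malliavin_unique (F : {RV P >-> R}) (u v : T -> H) : generated_by W ->
  is_malliavin_derivative ip W F u -> is_malliavin_derivative ip W F v ->
  \forall w \ae P, u w = v w.
Proof.
move=> gen Du Dv.
have h i : \forall w \ae P, ip (u w - v w) (e i) = 0.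
  have [_ [u2 _]] := malliavin_integration_by_parts i 0 0 Du.
  have [_ [v2 _]] := malliavin_integration_by_parts i 0 0 Dv.
  have : annihilates W setT (fun w => ip (u w) (e i) - ip (v w) (e i)).
    split; first by apply: L1B; exact: L2_L1.
    move=> g c _.
    have [_ [_ Eu]] := malliavin_integration_by_parts i g c Du.
    have [_ [_ Ev]] := malliavin_integration_by_parts i g c Dv.
    under eq_Rintegral do rewrite mulrBl.
    have c2 : L2 P (fun w => cos (W g w + c)).
      have mcos : measurable_fun setT (fun w => cos (W g w + c)).
        apply: (measurableT_comp (f := cos)); last by apply: measurable_funD => //; exact: measurable_cst.
        by apply: continuous_measurable_fun; exact: continuous_cos.
      have := L2_bounded_mul mcos (fun w => cos_max _) (L2_cst P 1).
      by under eq_fun do rewrite mul1r.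
    rewrite RintegralB//; try exact: L2_mul.
    by rewrite -Eu -Ev subrr.
  move=> /(annihilates_eq0 ip_inner W_isonormal gen).
  by apply: filterS => w hw; rewrite (ipBl ip_inner) hw.
have : \forall w \ae P, forall i, ip (u w - v w) (e i) = 0 by exact/ae_foralln.
apply: filterS => w hw; apply/eqP; rewrite -subr_eq0; apply/eqP.
exact: e_basis.2.
Qed.

End Closability.

(** * Square summable tensors *)

Section Esum.
Variable R : realType.
Local Open Scope ereal_scope.

Lemma esumZl (J : choiceType) (A : set J) (c : R) (a : J -> \bar R) : (0 <= c)%R ->
  (forall i, 0 <= a i) -> \esum_(i in A) (c%:E * a i) = c%:E * \esum_(i in A) a i.
Proof.
move=> c0 a0; have [->|cn0] := eqVneq c 0%R.
  by rewrite mul0e; apply: esum1 => i _; rewrite mul0e.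
have cp : (0 < c)%R by rewrite lt_def cn0.
have le (b : R) (f : J -> \bar R) : (0 <= b)%R -> (forall i, 0 <= f i) ->
    \esum_(i in A) (b%:E * f i) <= b%:E * \esum_(i in A) f i.
  move=> b0 f0; apply: ge_ereal_sup => _ [X XA <-].
  rewrite -ge0_mule_fsumr//; apply: lee_wpmul2l; first by rewrite lee_fin.
  by apply: ereal_sup_ubound; exists X.
apply/eqP; rewrite eq_le le//=.
have ca0 i : 0 <= c%:E * a i by rewrite mule_ge0 ?lee_fin.
have := le c^-1%R _ _ ca0; rewrite invr_ge0 => /(_ c0).
under eq_esum do rewrite muleA -EFinM mulVf// mul1e.
move=> h; apply: (@le_trans _ _ (c%:E * (c^-1%:E * \esum_(i in A) (c%:E * a i)))).
  by apply: lee_wpmul2l => //; rewrite lee_fin.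
by rewrite muleA -EFinM mulfV// mul1e.
Qed.

Lemma esum_swap (J K : choiceType) (a : J -> K -> \bar R) : (forall i j, 0 <= a i j) ->
  \esum_(i in [set: J]) \esum_(j in [set: K]) a i j =
  \esum_(j in [set: K]) \esum_(i in [set: J]) a i j.
Proof.
move=> a0; rewrite !esum_esum//.
rewrite (@reindex_esum _ _ _ ([set: K] `*`` (fun=> [set: J])) _ (fun x => (x.2, x.1)))//.
split=> [x _ //|[x y] [x' y'] _ _ /= [-> ->]//|[x y] _ /=].
by exists (y, x).
Qed.

Lemma esum_nat_finite (a : nat -> \bar R) N : (forall i, 0 <= a i) ->
  (forall i, (N <= i)%N -> a i = 0) -> \esum_(i in [set: nat]) a i = \sum_(i < N) a i.
Proof.
move=> a0 aN; rewrite -nneseries_esumT// (nneseries_split 0 N)//= add0n big_mkord.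
by rewrite eseries0 ?adde0// => i Ni _; rewrite aN.
Qed.

Lemma esum_pair (J K : choiceType) (a : J * K -> \bar R) : (forall x, 0 <= a x) ->
  \esum_(x in [set: J * K]) a x = \esum_(i in [set: J]) \esum_(j in [set: K]) a (i, j).
Proof.
move=> a0; rewrite esum_esum//.
rewrite (_ : [set: J] `*`` _ = setT); first by apply: eq_esum => -[].
by apply/seteqP; split.
Qed.

Lemma esum_lty_le (J : choiceType) (a b : J -> \bar R) : (forall i, a i <= b i) ->
  \esum_(i in [set: J]) b i < +oo -> \esum_(i in [set: J]) a i < +oo.
Proof. by move=> ab; apply: le_lt_trans; apply: le_esum => i _. Qed.

End Esum.

(** * Absolutely summable families *)

Section Usum.
Variables (R : realType) (J : choiceType).
Implicit Types a b : J -> R.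
Local Notation E a := (\esum_(i in [set: J]) (a i)%:E)%E.

Definition abs_summable a := (E (fun i => `|a i|) < +oo)%E.

Lemma fine_esumD a b : (forall i, 0 <= a i) -> (forall i, 0 <= b i) ->
  (E a < +oo)%E -> (E b < +oo)%E ->
  fine (E (fun i => a i + b i)) = fine (E a) + fine (E b).
Proof.
move=> a0 b0 fa fb; rewrite -fineD ?ge0_fin_numE ?esum_ge0//; try by move=> i _; rewrite lee_fin.
by rewrite -esumD// => i _; rewrite lee_fin.
Qed.

Lemma abs_summable_pos a : abs_summable a -> (E (fun i => Num.max (a i) 0) < +oo)%E.
Proof. by apply: esum_lty_le => i; rewrite lee_fin ge_max ler_norm normr_ge0. Qed.

Lemma abs_summable_neg a : abs_summable a -> (E (fun i => Num.max (- a i) 0) < +oo)%E.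
Proof. by apply: esum_lty_le => i; rewrite lee_fin ge_max -normrN ler_norm normr_ge0. Qed.

Let M0 (x : R) : 0 <= Num.max x 0. Proof. by rewrite le_max lexx orbT. Qed.

Lemma usumD a b : abs_summable a -> abs_summable b ->
  usum (fun i => a i + b i) = usum a + usum b.
Proof.
move=> sa sb.
have sab : abs_summable (fun i => a i + b i).
  apply: (@esum_lty_le _ _ _ (fun i => `|a i|%:E + `|b i|%:E)%E).
    by move=> i; rewrite -EFinD lee_fin ler_normD.
  rewrite esumD; [exact: lte_add_pinfty| |] => i _; by rewrite lee_fin.
have pa := abs_summable_pos sa; have na := abs_summable_neg sa.
have pb := abs_summable_pos sb; have nb := abs_summable_neg sb.
have pab := abs_summable_pos sab; have nab := abs_summable_neg sab.
have fD (x y : J -> R) : (forall i, 0 <= x i) -> (forall i, 0 <= y i) -> (E x < +oo)%E -> (E y < +oo)%E ->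
    (E (fun i => x i + y i) < +oo)%E.
  move=> x0 y0 xo yo; under eq_esum do rewrite EFinD.
  by rewrite esumD; [exact: lte_add_pinfty| |] => i _; rewrite lee_fin.
(* Positive and negative parts are not additive, but [(a + b)^+ + a^- + b^- = (a + b)^- + a^+ + b^+]
   involves only sums of nonnegative families. *)
have key : fine (E (fun i => Num.max (a i + b i) 0 + (Num.max (- a i) 0 + Num.max (- b i) 0))) =
    fine (E (fun i => Num.max (- (a i + b i)) 0 + (Num.max (a i) 0 + Num.max (b i) 0))).
  congr fine; apply: eq_esum => i _; congr EFin.
  by case: (lerP (a i + b i) 0); case: (lerP (- (a i + b i)) 0);
    case: (lerP (a i) 0); case: (lerP (- a i) 0); case: (lerP (b i) 0); case: (lerP (- b i) 0); lra.
have P0 (x : J -> R) i : 0 <= Num.max (x i) 0 by exact: M0.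
have PD (x y : J -> R) i : 0 <= Num.max (x i) 0 + Num.max (y i) 0 by rewrite addr_ge0.
rewrite (fine_esumD (P0 (fun i => a i + b i)) (PD (fun i => - a i) (fun i => - b i)) pab) in key; last first.
  exact: (fD _ _ (P0 (fun i => - a i)) (P0 (fun i => - b i))).
rewrite (fine_esumD (P0 (fun i => - (a i + b i))) (PD a b) nab) in key; last first.
  exact: (fD _ _ (P0 a) (P0 b)).
rewrite (fine_esumD (P0 a) (P0 b) pa pb) in key.
rewrite (fine_esumD (P0 (fun i => - a i)) (P0 (fun i => - b i)) na nb) in key; move: key.
by rewrite /usum; lra.
Qed.

Lemma ler_norm_usum a : abs_summable a -> `|usum a| <= fine (E (fun i => `|a i|)).
Proof.
move=> sa; have -> : fine (E (fun i => `|a i|)) =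
    fine (E (fun i => Num.max (a i) 0 + Num.max (- a i) 0)).
  congr fine; apply: eq_esum => i _; congr EFin.
  by case: (lerP (a i) 0); case: (lerP (- a i) 0) => h1 h2; rewrite ?(ler0_norm h2) ?(gtr0_norm h2); lra.
rewrite fine_esumD//; [|exact: abs_summable_pos|exact: abs_summable_neg].
rewrite /usum (le_trans (ler_normB _ _))// !ger0_norm// fine_ge0// esum_ge0// => i _; by rewrite lee_fin.
Qed.

Lemma abs_summable_mul a b : (E (fun i => a i ^+ 2) < +oo)%E -> (E (fun i => b i ^+ 2) < +oo)%E ->
  abs_summable (fun i => a i * b i).
Proof.
move=> fa fb; apply: (@esum_lty_le _ _ _ (fun i => (a i ^+ 2)%:E + (b i ^+ 2)%:E)%E).
  move=> i; rewrite -EFinD lee_fin normrM -(real_normK (num_real (a i))) -(real_normK (num_real (b i))).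
  by have := normr_ge0 (a i); have := normr_ge0 (b i); nra.
by rewrite esumD; [exact: lte_add_pinfty| |] => i _; rewrite lee_fin sqr_ge0.
Qed.

Lemma usum_cauchy_schwarz a b : (E (fun i => a i ^+ 2) < +oo)%E -> (E (fun i => b i ^+ 2) < +oo)%E ->
  usum (fun i => a i * b i) ^+ 2 <= fine (E (fun i => a i ^+ 2)) * fine (E (fun i => b i ^+ 2)).
Proof.
move=> fa fb; have sab := abs_summable_mul fa fb.
have fin (c : J -> R) : (E (fun i => c i ^+ 2) < +oo)%E -> E (fun i => c i ^+ 2) \is a fin_num.
  by move=> fc; rewrite ge0_fin_numE// esum_ge0// => i _; rewrite lee_fin sqr_ge0.
set A := fine _; set B := fine _; set X := fine (E (fun i => `|a i * b i|)).
have A0 : 0 <= A by rewrite fine_ge0// esum_ge0// => i _; rewrite lee_fin sqr_ge0.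
have B0 : 0 <= B by rewrite fine_ge0// esum_ge0// => i _; rewrite lee_fin sqr_ge0.
have X0 : 0 <= X by rewrite fine_ge0// esum_ge0// => i _; rewrite lee_fin.
(* A one-parameter form of Cauchy-Schwarz, obtained termwise from a square; [s] is optimized
   below. *)
have h s : 0 < s -> 2 * X <= s * A + s^-1 * B.
  move=> s0; rewrite -lee_fin EFinD !EFinM /X /A /B !fineK ?fin//; last first.
    by rewrite ge0_fin_numE// esum_ge0// => i _; rewrite lee_fin.
  have sq (c : J -> R) i : (0 <= (c i ^+ 2)%:E :> \bar R)%E by rewrite lee_fin sqr_ge0.
  rewrite -!esumZl ?invr_ge0 ?(ltW s0)//; try exact: sq.
    rewrite -esumD; try (by move=> i _; rewrite mule_ge0 ?lee_fin ?invr_ge0 ?sqr_ge0 ?(ltW s0)).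
    apply: le_esum => i _; rewrite -!EFinM -EFinD lee_fin normrM.
    rewrite -(real_normK (num_real (a i))) -(real_normK (num_real (b i))).
    move: `|a i| `|b i| => x y.
    rewrite -subr_ge0 (_ : _ - _ = s^-1 * (s * x - y) ^+ 2).
      by rewrite mulr_ge0 ?sqr_ge0// invr_ge0 ltW.
    by field; rewrite gt_eqF.
have hX : X ^+ 2 <= A * B.
  have [->|Xn] := eqVneq X 0; first by rewrite expr0n mulr_ge0.
  have Xp : 0 < X by rewrite lt_def Xn.
  have [Az|An] := eqVneq A 0.
    (* When [A = 0] this value of [s] gives [2 X <= X B / (B + 1)], which is absurd for positive
       [X]. *)
    have s0 : 0 < (B + 1) / X by rewrite divr_gt0// ltr_wpDl.
    have := h _ s0; rewrite Az mulr0 add0r invf_div mulrAC ler_pdivlMr ?ltr_wpDl//.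
    by nra.
  have Ap : 0 < A by rewrite lt_def An.
  have s0 : 0 < X / A by rewrite divr_gt0.
  have := h _ s0; rewrite divfK ?gt_eqF// invf_div.
  have -> : A / X * B = A * B / X by rewrite mulrAC.
  rewrite mulr_natl mulr2n lerD2l ler_pdivlMr// -expr2 => ->//.
apply: le_trans hX; rewrite -(real_normK (num_real (usum _))).
by apply: lerXn2r; rewrite ?nnegrE// ler_norm_usum.
Qed.

Lemma usum_finite a (r : seq J) : uniq r -> (forall i, i \notin r -> a i = 0) ->
  usum a = \sum_(i <- r) a i.
Proof.
move=> ur ar.
have h (b : J -> R) : (forall i, 0 <= b i) -> (forall i, i \notin r -> b i = 0) ->
    fine (E b) = \sum_(i <- r) b i.
  move=> b0 br; rewrite (esumID [set` r]); last by move=> i _; rewrite lee_fin.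
  rewrite [X in (_ + X)%E]esum1 ?adde0; last first.
    by move=> i [_ /= /negP ir]; rewrite br.
  rewrite setTI esum_fset//; last by move=> i _; rewrite lee_fin.
  by rewrite -fsbig_seq// sumEFin.
rewrite /usum !h// => [|i ir|i ir]; last 2 first.
- by rewrite ar// oppr0 maxxx.
- by rewrite ar// maxxx.
rewrite -sumrB; apply: eq_bigr => i _.
by case: (lerP (a i) 0); case: (lerP (- a i) 0); lra.
Qed.

End Usum.

(** * Sums over index tuples *)

Section TupleSums.
Variable R : realType.
Implicit Types (F G : seq nat -> \bar R).
Local Open Scope ereal_scope.

(** The summand is a function of sequences, so an index can be cut in two without casting tuple
    types. *)
Definition tsum n F : \bar R := \esum_(t in [set: n.-tuple nat]) F t.

Lemma tsum_ge0 n F : (forall s, 0 <= F s) -> 0 <= tsum n F.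
Proof. by move=> F0; apply: esum_ge0. Qed.

Lemma eq_tsum n F G : (forall s, size s = n -> F s = G s) -> tsum n F = tsum n G.
Proof. by move=> FG; apply: eq_esum => t _; apply: FG; rewrite size_tuple. Qed.

Lemma le_tsum n F G : (forall s, size s = n -> F s <= G s) -> tsum n F <= tsum n G.
Proof. by move=> FG; apply: le_esum => t _; apply: FG; rewrite size_tuple. Qed.

Lemma tsumZl n (c : R) F : (0 <= c)%R -> (forall s, 0 <= F s) ->
  tsum n (fun s => c%:E * F s) = c%:E * tsum n F.
Proof. by move=> c0 F0; rewrite -esumZl. Qed.

Lemma tsum0 F : 0 <= F [::] -> tsum 0 F = F [::].
Proof.
move=> F0; rewrite /tsum (_ : [set: 0.-tuple nat] = [set [tuple]]) ?esum_set1//.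
by apply/seteqP; split=> t _ //=; rewrite tuple0.
Qed.

Lemma tsumS n F : (forall s, 0 <= F s) ->
  tsum n.+1 F = \esum_(i in [set: nat]) tsum n (fun s => F (i :: s)).
Proof.
move=> F0; rewrite [RHS]esum_esum// /tsum.
rewrite (@reindex_esum _ _ _ ([set: nat] `*`` (fun=> [set: n.-tuple nat])) _
  (fun x : nat * n.-tuple nat => [tuple of x.1 :: x.2]))//.
split=> [x _ //|[i t] [j u] _ _ /= /(congr1 val) /= [-> tu]|t _ /=].
  by congr pair; apply/val_inj.
by exists (thead t, [tuple of behead t]) => //=; rewrite -tuple_eta.
Qed.

Lemma tsum_cat p q F : (forall s, 0 <= F s) ->
  tsum (p + q) F = tsum p (fun x => tsum q (fun y => F (x ++ y))).
Proof.
elim: p F => [|p IH] F F0; first by rewrite tsum0 ?tsum_ge0.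
rewrite addSn !tsumS//; last by move=> s; exact: tsum_ge0.
by apply: eq_esum => i _; rewrite IH.
Qed.

Lemma tsum_swap p q (F : seq nat -> seq nat -> \bar R) : (forall x y, 0 <= F x y) ->
  tsum p (fun x => tsum q (F x)) = tsum q (fun y => tsum p (F^~ y)).
Proof. by move=> F0; apply: esum_swap => i j. Qed.

Lemma tsum_finite n N F : (forall s, 0 <= F s) ->
  (forall s, size s = n -> ~~ all (fun j => j < N)%N s -> F s = 0) ->
  tsum n F = \sum_(s <- words N n) F (map val s).
Proof.
elim: n F => [|n IH] F F0 FN; first by rewrite tsum0// big_words0.
rewrite tsumS// (esum_nat_finite (N := N)); last 2 first.
- by move=> i; exact: tsum_ge0.
- move=> i Ni; apply: esum1 => t _; apply: FN; first by rewrite /= size_tuple.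
  by rewrite /= ltnNge Ni.
rewrite big_wordsS; apply: eq_bigr => i _; rewrite IH// => s sn sN; apply: FN; first by rewrite /= sn.
by rewrite /= negb_and sN orbT.
Qed.

End TupleSums.

Section Tensors.
Variable R : realType.
Implicit Types (n m r N : nat).

Lemma val_as_tuple n (s : seq nat) : size s = n -> as_tuple n s = s :> seq nat.
Proof.
move=> sn; apply: (@eq_from_nth _ 0%N); first by rewrite size_tuple sn.
by move=> i; rewrite size_tuple => ilt; rewrite -[i]/(nat_of_ord (Ordinal ilt)) -tnth_nth tnth_mktuple.
Qed.

Lemma as_tuple_id n (t : n.-tuple nat) : as_tuple n t = t.
Proof. by apply/val_inj; exact: val_as_tuple (size_tuple t). Qed.

Lemma permute_index_perm n (s t : n.-tuple nat) : perm_eq s t ->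
  exists u : 'S_n, s = permute_index u t.
Proof.
by move=> /tuple_permP[u E]; exists u; apply/val_inj.
Qed.

(** The squared norm before [fine], which keeps the value [+oo] for arrays that are not square
    summable. *)
Definition tnorm2 n (f : tensor R n) : \bar R := \esum_(t in [set: n.-tuple nat]) ((f t) ^+ 2)%:E.

Lemma tnorm2_ge0 n (f : tensor R n) : (0 <= tnorm2 f)%E.
Proof. by apply: esum_ge0 => t _; rewrite lee_fin sqr_ge0. Qed.

Lemma sqnormE n (f : tensor R n) : square_summable f -> (sqnorm f)%:E = tnorm2 f.
Proof. by move=> ff; rewrite fineK// ge0_fin_numE ?tnorm2_ge0. Qed.

Lemma sqnorm_ge0 n (f : tensor R n) : 0 <= sqnorm f.
Proof. by rewrite fine_ge0// tnorm2_ge0. Qed.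

Lemma tnorm2E n (f : tensor R n) : tnorm2 f = tsum n (fun s => (f (as_tuple n s) ^+ 2)%:E).
Proof. by apply: eq_esum => t _; rewrite as_tuple_id. Qed.

(** A triangle inequality at the level of squares; continuity follows by taking [s] small. *)
Lemma sqrD_le (x y s : R) : 0 < s -> (x + y) ^+ 2 <= (1 + s) * x ^+ 2 + (1 + s^-1) * y ^+ 2.
Proof.
move=> s0; rewrite -subr_ge0 (_ : _ - _ = s^-1 * (s * x - y) ^+ 2).
  by rewrite mulr_ge0 ?sqr_ge0// invr_ge0 ltW.
by field; rewrite gt_eqF.
Qed.

Lemma tnorm2D n (f f' : tensor R n) (s : R) : 0 < s ->
  (tnorm2 (fun t => (f t + f' t)%R) <= (1 + s)%:E * tnorm2 f + (1 + s^-1)%:E * tnorm2 f')%E.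
Proof.
move=> s0; have s1 : 0 <= 1 + s by rewrite addr_ge0// ltW.
have s2 : 0 <= 1 + s^-1 by rewrite addr_ge0// invr_ge0 ltW.
have sq (h : tensor R n) t : (0 <= (h t ^+ 2)%:E)%E by rewrite lee_fin sqr_ge0.
rewrite /tnorm2 -!esumZl// -esumD; try by move=> t _; rewrite mule_ge0.
by apply: le_esum => t _; rewrite -!EFinM -EFinD lee_fin sqrD_le.
Qed.

Lemma tnorm2Z n (f : tensor R n) (c : R) :
  tnorm2 (fun t => c * f t) = ((c ^+ 2)%:E * tnorm2 f)%E.
Proof.
rewrite /tnorm2 -esumZl ?sqr_ge0//; last by move=> t; rewrite lee_fin sqr_ge0.
by apply: eq_esum => t _; rewrite exprMn EFinM.
Qed.

Lemma square_summableD n (f f' : tensor R n) : square_summable f -> square_summable f' ->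
  square_summable (fun t => f t + f' t).
Proof.
move=> ff ff'; apply: (le_lt_trans (tnorm2D f f' ltr01)).
by rewrite lte_add_pinfty// lte_mul_pinfty// ?lee_fin ?addr_ge0// invr1.
Qed.

Lemma square_summableZ n (f : tensor R n) (c : R) : square_summable f ->
  square_summable (fun t => c * f t).
Proof.
by move=> ff; rewrite /square_summable -/(tnorm2 _) tnorm2Z lte_mul_pinfty// lee_fin sqr_ge0.
Qed.

Lemma square_summable_le n (f f' : tensor R n) : (forall t, `|f t| <= `|f' t|) ->
  square_summable f' -> square_summable f.
Proof.
move=> h; apply: esum_lty_le => t; rewrite lee_fin -(real_normK (num_real (f t))).
by rewrite -(real_normK (num_real (f' t))) lerXn2r ?nnegrE.
Qed.

Lemma tnorm2_permute n (f : tensor R n) (s : 'S_n) :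
  tnorm2 (fun t => f (permute_index s t)) = tnorm2 f.
Proof.
rewrite [RHS](@reindex_esum _ _ _ setT _ (permute_index s))//.
split=> [t _ //|t u _ _ E|t _ /=].
  apply/eq_from_tnth => i; have /(congr1 (fun v => tnth v (s^-1 i)%g)) := E.
  by rewrite !tnth_mktuple permKV.
exists (permute_index s^-1%g t) => //; apply/eq_from_tnth => i.
by rewrite !tnth_mktuple permK.
Qed.

(** Nonnegativity of a variance; it makes symmetrization a contraction for [tnorm2]. *)
Lemma sqr_mean_le (J : finType) (a : J -> R) :
  (#|J|%:R^-1 * \sum_j a j) ^+ 2 <= #|J|%:R^-1 * \sum_j a j ^+ 2.
Proof.
have [J0|J0] := eqVneq #|J| 0%N; first by rewrite J0 invr0 !mul0r expr0n.
have c0 : 0 < #|J|%:R :> R by rewrite ltr0n lt0n.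
set c : R := #|J|%:R in c0 *; set m := c^-1 * _.
have : 0 <= \sum_j (a j - m) ^+ 2 by apply: sumr_ge0 => j _; exact: sqr_ge0.
have -> : \sum_j (a j - m) ^+ 2 = \sum_j a j ^+ 2 - c * m ^+ 2.
  under eq_bigr => j _ do rewrite sqrrB.
  rewrite big_split sumrB/= sumr_const -mulr_natl -/c.
  under [X in _ - X]eq_bigr => j _ do rewrite -mulr_natr -mulrA.
  rewrite -mulr_suml (_ : \sum_j a j = c * m); last by rewrite /m mulrA divff ?mul1r// gt_eqF.
  by ring.
by rewrite subr_ge0 => h; rewrite ler_pdivlMl.
Qed.

Lemma tnorm2_symmetrization n (f : tensor R n) : (tnorm2 (symmetrization f) <= tnorm2 f)%E.
Proof.
have n0 : 0 <= n`!%:R^-1 :> R by rewrite invr_ge0.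
apply: (@le_trans _ _ (\esum_(t in [set: n.-tuple nat])
    ((n`!%:R^-1)%:E * \sum_(s : 'S_n) (f (permute_index s t) ^+ 2)%:E))%E).
  apply: le_esum => t _; rewrite sumEFin -EFinM lee_fin.
  by have := sqr_mean_le (fun s : 'S_n => f (permute_index s t)); rewrite card_Sn.
rewrite esumZl//; last by move=> t; apply: sume_ge0 => s _; rewrite lee_fin sqr_ge0.
rewrite esum_sum; last by move=> *; rewrite lee_fin sqr_ge0.
rewrite (eq_bigr (fun=> tnorm2 f)); last by move=> s _; exact: tnorm2_permute.
have [fo|fo] := eqVneq (tnorm2 f) +oo%E; first by rewrite fo leey.
have : tnorm2 f \is a fin_num by rewrite ge0_fin_numE ?tnorm2_ge0// lt_neqAle fo leey.
move=> /fineK <-; rewrite sumEFin sumr_const card_Sn -EFinM lee_fin.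
set c := fine _; have -> : c *+ n`! = n`!%:R * c by rewrite mulr_natl.
by rewrite mulrA mulVf ?mul1r// pnatr_eq0 -lt0n fact_gt0.
Qed.

End Tensors.

(** * Contractions, slices and finitely supported tensors *)

Section Contractions.
Variable R : realType.
Implicit Types (n m r N : nat).

Lemma esum_term_le (J : choiceType) (a : J -> \bar R) i : (forall j, 0 <= a j)%E ->
  (a i <= \esum_(j in [set: J]) a j)%E.
Proof.
move=> a0; rewrite (esumID [set i])// setTI esum_set1// leeDl//.
by apply: esum_ge0.
Qed.

(** Squared norm of the section of [f] in its first [r] indices, the others being fixed. *)
Let fiber n r (f : tensor R n) (x : seq nat) := tsum r (fun i => (f (as_tuple n (i ++ x)) ^+ 2)%:E).

Let fiber_ge0 n r (f : tensor R n) x : (0 <= fiber r f x)%E.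
Proof. by apply: tsum_ge0 => s; rewrite lee_fin sqr_ge0. Qed.

Let tsum_fiber n r (f : tensor R n) : (r <= n)%N -> tsum (n - r) (fiber r f) = tnorm2 f.
Proof.
move=> rn; rewrite tsum_swap; last by move=> *; rewrite lee_fin sqr_ge0.
rewrite -(tsum_cat r (n - r) (F := fun s => (f (as_tuple n s) ^+ 2)%:E)) ?subnKC -?tnorm2E// => s.
by rewrite lee_fin sqr_ge0.
Qed.

Let fiber_lty n r (f : tensor R n) x : (r <= n)%N -> square_summable f -> size x = (n - r)%N ->
  (fiber r f x < +oo)%E.
Proof.
move=> rn ff sx; apply: le_lt_trans ff; rewrite -/(tnorm2 f) -(tsum_fiber f rn).
have E : x = as_tuple (n - r) x by rewrite val_as_tuple.
by rewrite {1}E; exact: (@esum_term_le _ (fun t : (n - r).-tuple nat => fiber r f t)).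
Qed.

Let fiber_fin n r (f : tensor R n) x : (r <= n)%N -> square_summable f -> size x = (n - r)%N ->
  (fine (fiber r f x))%:E = fiber r f x.
Proof. by move=> rn ff sx; rewrite fineK// ge0_fin_numE// fiber_lty. Qed.

(** Cauchy-Schwarz in the contracted indices, for each value of the free ones; the bound is then a
    product, which Tonelli sums. *)
Lemma tnorm2_contraction n m r (f : tensor R n) (g : tensor R m) : (r <= n)%N -> (r <= m)%N ->
  square_summable f -> square_summable g ->
  (tnorm2 (tensor_contraction r f g) <= tnorm2 f * tnorm2 g)%E.
Proof.
move=> rn rm ff gg; rewrite tnorm2E tsum_cat; last by move=> s; rewrite lee_fin sqr_ge0.
apply: (@le_trans _ _ (tsum (n - r) (fun x => tsum (m - r) (fun y => (fine (fiber r f x))%:E * fiber r g y))%E)).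
  apply: le_tsum => x sx; apply: le_tsum => y sy.
  have sxy : size (x ++ y) = (n - r + (m - r))%N by rewrite size_cat sx sy.
  rewrite /tensor_contraction val_as_tuple// take_size_cat// drop_size_cat//.
  rewrite -(fiber_fin rm gg sy) -EFinM lee_fin.
  apply: (@usum_cauchy_schwarz _ _ (fun i : r.-tuple nat => f (as_tuple n (i ++ x)))
    (fun i : r.-tuple nat => g (as_tuple m (i ++ y)))); [exact: (fiber_lty rn ff sx)|exact: (fiber_lty rm gg sy)].
rewrite le_eqVlt; apply/orP; left; apply/eqP.
transitivity (tsum (n - r) (fun x => (sqnorm g)%:E * fiber r f x)%E).
  apply: eq_tsum => x sx; rewrite tsumZl ?fine_ge0// tsum_fiber// (fiber_fin rn ff sx).
  by rewrite sqnormE// muleC.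
by rewrite tsumZl ?sqnorm_ge0// tsum_fiber// sqnormE// muleC.
Qed.

Lemma contraction_summable n m r (f : tensor R n) (g : tensor R m) x y : (r <= n)%N -> (r <= m)%N ->
  square_summable f -> square_summable g -> size x = (n - r)%N -> size y = (m - r)%N ->
  abs_summable (fun i : r.-tuple nat => f (as_tuple n (i ++ x)) * g (as_tuple m (i ++ y))).
Proof.
by move=> rn rm ff gg sx sy; apply: abs_summable_mul; exact: fiber_lty.
Qed.

Lemma contractionDl n m r (f f' : tensor R n) (g : tensor R m) t : (r <= n)%N -> (r <= m)%N ->
  square_summable f -> square_summable f' -> square_summable g ->
  tensor_contraction r (fun t => f t + f' t) g t =
  tensor_contraction r f g t + tensor_contraction r f' g t.
Proof.
move=> rn rm ff ff' gg.
have s1 : size (take (n - r) t) = (n - r)%N by rewrite size_take size_tuple; case: ltnP => //; lia.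
have s2 : size (drop (n - r) t) = (m - r)%N by rewrite size_drop size_tuple addKn.
rewrite /tensor_contraction -usumD; try exact: contraction_summable.
by congr usum; apply/funext => i; rewrite mulrDl.
Qed.

Lemma contractionDr n m r (f : tensor R n) (g g' : tensor R m) t : (r <= n)%N -> (r <= m)%N ->
  square_summable f -> square_summable g -> square_summable g' ->
  tensor_contraction r f (fun t => g t + g' t) t =
  tensor_contraction r f g t + tensor_contraction r f g' t.
Proof.
move=> rn rm ff gg gg'.
have s1 : size (take (n - r) t) = (n - r)%N by rewrite size_take size_tuple; case: ltnP => //; lia.
have s2 : size (drop (n - r) t) = (m - r)%N by rewrite size_drop size_tuple addKn.
rewrite /tensor_contraction -usumD; try exact: contraction_summable.
by congr usum; apply/funext => i; rewrite mulrDr.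
Qed.

Lemma symmetrizationD n (f f' : tensor R n) t :
  symmetrization (fun t => f t + f' t) t = symmetrization f t + symmetrization f' t.
Proof. by rewrite /symmetrization big_split mulrDr. Qed.

Lemma tnorm2_slices p (f : tensor R p.+1) :
  (\esum_(i in [set: nat]) tnorm2 (slice i f) = (p.+1%:R ^+ 2)%:E * tnorm2 f)%E.
Proof.
rewrite [in RHS]tnorm2E tsumS; last by move=> s; rewrite lee_fin sqr_ge0.
rewrite -esumZl ?sqr_ge0//; last by move=> i; apply: tsum_ge0 => s; rewrite lee_fin sqr_ge0.
apply: eq_esum => i _; rewrite -tsumZl ?sqr_ge0//; last by move=> s; rewrite lee_fin sqr_ge0.
by apply: eq_esum => t _; rewrite /slice exprMn EFinM.
Qed.

Lemma slice_square_summable p (f : tensor R p.+1) i : square_summable f -> square_summable (slice i f).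
Proof.
move=> ff; apply: (@le_lt_trans _ _ (\esum_(i in [set: nat]) tnorm2 (slice i f))%E).
  by apply: (@esum_term_le _ (fun i => tnorm2 (slice i f))) => j; exact: tnorm2_ge0.
by rewrite tnorm2_slices lte_mul_pinfty// ?tnorm2_ge0 ?lee_fin ?sqr_ge0.
Qed.

Lemma symmetric_tensorP n (f : tensor R n) : symmetric_tensor f <->
  square_summable f /\ forall s t : seq nat, size s = n -> perm_eq s t -> f (as_tuple n s) = f (as_tuple n t).
Proof.
split=> [[ff fs]|[ff fs]]; split=> //.
  move=> s t sn st; have tn : size t = n by rewrite -(perm_size st).
  have [|u ->] := @permute_index_perm n (as_tuple n s) (as_tuple n t); last exact: fs.
  by rewrite !val_as_tuple.
move=> s t; have := fs (permute_index s t) t; rewrite !as_tuple_id; apply; first by rewrite size_tuple.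
by apply/tuple_permP; exists s; rewrite /permute_index.
Qed.

Lemma slice_symmetric p (f : tensor R p.+1) i : symmetric_tensor f -> symmetric_tensor (slice i f).
Proof.
move=> /symmetric_tensorP[ff fs]; apply/symmetric_tensorP; split; first exact: slice_square_summable.
move=> s t /= sp st; rewrite /slice; congr (_ * _); have tp : size t = p by rewrite -(perm_size st).
have E1 : size (i :: as_tuple p s) = p.+1 := congr1 S (size_tuple _).
have E2 : perm_eq (i :: as_tuple p s) (i :: as_tuple p t).
  by rewrite perm_cons (val_as_tuple sp) (val_as_tuple tp).
exact: fs E1 E2.
Qed.

Lemma symmetric_tensorD n (f g : tensor R n) : symmetric_tensor f -> symmetric_tensor g ->
  symmetric_tensor (fun t => f t + g t).
Proof.
by move=> [ff fs] [gg gs]; split=> [|s t]; [exact: square_summableD|rewrite fs gs].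
Qed.

Lemma symmetric_tensorZ n (f : tensor R n) (c : R) : symmetric_tensor f ->
  symmetric_tensor (fun t => c * f t).
Proof. by move=> [ff fs]; split=> [|s t]; [exact: square_summableZ|rewrite fs]. Qed.

Definition truncate N n (f : tensor R n) : tensor R n :=
  fun t => if all (fun j => j < N)%N t then f t else 0.

Definition supported N n (f : tensor R n) := forall t : n.-tuple nat,
  ~~ all (fun j => j < N)%N t -> f t = 0.

(* Extended by 0 because [as_tuple n] pads or cuts words of length other than n,
   which would break the invariance under permutations. *)
Definition coef N n (f : tensor R n) (s : seq 'I_N) : R :=
  if size s == n then f (as_tuple n (map val s)) else 0.

Lemma truncate_supported N n (f : tensor R n) : supported N (truncate N f).
Proof. by move=> t; rewrite /truncate => /negbTE ->. Qed.

Lemma truncate_symmetric N n (f : tensor R n) : symmetric_tensor f -> symmetric_tensor (truncate N f).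
Proof.
move=> [ff fs]; split.
  apply: square_summable_le ff => t; rewrite /truncate; case: ifP => // _.
  by rewrite normr0.
move=> s t; rewrite /truncate fs; congr (if _ then _ else _).
by apply/perm_all/tuple_permP; exists s.
Qed.

Lemma coef_perm_invariant N n (f : tensor R n) : symmetric_tensor f -> perm_invariant (coef f : seq 'I_N -> R).
Proof.
move=> /symmetric_tensorP[_ fs] s t st; rewrite /coef (perm_size st); case: eqP => // tn.
by apply: fs; [rewrite size_map (perm_size st)|exact: perm_map].
Qed.

Lemma supported_word N n (t : n.-tuple nat) : all (fun j => j < N)%N t ->
  exists2 s : seq 'I_N, size s = n & t = as_tuple n (map val s).
Proof.
move=> tN.
have [s sE] : exists s : seq 'I_N, map val s = t.
  elim: (tval t) tN => [|j u IH] /=; first by exists [::].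
  by move=> /andP[jN /IH[s <-]]; exists (Ordinal jN :: s).
by exists s; [rewrite -(size_map val) sE size_tuple|rewrite sE as_tuple_id].
Qed.

Lemma tnorm2_supported N n (f : tensor R n) : supported N f ->
  tnorm2 f = (\sum_(s <- words N n) coef f s ^+ 2)%:E.
Proof.
move=> fN; rewrite tnorm2E (tsum_finite (N := N)); last 2 first.
- by move=> s; rewrite lee_fin sqr_ge0.
- by move=> s sn sN; rewrite fN ?expr0n// val_as_tuple.
by rewrite sumEFin; congr EFin; apply: eq_words => s sn; rewrite /coef sn eqxx.
Qed.

Lemma usum_words N r (a : seq nat -> R) : (forall t : r.-tuple nat, ~~ all (fun j => j < N)%N t -> a t = 0) ->
  usum (fun i : r.-tuple nat => a i) = \sum_(s <- words N r) a (map val s).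
Proof.
move=> aN; rewrite (usum_finite (r := [seq as_tuple r (map val s) | s : seq 'I_N <- words N r])).
- rewrite big_map; apply: eq_words => s sr; by rewrite val_as_tuple ?size_map.
- rewrite map_inj_in_uniq ?words_uniq// => s t; rewrite !mem_words => /eqP sr /eqP tr.
  move=> /(congr1 val) /=; rewrite -!/(tval _) !val_as_tuple ?size_map// => /inj_map; apply; exact: val_inj.
- move=> t tn; apply: aN; apply: contra tn => /supported_word[s sr ->].
  by apply: map_f; rewrite mem_words sr.
Qed.

(** Bridge to the polynomial part: for finitely supported tensors the infinite sums are the finite
    sums [contr] over words. *)
Lemma contraction_word N n m r (f : tensor R n) (g : tensor R m) (s : seq 'I_N) :
  (r <= n)%N -> (r <= m)%N -> supported N f -> size s = (n - r + (m - r))%N ->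
  tensor_contraction r f g (as_tuple _ (map val s)) =
  contr r (coef f) (coef g) (take (n - r) s) (drop (n - r) s).
Proof.
move=> rn rm fN ss; rewrite /tensor_contraction val_as_tuple ?size_map// -map_take -map_drop.
have s1 : size (take (n - r) s) = (n - r)%N by rewrite size_take ss; case: ltnP => //; lia.
have s2 : size (drop (n - r) s) = (m - r)%N by rewrite size_drop ss addKn.
rewrite (usum_words (N := N) (a := fun i => f (as_tuple n (i ++ _)) * g (as_tuple m (i ++ _)))).
  rewrite /contr; apply: eq_words => u ur.
  by rewrite /coef !size_cat ur s1 s2 !subnKC// !eqxx !map_cat.
move=> t tN; rewrite fN ?mul0r// val_as_tuple; last by rewrite size_cat size_tuple size_map s1 subnKC.
by rewrite all_cat negb_and tN.
Qed.

Lemma contraction_supported N n m r (f : tensor R n) (g : tensor R m) :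
  (r <= n)%N -> (r <= m)%N -> supported N f -> supported N g -> supported N (tensor_contraction r f g).
Proof.
move=> rn rm fN gN t tN; rewrite /tensor_contraction.
have s1 : size (take (n - r) t) = (n - r)%N by rewrite size_take size_tuple; case: ltnP => //; lia.
have s2 : size (drop (n - r) t) = (m - r)%N by rewrite size_drop size_tuple addKn.
rewrite (usum_finite (r := [::])) ?big_nil// => i _.
have e1 : size (i ++ take (n - r) t) = n by rewrite size_cat s1 size_tuple subnKC.
have e2 : size (i ++ drop (n - r) t) = m by rewrite size_cat s2 size_tuple subnKC.
move: tN; rewrite -{1}(cat_take_drop (n - r) t) all_cat negb_and => /orP[h|h].
  by rewrite fN ?mul0r// (val_as_tuple e1) all_cat negb_and h orbT.
by rewrite gN ?mulr0// (val_as_tuple e2) all_cat negb_and h orbT.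
Qed.

Lemma sqnorm_contraction_supported N n m r (f : tensor R n) (g : tensor R m) :
  (r <= n)%N -> (r <= m)%N -> supported N f -> supported N g ->
  sqnorm (tensor_contraction r f g) = contr_sqnorm r n m (coef f : seq 'I_N -> R) (coef g).
Proof.
move=> rn rm fN gN; rewrite /sqnorm -/(tnorm2 _) (tnorm2_supported (N := N)); last exact: contraction_supported.
rewrite /= /contr_sqnorm big_words_cat; apply: eq_words => x sx; apply: eq_words => y sy.
by rewrite /coef size_cat sx sy eqxx contraction_word ?size_cat ?sx ?sy// take_size_cat// drop_size_cat.
Qed.

Lemma symmetrization_supported N n (f : tensor R n) : supported N f -> supported N (symmetrization f).
Proof.
move=> fN t tN; rewrite /symmetrization big1 ?mulr0// => s _; apply: fN; apply: contra tN => h.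
by rewrite -(perm_all (s1 := permute_index s t))//; apply/tuple_permP; exists s.
Qed.

Lemma symmetrization_word N M (f : tensor R M) (A : seq 'I_N -> R) (t : M.-tuple 'I_N) :
  (forall s, size s = M -> f (as_tuple M (map val s)) = A s) ->
  symmetrization f (as_tuple M (map val t)) = symz A t.
Proof.
move=> fA; rewrite /symmetrization /symz; congr (_ * _); apply: eq_bigr => s _.
rewrite -fA ?size_tuple//; congr f; apply/eq_from_tnth => i.
have h (u : M.-tuple 'I_N) j : tnth (as_tuple M (map val u)) j = tnth u j.
  rewrite (tnth_nth 0%N) val_as_tuple ?size_map ?size_tuple//.
  by rewrite (nth_map (tnth u j)) ?size_tuple// -tnth_nth.
by rewrite tnth_mktuple !h tnth_mktuple.
Qed.

Lemma slice_supported N p (f : tensor R p.+1) i : supported N f -> supported N (slice i f).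
Proof.
move=> fN t tN; rewrite /slice fN ?mulr0// val_as_tuple /= ?size_tuple//.
by rewrite negb_and tN orbT.
Qed.

Lemma slice_eq0 N p (f : tensor R p.+1) i t : supported N f -> (N <= i)%N -> slice i f t = 0.
Proof.
by move=> fN Ni; rewrite /slice fN ?mulr0// val_as_tuple /= ?size_tuple// ltnNge Ni.
Qed.

Lemma coef_slice N p (f : tensor R p.+1) (i : 'I_N) s : size s = p ->
  coef (slice i f) s = p.+1%:R * coef f (i :: s).
Proof.
by move=> sp; rewrite /coef /= sp !eqxx /slice val_as_tuple ?size_map.
Qed.

End Contractions.

(** * Continuity under truncation *)

Section Truncation.
Variable R : realType.
Implicit Types (n m r N : nat).

Definition tail N n (f : tensor R n) : tensor R n := fun t => f t - truncate N f t.

Lemma truncateK N n (f : tensor R n) : f = (fun t => truncate N f t + tail N f t).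
Proof. by apply/funext => t; rewrite /tail addrC subrK. Qed.

Lemma truncate_tail N n (f : tensor R n) : truncate N f = (fun t => f t + (-1) * tail N f t).
Proof. by apply/funext => t; rewrite /tail mulN1r opprB addrC subrK. Qed.

Lemma tail_symmetric N n (f : tensor R n) : symmetric_tensor f -> symmetric_tensor (tail N f).
Proof.
move=> fs; have := symmetric_tensorD fs (symmetric_tensorZ (-1) (truncate_symmetric N fs)).
by under eq_fun do rewrite mulN1r.
Qed.

Lemma tnorm2_truncate N n (f : tensor R n) :
  tnorm2 f = (tnorm2 (truncate N f) + tnorm2 (tail N f))%E.
Proof.
rewrite /tnorm2 -esumD; try by move=> t _; rewrite lee_fin sqr_ge0.
apply: eq_esum => t _; rewrite -EFinD /tail /truncate.
by case: ifP => _; rewrite ?subrr ?subr0 expr0n /= ?addr0 ?add0r.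
Qed.

Lemma sqnorm_truncate N n (f : tensor R n) : symmetric_tensor f ->
  sqnorm f = sqnorm (truncate N f) + sqnorm (tail N f).
Proof.
move=> fs; have [f1 _] := truncate_symmetric N fs; have [f2 _] := tail_symmetric N fs.
by apply: EFin_inj; rewrite EFinD !sqnormE -?tnorm2_truncate//; case: fs.
Qed.

Lemma cvg_sqnorm_tail n (f : tensor R n) : symmetric_tensor f ->
  (fun N => sqnorm (tail N f)) @ \oo --> (0 : R).
Proof.
move=> fs; have ff := fs.1; apply/cvgrPdist_lt => ep ep0.
have fin : tnorm2 f \is a fin_num by rewrite ge0_fin_numE ?tnorm2_ge0.
have [_ [X [fX _] <-]] := ub_ereal_sup_adherent ep0 fin.
rewrite -/(esum _ _) -/(tnorm2 f) => hX.
have [s Xs] := (finite_seqP X).1 fX.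
(* A crude bound above every index that occurs in the finite set [X], which almost exhausts the
   norm. *)
exists (\sum_(t <- s) \sum_(j <- (t : n.-tuple nat)) j.+1)%N => // N /= hN.
rewrite sub0r normrN ger0_norm ?sqnorm_ge0//.
have XN t : X t -> all (fun j => (j < N)%N) t.
  rewrite Xs /= => ts; apply/allP => j jt; apply: leq_trans hN.
  by rewrite (big_rem t)//= (big_rem j)//= -addnA leq_addr.
have le : (\sum_(t \in X) (f t ^+ 2)%:E <= tnorm2 (truncate N f))%E.
  have -> : (\sum_(t \in X) (f t ^+ 2)%:E = \sum_(t \in X) (truncate N f t ^+ 2)%:E)%E.
    by apply: eq_fsbigr => t /set_mem Xt; rewrite /truncate XN.
  by apply: ereal_sup_ubound; exists X.
have := lt_le_trans hX le; rewrite -(sqnormE ff) -sqnormE; last by case: (truncate_symmetric N fs).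
by rewrite -EFinB lte_fin (sqnorm_truncate N fs) ltrBlDr ltrD2l.
Qed.

Section Limit.
Variables (n m : nat) (Q : tensor R n -> tensor R m -> \bar R) (C : R).
Hypothesis C0 : 0 <= C.
Hypothesis Q0 : forall f g, (0 <= Q f g)%E.
Hypothesis QB : forall f g, symmetric_tensor f -> symmetric_tensor g ->
  (Q f g <= (C * (sqnorm f * sqnorm g))%:E)%E.
(* This is the triangle inequality for the square root of Q. *)
Hypothesis Ql : forall (f f' : tensor R n) (g : tensor R m) (s : R), 0 < s ->
  symmetric_tensor f -> symmetric_tensor f' -> symmetric_tensor g ->
  (Q (fun t => (f t + f' t)%R) g <= (1 + s)%:E * Q f g + (1 + s^-1)%:E * Q f' g)%E.
Hypothesis Qr : forall (f : tensor R n) (g g' : tensor R m) (s : R), 0 < s ->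
  symmetric_tensor f -> symmetric_tensor g -> symmetric_tensor g' ->
  (Q f (fun t => (g t + g' t)%R) <= (1 + s)%:E * Q f g + (1 + s^-1)%:E * Q f g')%E.

Lemma bounded_form_fine f g : symmetric_tensor f -> symmetric_tensor g -> (fine (Q f g))%:E = Q f g.
Proof.
by move=> fs gs; rewrite fineK// ge0_fin_numE//; apply: (le_lt_trans (QB fs gs)); exact: ltry.
Qed.

Let q f g := fine (Q f g).

Let q0 f g : 0 <= q f g. Proof. exact: fine_ge0. Qed.

Let qB f g : symmetric_tensor f -> symmetric_tensor g -> q f g <= C * (sqnorm f * sqnorm g).
Proof. by move=> fs gs; rewrite -lee_fin bounded_form_fine// QB. Qed.

(** Moving first in the left argument, then in the right one, costs [(1 + s) ^+ 2] on the main term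
    and puts the perturbation into terms controlled by [QB]. *)
Let step (u a : tensor R n) (v b : tensor R m) (s : R) : 0 < s ->
  symmetric_tensor u -> symmetric_tensor a -> symmetric_tensor v -> symmetric_tensor b ->
  symmetric_tensor (fun t => v t + b t) ->
  q (fun t => u t + a t) (fun t => v t + b t) <=
    (1 + s) ^+ 2 * q u v + (1 + s) * ((1 + s^-1) * (C * (sqnorm u * sqnorm b))) +
    (1 + s^-1) * (C * (sqnorm a * sqnorm (fun t => v t + b t))).
Proof.
move=> s0 us ha vs bs vbs.
have s1 : 0 <= 1 + s by rewrite addr_ge0// ltW.
have s2 : 0 <= 1 + s^-1 by rewrite addr_ge0// invr_ge0 ltW.
have h1 : q (fun t => u t + a t) (fun t => v t + b t) <= (1 + s) * q u (fun t => v t + b t) +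
    (1 + s^-1) * q a (fun t => v t + b t).
  rewrite -lee_fin EFinD !EFinM !bounded_form_fine//; [exact: Ql|exact: symmetric_tensorD].
have h2 : q u (fun t => v t + b t) <= (1 + s) * q u v + (1 + s^-1) * q u b.
  by rewrite -lee_fin EFinD !EFinM !bounded_form_fine//; exact: Qr.
apply: (le_trans h1); apply: lerD; last by apply: ler_wpM2l => //; exact: qB.
rewrite expr2 -mulrA -mulrDr; apply: ler_wpM2l => //; apply: (le_trans h2).
by rewrite lerD2l; apply: ler_wpM2l => //; exact: qB.
Qed.

(** By [step], each of the full and the truncated value is at most [(1 + s) ^+ 2] times the other
    plus tails. Both are at most [C * (A * B)], so the multiplicative loss is an additive one of
    order [s]; [s] is fixed first, then [N] is taken large. *)
Lemma cvg_bounded_form f g : symmetric_tensor f -> symmetric_tensor g ->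
  (fun N => fine (Q (truncate N f) (truncate N g))) @ \oo --> fine (Q f g).
Proof.
move=> fs gs; set A := sqnorm f; set B := sqnorm g.
have A0 : 0 <= A by exact: sqnorm_ge0.
have B0 : 0 <= B by exact: sqnorm_ge0.
have M0 : 0 <= C * (A * B) by rewrite !mulr_ge0.
have bound N s : 0 < s -> `|q f g - q (truncate N f) (truncate N g)| <=
    (2 * s + s ^+ 2) * (C * (A * B)) +
    (1 + s) * (1 + s^-1) * C * (A * sqnorm (tail N g) + sqnorm (tail N f) * B).
  move=> s0; set fN := truncate N f; set gN := truncate N g; set f' := tail N f; set g' := tail N g.
  have fNs : symmetric_tensor fN by exact: truncate_symmetric.
  have gNs : symmetric_tensor gN by exact: truncate_symmetric.
  have f's : symmetric_tensor f' by exact: tail_symmetric.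
  have g's : symmetric_tensor g' by exact: tail_symmetric.
  have fA : sqnorm fN <= A by rewrite /A (sqnorm_truncate N fs) lerDl sqnorm_ge0.
  have gB : sqnorm gN <= B by rewrite /B (sqnorm_truncate N gs) lerDl sqnorm_ge0.
  have f'0 := sqnorm_ge0 f'; have g'0 := sqnorm_ge0 g'; have fN0 := sqnorm_ge0 fN; have gN0 := sqnorm_ge0 gN.
  have sN k (h : tensor R k) : sqnorm (fun t => -1 * h t) = sqnorm h.
    by rewrite /sqnorm; congr fine; apply: eq_esum => t _; rewrite mulN1r sqrrN.
  have s1 : 0 <= 1 + s by rewrite addr_ge0// ltW.
  have s2 : 1 <= 1 + s by rewrite lerDl ltW.
  have s3 : 0 <= 1 + s^-1 by rewrite addr_ge0// invr_ge0 ltW.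
  have qfg := qB fs gs; have qfgN := qB fNs gNs.
  have L1' : q f g <= (1 + s) ^+ 2 * q fN gN + (1 + s) * (1 + s^-1) * C * (A * sqnorm g' + sqnorm f' * B).
    have := step s0 fNs f's gNs g's; rewrite -!truncateK => /(_ gs) h; apply: (le_trans h).
    rewrite -addrA lerD2l mulrDr; apply: lerD.
      by rewrite -!mulrA; do 3!apply: ler_wpM2l => //; exact: ler_wpM2r.
    rewrite -!mulrA -[leLHS]mul1r; apply: ler_pM => //.
    by rewrite !mulr_ge0// sqnorm_ge0.
  have L2' : q fN gN <= (1 + s) ^+ 2 * q f g + (1 + s) * (1 + s^-1) * C * (A * sqnorm g' + sqnorm f' * B).
    (* Conversely the truncation is the full tensor plus [-1] times the tail, so the same estimate
       applies with the roles exchanged. *)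
    have := step s0 fs (symmetric_tensorZ (-1) f's) gs (symmetric_tensorZ (-1) g's).
    rewrite -!truncate_tail => /(_ gNs) h; apply: (le_trans h).
    rewrite -addrA lerD2l mulrDr !sN; apply: lerD; first by rewrite -!mulrA.
    rewrite -!mulrA -[leLHS]mul1r; apply: ler_pM => //; first by rewrite !mulr_ge0.
    by do 3!apply: ler_wpM2l => //.
  have M1 : q f g <= C * (A * B) by exact: qB.
  have M2 : q fN gN <= C * (A * B).
    by apply: (le_trans qfgN); apply: ler_wpM2l => //; exact: ler_pM.
  have e2 (x : R) : x <= C * (A * B) -> 0 <= x -> (1 + s) ^+ 2 * x <= x + (2 * s + s ^+ 2) * (C * (A * B)).
    move=> xM x0; have -> : (1 + s) ^+ 2 * x = x + (2 * s + s ^+ 2) * x by ring.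
    by rewrite lerD2l ler_wpM2l// addr_ge0 ?mulr_ge0 ?sqr_ge0// ltW.
  rewrite ler_norml; apply/andP; split.
    have := e2 _ M1 (q0 f g); move: L2'; lra.
  have := e2 _ M2 (q0 fN gN); move: L1'; lra.
apply/cvgrPdist_le => ep ep0; rewrite -/(q f g).
set M := C * (A * B) in M0 bound *.
(* Chosen so that [s <= 1], hence [2 s + s^2 <= 3 s], and [6 s (M + 1) <= ep]. *)
set s := ep / (6 * (M + 1) + ep).
have D0 : 0 < 6 * (M + 1) + ep by rewrite addr_gt0// mulr_gt0// ltr_wpDl.
have s0 : 0 < s by rewrite divr_gt0.
have s1 : s <= 1 by rewrite ler_pdivrMr// mul1r lerDr mulr_ge0// addr_ge0.
have sM : (2 * s + s ^+ 2) * M <= ep / 2.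
  apply: (@le_trans _ _ (3 * s * M)); first by apply: ler_wpM2r => //; nra.
  have : s * (6 * (M + 1) + ep) = ep by rewrite divfK// gt_eqF.
  by move: s0 s1 M0 ep0; nra.
have K0 : (fun N => (1 + s) * (1 + s^-1) * C * (A * sqnorm (tail N g) + sqnorm (tail N f) * B)) @ \oo --> (0 : R).
  suff : (fun N => (1 + s) * (1 + s^-1) * C * (A * sqnorm (tail N g) + sqnorm (tail N f) * B)) @ \oo -->
      (1 + s) * (1 + s^-1) * C * (A * 0 + 0 * B) by rewrite !(mulr0, mul0r, addr0).
  apply: cvgM; first exact: cvg_cst.
  by apply: cvgD; apply: cvgM; try exact: cvg_cst; exact: cvg_sqnorm_tail.
have ep2 : 0 < ep / 2 by rewrite divr_gt0.
move/cvgrPdist_le : K0 => /(_ _ ep2); apply: filterS => N.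
rewrite sub0r normrN => hN; apply: (le_trans (bound N s s0)).
rewrite [leRHS](splitr ep); apply: lerD => //; exact: (le_trans (ler_norm _) hN).
Qed.

End Limit.

End Truncation.

(** * Double sums over slices *)

Section Forms.
Variable R : realType.
Implicit Types (p q k : nat).

Section DoubleSum.
Variables (p q : nat) (D : tensor R p -> tensor R q -> tensor R p -> tensor R q -> \bar R) (C : R).
Hypothesis C0 : 0 <= C.
Hypothesis D0 : forall a b a' b', (0 <= D a b a' b')%E.
Hypothesis DB : forall a b a' b', symmetric_tensor a -> symmetric_tensor b ->
  symmetric_tensor a' -> symmetric_tensor b' ->
  (D a b a' b' <= C%:E * (tnorm2 a * tnorm2 b + tnorm2 a' * tnorm2 b'))%E.
Hypothesis Dl : forall (a c : tensor R p) (b : tensor R q) (a' c' : tensor R p) (b' : tensor R q) (s : R), 0 < s ->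
  symmetric_tensor a -> symmetric_tensor b -> symmetric_tensor a' -> symmetric_tensor b' ->
  symmetric_tensor c -> symmetric_tensor c' ->
  (D (fun t => (a t + c t)%R) b (fun t => (a' t + c' t)%R) b' <=
     (1 + s)%:E * D a b a' b' + (1 + s^-1)%:E * D c b c' b')%E.
Hypothesis Dr : forall (a : tensor R p) (b c : tensor R q) (a' : tensor R p) (b' c' : tensor R q) (s : R), 0 < s ->
  symmetric_tensor a -> symmetric_tensor b -> symmetric_tensor a' -> symmetric_tensor b' ->
  symmetric_tensor c -> symmetric_tensor c' ->
  (D a (fun t => (b t + c t)%R) a' (fun t => (b' t + c' t)%R) <=
     (1 + s)%:E * D a b a' b' + (1 + s^-1)%:E * D a c a' c')%E.

(** [D a b a' b'] models the squared norm of a product of [a] and [b] minus the product of [a'] and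
    [b']. The expected determinant and each [T_] have this form, so one limit argument serves for
    both. *)
Definition double_sum (f : tensor R p.+1) (g : tensor R q.+1) : \bar R :=
  (\esum_(i in [set: nat]) \esum_(l in [set: nat])
     D (slice i f) (slice l g) (slice l f) (slice i g))%E.

Let Q0 f g : (0 <= double_sum f g)%E.
Proof. by apply: esum_ge0 => i _; apply: esum_ge0. Qed.

(** The slices contribute the two squared orders, and the two products in the bound [DB] contribute
    the factor 2. *)
Let M := C * (2 * (p.+1%:R ^+ 2 * q.+1%:R ^+ 2)).

Let M0 : 0 <= M. Proof. by rewrite !mulr_ge0. Qed.

Let sliceD n i (f f' : tensor R n) : slice i (fun t => f t + f' t) = (fun t => slice i f t + slice i f' t).
Proof. by apply/funext => t; rewrite /slice mulrDr. Qed.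

Let product_sum (f : tensor R p.+1) (g : tensor R q.+1) : symmetric_tensor f -> symmetric_tensor g ->
  (\esum_(i in [set: nat]) \esum_(l in [set: nat]) (tnorm2 (slice i f) * tnorm2 (slice l g)) =
   (p.+1%:R ^+ 2 * sqnorm f * (q.+1%:R ^+ 2 * sqnorm g))%R%:E)%E.
Proof.
move=> fs gs; have Ef i := sqnormE (slice_symmetric i fs).1.
have Eg : ((q.+1%:R ^+ 2 * sqnorm g)%:E = \esum_(l in [set: nat]) tnorm2 (slice l g))%E.
  by rewrite tnorm2_slices EFinM sqnormE//; case: gs.
transitivity (\esum_(i in [set: nat]) ((q.+1%:R ^+ 2 * sqnorm g)%:E * tnorm2 (slice i f)))%E.
  apply: eq_esum => i _; rewrite Eg -Ef muleC -esumZl ?sqnorm_ge0//; last by move=> l; exact: tnorm2_ge0.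
rewrite esumZl ?mulr_ge0 ?sqnorm_ge0//; last by move=> l; exact: tnorm2_ge0.
by rewrite tnorm2_slices -sqnormE; [rewrite -!EFinM mulrC|case: fs].
Qed.

Lemma double_sum_bound f g : symmetric_tensor f -> symmetric_tensor g ->
  (double_sum f g <= (M * (sqnorm f * sqnorm g))%:E)%E.
Proof.
move=> fs gs; have tq (u : tensor R p.+1) (v : tensor R q.+1) i l : (0 <= tnorm2 (slice i u) * tnorm2 (slice l v))%E.
  by rewrite mule_ge0 ?tnorm2_ge0.
apply: (@le_trans _ _ (\esum_(i in [set: nat]) \esum_(l in [set: nat])
   (C%:E * (tnorm2 (slice i f) * tnorm2 (slice l g) + tnorm2 (slice l f) * tnorm2 (slice i g))))%E).
  by apply: le_esum => i _; apply: le_esum => l _; apply: DB; exact: slice_symmetric.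
under eq_esum => i _ do rewrite (esumZl _ C0 (fun l => adde_ge0 (tq f g i l) (tq f g l i))) esumD//.
rewrite esumZl//; last by move=> i; rewrite adde_ge0// esum_ge0.
rewrite esumD; try by move=> i _; rewrite esum_ge0.
rewrite product_sum// [X in (_ * (_ + X))%E]esum_swap// product_sum// -EFinD -EFinM lee_fin.
by rewrite le_eqVlt; apply/orP; left; apply/eqP; rewrite /M; ring.
Qed.

Let Ql (f f' : tensor R p.+1) (g : tensor R q.+1) (s : R) : 0 < s ->
  symmetric_tensor f -> symmetric_tensor f' -> symmetric_tensor g ->
  (double_sum (fun t => (f t + f' t)%R) g <= (1 + s)%:E * double_sum f g + (1 + s^-1)%:E * double_sum f' g)%E.
Proof.
move=> s0 fs f's gs; have s1 : 0 <= 1 + s by rewrite addr_ge0// ltW.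
have s2 : 0 <= 1 + s^-1 by rewrite addr_ge0// invr_ge0 ltW.
rewrite /double_sum -!esumZl//; try by move=> i; exact: esum_ge0.
rewrite -esumD; try by move=> i _; rewrite mule_ge0 ?esum_ge0.
apply: le_esum => i _; rewrite -!esumZl// -esumD; try by move=> l _; rewrite mule_ge0.
by apply: le_esum => l _; rewrite !sliceD; apply: Dl => //; exact: slice_symmetric.
Qed.

Let Qr (f : tensor R p.+1) (g g' : tensor R q.+1) (s : R) : 0 < s ->
  symmetric_tensor f -> symmetric_tensor g -> symmetric_tensor g' ->
  (double_sum f (fun t => (g t + g' t)%R) <= (1 + s)%:E * double_sum f g + (1 + s^-1)%:E * double_sum f g')%E.
Proof.
move=> s0 fs gs g's; have s1 : 0 <= 1 + s by rewrite addr_ge0// ltW.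
have s2 : 0 <= 1 + s^-1 by rewrite addr_ge0// invr_ge0 ltW.
rewrite /double_sum -!esumZl//; try by move=> i; exact: esum_ge0.
rewrite -esumD; try by move=> i _; rewrite mule_ge0 ?esum_ge0.
apply: le_esum => i _; rewrite -!esumZl// -esumD; try by move=> l _; rewrite mule_ge0.
by apply: le_esum => l _; rewrite !sliceD; apply: Dr => //; exact: slice_symmetric.
Qed.

Lemma double_sum_fine f g : symmetric_tensor f -> symmetric_tensor g ->
  (fine (double_sum f g))%:E = double_sum f g.
Proof. exact: (bounded_form_fine Q0 double_sum_bound). Qed.

Lemma cvg_double_sum f g : symmetric_tensor f -> symmetric_tensor g ->
  (fun N => fine (double_sum (truncate N f) (truncate N g))) @ \oo --> fine (double_sum f g).
Proof. exact: (cvg_bounded_form M0 Q0 double_sum_bound Ql Qr). Qed.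

End DoubleSum.

Lemma double_sum_ge0 p q D f g : (forall a b a' b', (0 <= D a b a' b')%E) -> (0 <= @double_sum p q D f g)%E.
Proof. by move=> D0; apply: esum_ge0 => i _; apply: esum_ge0. Qed.

Lemma cvg_sqnorm_contraction n m r (f : tensor R n) (g : tensor R m) : (r <= n)%N -> (r <= m)%N ->
  symmetric_tensor f -> symmetric_tensor g ->
  (fun N => sqnorm (tensor_contraction r (truncate N f) (truncate N g))) @ \oo -->
  sqnorm (tensor_contraction r f g).
Proof.
move=> rn rm; apply: (@cvg_bounded_form _ _ _ (fun f g => tnorm2 (tensor_contraction r f g)) 1) => //.
- by move=> *; exact: tnorm2_ge0.
- move=> {}f {}g [ff _] [gg _]; rewrite mul1r EFinM !sqnormE//; exact: tnorm2_contraction.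
- move=> {}f f' {}g s s0 [ff _] [ff' _] [gg _].
  rewrite (_ : tensor_contraction r _ g = (fun t => tensor_contraction r f g t + tensor_contraction r f' g t)).
    exact: tnorm2D.
  by apply/funext => t; exact: contractionDl.
- move=> {}f {}g g' s s0 [ff _] [gg _] [gg' _].
  rewrite (_ : tensor_contraction r f _ = (fun t => tensor_contraction r f g t + tensor_contraction r f g' t)).
    exact: tnorm2D.
  by apply/funext => t; exact: contractionDr.
Qed.

Section CommutatorForm.
Variables p q k : nat.
Hypothesis kp : (k <= p)%N.
Hypothesis kq : (k <= q)%N.
Implicit Types (a : tensor R p) (b : tensor R q).

Definition commutator a b a' b' : tensor R (p - k + (q - k)) :=
  fun t => symmetrization (tensor_contraction k a b) t - symmetrization (tensor_contraction k a' b') t.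

Let commutatorE a b a' b' : commutator a b a' b' =
  (fun t => symmetrization (tensor_contraction k a b) t + -1 * symmetrization (tensor_contraction k a' b') t).
Proof. by apply/funext => t; rewrite /commutator mulN1r. Qed.

Lemma tnorm2_commutator a b a' b' : square_summable a -> square_summable b ->
  square_summable a' -> square_summable b' ->
  (tnorm2 (commutator a b a' b') <= 2%:E * (tnorm2 a * tnorm2 b + tnorm2 a' * tnorm2 b'))%E.
Proof.
move=> aa bb aa' bb'; rewrite commutatorE; apply: (le_trans (tnorm2D _ _ ltr01)).
rewrite invr1 (tnorm2Z _ (-1)) sqrrN expr1n mul1e -(_ : 1 + 1 = 2 :> R)// muleDr//; last first.
  by rewrite ge0_adde_def// inE mule_ge0 ?tnorm2_ge0.
have h (u : tensor R p) (v : tensor R q) : square_summable u -> square_summable v ->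
    (tnorm2 (symmetrization (tensor_contraction k u v)) <= tnorm2 u * tnorm2 v)%E.
  by move=> aa1 bb1; apply: (le_trans (tnorm2_symmetrization _)); exact: tnorm2_contraction.
by apply: leeD; apply: lee_wpmul2l; rewrite ?lee_fin ?addr_ge0//; exact: h.
Qed.

(** The commutator is additive in the pair [(a, a')] and in the pair [(b, b')], so both splitting
    inequalities reduce to [tnorm2D]. *)
Let commutator_form_axioms (c : R) : 0 <= c ->
  let D a b a' b' := (c%:E * tnorm2 (commutator a b a' b'))%E in
  [/\ forall a b a' b', (0 <= D a b a' b')%E,
   forall a b a' b', symmetric_tensor a -> symmetric_tensor b ->
     symmetric_tensor a' -> symmetric_tensor b' ->
     (D a b a' b' <= (c * 2)%:E * (tnorm2 a * tnorm2 b + tnorm2 a' * tnorm2 b'))%E,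
   forall a c b a' c' b' (s : R), 0 < s ->
     symmetric_tensor a -> symmetric_tensor b -> symmetric_tensor a' -> symmetric_tensor b' ->
     symmetric_tensor c -> symmetric_tensor c' ->
     (D (fun t => (a t + c t)%R) b (fun t => (a' t + c' t)%R) b' <=
        (1 + s)%:E * D a b a' b' + (1 + s^-1)%:E * D c b c' b')%E
   & forall a b c a' b' c' (s : R), 0 < s ->
     symmetric_tensor a -> symmetric_tensor b -> symmetric_tensor a' -> symmetric_tensor b' ->
     symmetric_tensor c -> symmetric_tensor c' ->
     (D a (fun t => (b t + c t)%R) a' (fun t => (b' t + c' t)%R) <=
        (1 + s)%:E * D a b a' b' + (1 + s^-1)%:E * D a c a' c')%E].
Proof.
move=> c0 D.
have split2 (u v : tensor R (p - k + (q - k))) (s : R) : 0 < s ->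
  (c%:E * tnorm2 (fun t => (u t + v t)%R) <=
   (1 + s)%:E * (c%:E * tnorm2 u) + (1 + s^-1)%:E * (c%:E * tnorm2 v))%E.
  move=> s0; have s1 : 0 <= 1 + s by rewrite addr_ge0// ltW.
  have s2 : 0 <= 1 + s^-1 by rewrite addr_ge0// invr_ge0 ltW.
  apply: (@le_trans _ _ (c%:E * ((1 + s)%:E * tnorm2 u + (1 + s^-1)%:E * tnorm2 v))%E).
    by apply: lee_wpmul2l; rewrite ?lee_fin//; exact: tnorm2D.
  rewrite muleDr//; last by rewrite ge0_adde_def// inE mule_ge0 ?tnorm2_ge0.
  by rewrite muleCA [X in (_ + X)%E]muleCA.
split.
- by move=> *; rewrite mule_ge0 ?tnorm2_ge0.
- move=> a b a' b' [aa _] [bb _] [aa' _] [bb' _]; rewrite EFinM -muleA.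
  by apply: lee_wpmul2l; rewrite ?lee_fin//; exact: tnorm2_commutator.
- move=> a u b a' u' b' s s0 [aa _] [bb _] [aa' _] [bb' _] [uu _] [uu' _].
  rewrite /D (_ : commutator _ b _ b' = (fun t => commutator a b a' b' t + commutator u b u' b' t)).
    exact: split2.
  apply/funext => t; rewrite /commutator.
  rewrite (_ : tensor_contraction k _ b = (fun t => tensor_contraction k a b t + tensor_contraction k u b t)).
    rewrite (_ : tensor_contraction k _ b' = (fun t => tensor_contraction k a' b' t + tensor_contraction k u' b' t)).
      by rewrite !symmetrizationD; ring.
    by apply/funext => ?; exact: contractionDl.
  by apply/funext => ?; exact: contractionDl.
- move=> a b u a' b' u' s s0 [aa _] [bb _] [aa' _] [bb' _] [uu _] [uu' _].
  rewrite /D (_ : commutator a _ a' _ = (fun t => commutator a b a' b' t + commutator a u a' u' t)).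
    exact: split2.
  apply/funext => t; rewrite /commutator.
  rewrite (_ : tensor_contraction k a _ = (fun t => tensor_contraction k a b t + tensor_contraction k a u t)).
    rewrite (_ : tensor_contraction k a' _ = (fun t => tensor_contraction k a' b' t + tensor_contraction k a' u' t)).
      by rewrite !symmetrizationD; ring.
    by apply/funext => ?; exact: contractionDr.
  by apply/funext => ?; exact: contractionDr.
Qed.

Definition commutator_form (c : R) a b a' b' : \bar R := (c%:E * tnorm2 (commutator a b a' b'))%E.

Lemma commutator_form_fine (c : R) f g : 0 <= c -> symmetric_tensor f -> symmetric_tensor g ->
  (fine (double_sum (commutator_form c) f g))%:E = double_sum (commutator_form c) f g.
Proof.
move=> c0; have [D0 DB Dl Dr] := commutator_form_axioms c0.
by apply: (@double_sum_fine _ _ _ (c * 2)) => //; exact: mulr_ge0.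
Qed.

Lemma cvg_commutator_form (c : R) f g : 0 <= c -> symmetric_tensor f -> symmetric_tensor g ->
  (fun N => fine (double_sum (commutator_form c) (truncate N f) (truncate N g))) @ \oo -->
  fine (double_sum (commutator_form c) f g).
Proof.
move=> c0; have [D0 DB Dl Dr] := commutator_form_axioms c0.
by apply: (@cvg_double_sum _ _ _ (c * 2)) => //; exact: mulr_ge0.
Qed.

End CommutatorForm.

End Forms.

(** * Multiple integrals *)

Section ProductBound.
Context (d : measure_display) (T : measurableType d) (R : realType) (P : probability T R).
Variables (Xs Ys : nat -> T -> R) (X Y : T -> R) (D : R).
Hypothesis Xs2 : forall j, L2 P (Xs j).
Hypothesis Ys2 : forall j, L2 P (Ys j).
Hypothesis X2 : L2 P X.
Hypothesis Y2 : L2 P Y.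
Hypothesis XX : (fun j => \int[P]_w ((Xs j w - X w) ^+ 2)) @ \oo --> (0 : R).
Hypothesis YY : (fun j => \int[P]_w ((Ys j w - Y w) ^+ 2)) @ \oo --> (0 : R).
Hypothesis XY2 : forall j, L2 P (fun w => Xs j w * Ys j w).
Hypothesis XYD : forall j, \int[P]_w ((Xs j w * Ys j w) ^+ 2) <= D.

Let cvgE (u : nat -> T -> R) : (forall j, L2 P (u j)) ->
  (fun j => \int[P]_w (u j w ^+ 2)) @ \oo --> (0 : R) ->
  (fun j => (\int[P]_w (u j w ^+ 2)%:E)%E) @ \oo --> 0%E.
Proof.
move=> u2 u0; have E j : ((\int[P]_w (u j w ^+ 2)%:E) = (\int[P]_w (u j w ^+ 2))%:E)%E.
  by rewrite EFin_RI//; case: (u2 j).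
apply/fine_cvgP; split; first by near=> j; rewrite E.
by rewrite (_ : fine \o _ = (fun j => \int[P]_w (u j w ^+ 2))).
Unshelve. all: by end_near. Qed.

Let mXY : measurable_fun setT (fun w => X w * Y w).
Proof. by apply: measurable_funM; [case: X2|case: Y2]. Qed.

(** The product is truncated, not its factors: the result [Z] is bounded and satisfies
    [X Y Z = Z ^+ 2]. *)
Let trunc (M : nat) w : R := X w * Y w * \1_[set w | `|X w * Y w| <= M%:R] w.

Let mtrunc M : measurable_fun setT (trunc M).
Proof.
apply: measurable_funM => //; apply: measurable_indic.
rewrite (_ : [set w | _] = (fun w => `|X w * Y w|) @^-1` `]-oo, M%:R]); last first.
  by apply/seteqP; split=> w /=; rewrite in_itv.
rewrite -[X in measurable X]setTI; have : measurable_fun setT (fun w => `|X w * Y w|).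
  exact: measurableT_comp.
exact.
Qed.

Let btrunc M w : `|trunc M w| <= M%:R.
Proof.
rewrite /trunc indicE; case: (boolP (w \in _)) => [|_]; last by rewrite mulr0 normr0.
by rewrite inE mulr1.
Qed.

Let truncE M w : X w * Y w * trunc M w = trunc M w ^+ 2.
Proof.
by rewrite /trunc indicE; case: (boolP (w \in _)) => _; rewrite ?mulr1 ?mulr0 ?expr0n ?expr2.
Qed.

Let trunc2 M : L2 P (trunc M).
Proof.
have := L2_bounded_mul (mtrunc M) (btrunc M) (L2_cst P 1).
by under eq_fun do rewrite mul1r.
Qed.

Let trunc_bound M : \int[P]_w (trunc M w ^+ 2) <= D.
Proof.
set Z := trunc M.
have XZ : L2 P (fun w => X w * Z w) by exact: L2_bounded_mul (mtrunc M) (btrunc M) X2.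
have YZ : L2 P (fun w => Y w * Z w) by exact: L2_bounded_mul (mtrunc M) (btrunc M) Y2.
have u2 j : L2 P (fun w => Xs j w - X w) by exact: L2B.
have v2 j : L2 P (fun w => Ys j w - Y w) by exact: L2B.
have c1 := L2_cvg_mul (fun j => (u2 j).1) YZ (cvgE u2 XX).
have c2 := L2_cvg_mul (fun j => (v2 j).1) XZ (cvgE v2 YY).
have vZ j : L2 P (fun w => (Ys j w - Y w) * Z w) by exact: L2_bounded_mul (mtrunc M) (btrunc M) (v2 j).
(* The product of the two errors is controlled in the first moment only; boundedness of [Z] is what
   makes this term small. *)
have c3 : (fun j => \int[P]_w ((Xs j w - X w) * ((Ys j w - Y w) * Z w))) @ \oo --> (0 : R).
  apply/cvgr0Pnorm_le => ep ep0.
  have cs : (fun j => M%:R * (\int[P]_w ((Xs j w - X w) ^+ 2) + \int[P]_w ((Ys j w - Y w) ^+ 2))) @ \oo --> (0 : R).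
    suff : (fun j => M%:R * (\int[P]_w ((Xs j w - X w) ^+ 2) + \int[P]_w ((Ys j w - Y w) ^+ 2))) @ \oo -->
      (M%:R * (0 + 0) : R) by rewrite addr0 mulr0.
    by apply: cvgM; [exact: cvg_cst|exact: cvgD].
  move/cvgr0Pnorm_le : cs => /(_ _ ep0); apply: filterS => j hj.
  apply: le_trans (le_trans (ler_norm _) hj).
  apply: (le_trans (RI_norm (L2_mul (u2 j) (vZ j)))).
  have l2 : L1 P (fun w => (Xs j w - X w) ^+ 2 + (Ys j w - Y w) ^+ 2).
    by apply: L1D; [case: (u2 j)|case: (v2 j)].
  rewrite -RintegralD//; [|by case: (u2 j)|by case: (v2 j)].
  rewrite -RintegralZl//; apply: RI_le; [exact/L1_norm/L2_mul|exact: L1Z|move=> w].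
  rewrite mulrA normrM mulrC; apply: ler_pM => //; first exact: btrunc.
  rewrite normrM -(real_normK (num_real (Xs j w - X w))) -(real_normK (num_real (Ys j w - Y w))).
  by have := normr_ge0 (Xs j w - X w); have := normr_ge0 (Ys j w - Y w); nra.
have l1 : L1 P (fun w => X w * Y w * Z w).
  by apply: eq_L1 (L2_mul X2 YZ) => w; rewrite mulrA.
have l2 j : L1 P (fun w => Xs j w * Ys j w * Z w) by exact: L2_mul (XY2 j) (trunc2 M).
(* Expansion of [Xs Ys - X Y] into two linear errors and one quadratic error, each tested against
   [Z]. *)
have cT : (fun j => \int[P]_w (Xs j w * Ys j w * Z w)) @ \oo --> \int[P]_w (X w * Y w * Z w).
  rewrite -[X in _ --> X]add0r -[X in _ --> X + _](addr0 (0 : R)) -[X in _ --> X + _ + _](addr0 (0 : R)).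
  have -> : (fun j => \int[P]_w (Xs j w * Ys j w * Z w)) = (fun j =>
     \int[P]_w ((Xs j w - X w) * (Y w * Z w)) + \int[P]_w ((Ys j w - Y w) * (X w * Z w)) +
     \int[P]_w ((Xs j w - X w) * ((Ys j w - Y w) * Z w)) + \int[P]_w (X w * Y w * Z w)).
    apply/funext => j.
    have a1 := L2_mul (u2 j) YZ; have a2 := L2_mul (v2 j) XZ; have a3 := L2_mul (u2 j) (vZ j).
    rewrite -RintegralD// -RintegralD//; last exact: L1D.
    rewrite -RintegralD//; last by apply: L1D => //; exact: L1D.
    by apply: eq_Rintegral => w _; ring.
  by apply: cvgD; [apply: cvgD => //; exact: cvgD|exact: cvg_cst].
have h j : 2 * \int[P]_w (Xs j w * Ys j w * Z w) <= D + \int[P]_w (Z w ^+ 2).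
  apply: (@le_trans _ _ (\int[P]_w ((Xs j w * Ys j w) ^+ 2) + \int[P]_w (Z w ^+ 2))); last by rewrite lerD2r.
  have q1 : L1 P (fun w => (Xs j w * Ys j w) ^+ 2) by case: (XY2 j).
  have q2 : L1 P (fun w => Z w ^+ 2) by case: (trunc2 M).
  rewrite -(RintegralD _ q1 q2)// -(RintegralZl _ _ (l2 j))//.
  apply: RI_le; [exact: L1Z|by apply: L1D; [case: (XY2 j)|case: (trunc2 M)]|move=> w].
  by rewrite -subr_ge0 (_ : _ - _ = (Xs j w * Ys j w - Z w) ^+ 2) ?sqr_ge0//; ring.
have : 2 * \int[P]_w (X w * Y w * Z w) <= D + \int[P]_w (Z w ^+ 2).
  have c4 : (fun j => 2 * \int[P]_w (Xs j w * Ys j w * Z w)) @ \oo --> 2 * \int[P]_w (X w * Y w * Z w).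
    by apply: cvgM; [exact: cvg_cst|exact: cT].
  by apply: (cvgr_to_le c4); near=> j; exact: h.
rewrite (_ : \int[P]_w (X w * Y w * Z w) = \int[P]_w (Z w ^+ 2)).
  by rewrite mulrDl mul1r lerD2r.
by apply: eq_Rintegral => w _; exact: truncE.
Unshelve. all: by end_near. Qed.

(* By duality: X Y is tested against its own truncation Z, and
   E[X Y Z] = E[Z ^+ 2], while 2 E[Xs j Ys j Z] <= D + E[Z ^+ 2]. *)
Lemma L2_product_bound : L2 P (fun w => X w * Y w) /\ \int[P]_w ((X w * Y w) ^+ 2) <= D.
Proof.
have m2 M : measurable_fun setT (fun w => (trunc M w ^+ 2)%:E).
  by apply/measurable_EFinP; exact: measurable_funX.
have p2 M w : setT w -> (0 <= (trunc M w ^+ 2)%:E)%E by move=> _; rewrite lee_fin sqr_ge0.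
have h2 w : setT w -> {homo (fun M => (trunc M w ^+ 2)%:E) : k l / (k <= l)%N >-> (k <= l)%E}.
  move=> _ k l kl; rewrite lee_fin /trunc !indicE !exprMn.
  apply: ler_wpM2l; first exact: mulr_ge0 (sqr_ge0 _) (sqr_ge0 _).
  case: (boolP (w \in [set w | `|X w * Y w| <= k%:R])) => [|_]; last by rewrite expr0n sqr_ge0.
  rewrite inE /= => wk; rewrite mem_set//=; apply: (le_trans wk).
  by rewrite ler_nat.
have lE w : limn (fun M => (trunc M w ^+ 2)%:E) = ((X w * Y w) ^+ 2)%:E.
  apply/cvg_lim => //; apply: cvg_near_cst.
  have := nbhs_infty_ger `|X w * Y w|; apply: filterS => M hM.
  by rewrite /trunc indicE mem_set ?mulr1.
have key : (\int[P]_w ((X w * Y w) ^+ 2)%:E <= D%:E)%E.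
  have := @cvg_monotone_convergence _ _ _ P _ measurableT _ m2 p2 h2.
  under eq_integral do rewrite lE.
  move=> h; apply: (cvge_le _ h); near=> M.
  by rewrite -EFin_RI ?lee_fin//; case: (trunc2 M).
have l2 := L2_finite mXY (le_lt_trans key (ltry _)).
by split=> //; rewrite -lee_fin EFin_RI//; case: l2.
Unshelve. all: by end_near. Qed.

End ProductBound.

(** * Multiple integrals of finitely supported tensors *)

Section MultipleIntegrals.
Variables (R : realType) (H : completeNormedModType R) (ip : H -> H -> R) (e : nat -> H).
Context (d : measure_display) (T : measurableType d) (P : probability T R).
Variable W : H -> {RV P >-> R}.
Variable I : forall n : nat, tensor R n -> {RV P >-> R}.
Hypothesis ip_inner : inner_product ip.
Hypothesis e_basis : complete_orthonormal_system ip e.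
Hypothesis W_isonormal : isonormal ip W.
Hypothesis I_integral : forall n : nat, multiple_integral ip e W (I (n := n)).
Implicit Types (n p q N : nat).

Lemma I_linear n (a : R) (f g : tensor R n) : symmetric_tensor f -> symmetric_tensor g ->
  \forall w \ae P, I (fun t => a * f t + g t) w = a * I f w + I g w.
Proof.
have [h _ _] := I_integral n; move=> fs gs.
by have := h a f g fs gs; apply: filterS => w; exact.
Qed.

Lemma symmetric_tensor0 n : symmetric_tensor (fun _ : n.-tuple nat => 0 : R).
Proof. by split=> //; rewrite /square_summable esum1// => t _; rewrite expr0n. Qed.

Lemma I0 n : \forall w \ae P, I (fun _ : n.-tuple nat => 0) w = 0.
Proof.
have := I_linear 1 (symmetric_tensor0 n) (symmetric_tensor0 n).
rewrite (_ : (fun _ => 1 * 0 + 0) = (fun _ : n.-tuple nat => 0 : R)).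
  by apply: filterS => w; rewrite mul1r -[LHS]addr0 => /addrI.
by apply/funext => t; rewrite mulr0 addr0.
Qed.

Lemma I_add n (f g : tensor R n) : symmetric_tensor f -> symmetric_tensor g ->
  \forall w \ae P, I (fun t => f t + g t) w = I f w + I g w.
Proof.
move=> fs gs; have := I_linear 1 fs gs.
rewrite (_ : (fun t => 1 * f t + g t) = (fun t => f t + g t)).
  by apply: filterS => w ->; rewrite mul1r.
by apply/funext => t; rewrite mul1r.
Qed.

Lemma I_sub n (f g : tensor R n) : symmetric_tensor f -> symmetric_tensor g ->
  \forall w \ae P, I (fun t => f t - g t) w = I f w - I g w.
Proof.
move=> fs gs; have := I_linear (-1) gs fs.
rewrite (_ : (fun t => -1 * g t + f t) = (fun t => f t - g t)).
  by apply: filterS => w ->; rewrite mulN1r addrC.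
by apply/funext => t; rewrite mulN1r addrC.
Qed.

Lemma E_I2 n (f : tensor R n) : symmetric_tensor f ->
  (\int[P]_w ((I f w) ^+ 2)%:E = (n`!%:R * sqnorm f)%:E)%E.
Proof. by move=> fs; have [_ _ h] := I_integral n; have := h f fs; rewrite unlock. Qed.

Lemma L2_I n (f : tensor R n) : symmetric_tensor f -> L2 P (I f).
Proof. by move=> fs; apply: L2_finite => //; rewrite E_I2// ltry. Qed.

Lemma RI_I2 n (f : tensor R n) : symmetric_tensor f ->
  \int[P]_w ((I f w) ^+ 2) = n`!%:R * sqnorm f.
Proof. by move=> fs; apply: EFin_inj; rewrite EFin_RI ?E_I2//; case: (L2_I fs). Qed.

Section Chaos.
Variables (n N : nat).
Hypothesis N0 : (0 < N)%N.

Let vec (c : {ffun 'I_N -> R}) : H := \sum_(i < N) c i *: e i.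

Let ip_vec c (j : 'I_N) : ip (vec c) (e j) = c j.
Proof.
rewrite (ip_suml ip_inner) (bigD1 j)//= (ipZl ip_inner) e_basis.1 eqxx mulr1 big1 ?addr0// => i ij.
by rewrite (ipZl ip_inner) e_basis.1 (negbTE (ij : (i : nat) != j)) mulr0.
Qed.

Let ip_vec0 c j : (N <= j)%N -> ip (vec c) (e j) = 0.
Proof.
move=> Nj; rewrite (ip_suml ip_inner) big1// => i _.
by rewrite (ipZl ip_inner) e_basis.1 ltn_eqF ?mulr0// (leq_trans _ Nj).
Qed.

Let norm_vec (c : {ffun 'I_N -> R}) : \sum_i c i ^+ 2 = 1 -> `|vec c| = 1.
Proof.
move=> c1; apply/eqP; rewrite -(@pexpr_eq1 _ _ 2)// -(ip_norm ip_inner) -c1 {2}/vec.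
rewrite (ipC ip_inner) (ip_suml ip_inner); apply/eqP/eq_bigr => i _.
by rewrite (ipZl ip_inner) (ipC ip_inner) ip_vec expr2.
Qed.

Let tp c : tensor R n := tensor_power ip e (vec c).

Let tp_prod c t : tp c t = \prod_(j <- t) ip (vec c) (e j).
Proof. by rewrite /tp /tensor_power big_tuple. Qed.

Let tp_supported c : supported N (tp c).
Proof.
move=> t /allPn[j jt jN]; rewrite tp_prod (big_rem j)//= ip_vec0 ?mul0r//.
by rewrite leqNgt.
Qed.

Let tp_word c (s : seq 'I_N) : size s = n -> tp c (as_tuple n (map val s)) = \prod_(i <- s) c i.
Proof.
move=> sn; rewrite tp_prod val_as_tuple ?size_map// big_map.
by apply: eq_bigr => i _; rewrite ip_vec.
Qed.

Let tp_symmetric c : symmetric_tensor (tp c).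
Proof.
apply/symmetric_tensorP; split.
  by rewrite /square_summable -/(tnorm2 _) (tnorm2_supported (@tp_supported c)) ltry.
move=> s t sn st; have tn : size t = n by rewrite -(perm_size st).
by rewrite !tp_prod !val_as_tuple//; exact: perm_big.
Qed.

Let W_vec c : \forall w \ae P, W (vec c) w = \sum_i c i * W (e i) w.
Proof.
rewrite /vec; elim: (index_enum _) => [|i r IH].
  by have := W0 ip_inner W_isonormal; apply: filterS => w /(_ Logic.I); rewrite !big_nil.
have := W_linear ip_inner W_isonormal (c i) (e i) (\sum_(j <- r) c j *: e j).
by apply: filterS2 IH => w IHw /(_ Logic.I); rewrite !big_cons IHw.
Qed.

Let I_tp (c : {ffun 'I_N -> R}) : \sum_i c i ^+ 2 = 1 ->
  \forall w \ae P, I (tp c) w = gauss_poly e W (chaos n (fun s : seq 'I_N => \prod_(i <- s) c i)) w.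
Proof.
move=> c1; have [_ h _] := I_integral n; have := h _ (norm_vec c1); rewrite -/(tp c).
have := W_vec c; apply: filterS2 => w Ww /(_ Logic.I) ->.
by rewrite /gauss_poly chaos_power// Ww.
Qed.

Let I_sum (r : seq (R * {ffun 'I_N -> R})) :
  all (fun x : R * {ffun 'I_N -> R} => \sum_i x.2 i ^+ 2 == 1) r ->
  symmetric_tensor (fun t => \sum_(x <- r) x.1 * tp x.2 t) /\
  \forall w \ae P, I (fun t => \sum_(x <- r) x.1 * tp x.2 t) w =
    gauss_poly e W (chaos n (fun s : seq 'I_N => \sum_(x <- r) x.1 * \prod_(i <- s) x.2 i)) w.
Proof.
elim: r => [_|x r IH /= /andP[/eqP x1 /IH[rs Ir]]].
  have -> : (fun t => \sum_(x <- [::]) x.1 * tp x.2 t) = (fun _ : n.-tuple nat => 0 : R).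
    by apply/funext => t; rewrite big_nil.
  split; first exact: symmetric_tensor0.
  have := I0 n; apply: filterS => w ->; rewrite /gauss_poly.
  rewrite (_ : chaos n _ = 0) ?meval0// -(scale0r (chaos n (fun=> 0))) -chaosZ.
  by apply: eq_chaos => s _; rewrite big_nil mul0r.
have E : (fun t => \sum_(y <- x :: r) y.1 * tp y.2 t) =
    (fun t => x.1 * tp x.2 t + \sum_(y <- r) y.1 * tp y.2 t).
  by apply/funext => t; rewrite big_cons.
rewrite E; split; first by apply: symmetric_tensorD => //; exact: symmetric_tensorZ.
have := I_linear x.1 (tp_symmetric x.2) rs; have := I_tp x1.
apply: filterS3 Ir => w Ir Ix ->; rewrite Ir Ix /gauss_poly -mevalZ -mevalD -chaosZ -chaosD.
by congr meval; apply: eq_chaos => s _; rewrite big_cons.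
Qed.

Lemma I_chaos (f : tensor R n) : symmetric_tensor f -> supported N f ->
  \forall w \ae P, I f w = gauss_poly e W (chaos n (coef f : seq 'I_N -> R)) w.
Proof.
move=> fs fN; have [r [r1 fr]] := polarization n N0 (coef_perm_invariant (N := N) fs).
have [_] := I_sum r1.
rewrite (_ : (fun t => \sum_(x <- r) x.1 * tp x.2 t) = f); last first.
  apply/funext => t; have [tN|tN] := boolP (all (fun j => j < N)%N t); last first.
    by rewrite fN// big1// => x _; rewrite tp_supported ?mulr0.
  have [s sn ->] := supported_word tN.
  have := fr s sn; rewrite {1}/coef sn eqxx => ->; apply: eq_bigr => x _; rewrite tp_word//.
apply: filterS => w ->; rewrite /gauss_poly; congr meval.
by apply: eq_chaos => s sn; rewrite fr.
Qed.

End Chaos.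

(** The coefficient of [T_] for the orders [p = n - 1] and [q = m - 1] of the slices. *)
Definition fourth_coef p q k : R := (k`! ^ 2 * 'C(q, k) ^ 2 * 'C(p, k) ^ 2 * (p - k + (q - k))`!)%:R.

Definition wick_diff p q (a : tensor R p) (b : tensor R q) (a' : tensor R p) (b' : tensor R q) w : R :=
  I a w * I b w - I a' w * I b' w.

Lemma sqnorm_commutator_supported p q k N (a : tensor R p) (b : tensor R q) (a' : tensor R p) (b' : tensor R q) :
  (k <= p)%N -> (k <= q)%N -> supported N a -> supported N b -> supported N a' -> supported N b' ->
  sqnorm (commutator (k := k) a b a' b') =
  \sum_(t : (p - k + (q - k)).-tuple 'I_N)
      (symz (ctensor p k (coef a) (coef b)) t - symz (ctensor p k (coef a') (coef b')) t) ^+ 2.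
Proof.
move=> kp kq aN bN a'N b'N.
have cN : supported N (commutator (k := k) a b a' b').
  move=> t tN; rewrite /commutator !(symmetrization_supported (N := N)) ?subrr//; exact: contraction_supported.
rewrite /sqnorm -/(tnorm2 _) (tnorm2_supported cN) /= big_words_tuple; apply: eq_bigr => t _.
rewrite /coef size_tuple eqxx /commutator; congr ((_ - _) ^+ 2); apply: symmetrization_word => s sM;
  exact: contraction_word.
Qed.

Lemma L2_wick_supported p q N (a : tensor R p) (b : tensor R q) (a' : tensor R p) (b' : tensor R q) :
  (0 < N)%N -> symmetric_tensor a -> symmetric_tensor b -> symmetric_tensor a' -> symmetric_tensor b' ->
  supported N a -> supported N b -> supported N a' -> supported N b' ->
  L2 P (wick_diff a b a' b') /\
  \int[P]_w (wick_diff a b a' b' w ^+ 2) =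
    \sum_(k < (minn p q).+1) fourth_coef p q k * sqnorm (commutator (k := k) a b a' b').
Proof.
move=> N0 sa sb sa' sb' aN bN a'N b'N.
set A := chaos p (coef a : seq 'I_N -> R); set B := chaos q (coef b : seq 'I_N -> R).
set A' := chaos p (coef a' : seq 'I_N -> R); set B' := chaos q (coef b' : seq 'I_N -> R).
have E : (fun w => wick_diff a b a' b' w ^+ 2) = gauss_poly e W ((A * B - A' * B') ^+ 2) %[ae P].
  have h1 := I_chaos N0 sa aN; have h2 := I_chaos N0 sb bN.
  have h3 := I_chaos N0 sa' a'N; have h4 := I_chaos N0 sb' b'N.
  apply: (filterS2 _ _ (filterI h1 h2) (filterI h3 h4)) => w [Ea Eb] [Ea' Eb'] _.
  by rewrite /wick_diff Ea Eb Ea' Eb' /gauss_poly expr2 mevalM mevalB !mevalM.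
have mD : measurable_fun setT (wick_diff a b a' b').
  by apply: measurable_funB; exact: measurable_funM.
have mD2 : measurable_fun setT (fun w => wick_diff a b a' b' w ^+ 2) by exact: measurable_funX.
split.
  split=> //; apply: (L1_ae mD2 (L1_gauss_poly e W_isonormal ((A * B - A' * B') ^+ 2))) => //.
rewrite (RI_ae mD2 (L1_measurable (L1_gauss_poly e W_isonormal ((A * B - A' * B') ^+ 2))) E).
rewrite -/(gauss_mean e W _).
rewrite (@mu_chaos4 R N (gauss_mean e W (N := N)) (gauss_meanD e W_isonormal (N := N))
  (gauss_meanZ e W_isonormal (N := N)) (gauss_mean1 e W N)
  (gauss_meanX ip_inner e_basis W_isonormal (N := N))); try exact: coef_perm_invariant.
apply: eq_bigr => k _; congr (_ * _); rewrite (@sqnorm_commutator_supported p q k N)//.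
- by have := ltn_ord k; rewrite ltnS leq_min => /andP[].
- by have := ltn_ord k; rewrite ltnS leq_min => /andP[].
Qed.

End MultipleIntegrals.

Lemma commutator_square_summable (R : realType) p q k (a : tensor R p) (b : tensor R q)
    (a' : tensor R p) (b' : tensor R q) : (k <= p)%N -> (k <= q)%N ->
  symmetric_tensor a -> symmetric_tensor b -> symmetric_tensor a' -> symmetric_tensor b' ->
  square_summable (commutator (k := k) a b a' b').
Proof.
move=> kp kq [sa _] [sb _] [sa' _] [sb' _].
apply: (le_lt_trans (tnorm2_commutator kp kq sa sb sa' sb')).
have -> : (tnorm2 a * tnorm2 b + tnorm2 a' * tnorm2 b' = (sqnorm a * sqnorm b + sqnorm a' * sqnorm b')%:E)%E.
  by rewrite EFinD !EFinM (sqnormE sa) (sqnormE sb) (sqnormE sa') (sqnormE sb').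
by rewrite -EFinM ltry.
Qed.

Lemma cvg_finite_sum (R : realType) (J : Type) (r : seq J) (F : nat -> J -> R) (l : J -> R) :
  (forall j, F ^~ j @ \oo --> l j) -> (fun N => \sum_(j <- r) F N j) @ \oo --> \sum_(j <- r) l j.
Proof.
move=> Fl; elim: r => [|j r IH].
  by under eq_fun do rewrite big_nil; rewrite big_nil; exact: cvg_cst.
by under eq_fun do rewrite big_cons; rewrite big_cons; exact: cvgD.
Qed.

(** * Second moments of differences of products *)

Section WickForm.
Variables (R : realType) (H : completeNormedModType R) (ip : H -> H -> R) (e : nat -> H).
Context (d : measure_display) (T : measurableType d) (P : probability T R).
Variable W : H -> {RV P >-> R}.
Variable I : forall n : nat, tensor R n -> {RV P >-> R}.
Hypothesis ip_inner : inner_product ip.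
Hypothesis e_basis : complete_orthonormal_system ip e.
Hypothesis W_isonormal : isonormal ip W.
Hypothesis I_integral : forall n : nat, multiple_integral ip e W (I (n := n)).
Implicit Types (n p q N : nat).

Lemma L2_ae (f g : T -> R) : measurable_fun setT f -> L2 P g -> (\forall w \ae P, f w = g w) ->
  L2 P f /\ \int[P]_w (f w ^+ 2) = \int[P]_w (g w ^+ 2).
Proof.
move=> mf [mg g2] fg.
have E : (fun w => f w ^+ 2) = (fun w => g w ^+ 2) %[ae P] by apply: filterS fg => w ->.
have mf2 : measurable_fun setT (fun w => f w ^+ 2) by exact: measurable_funX.
by split; [split=> //; exact: (L1_ae mf2 g2 E)|exact: RI_ae mf2 (L1_measurable g2) E].
Qed.

(** Up to a null set the error is minus the integral of the tail, so the isometry computes it. The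
    shift to [N.+1] keeps at least one basis vector, as [I_chaos] requires. *)
Lemma cvg_I_truncate n (f : tensor R n) : symmetric_tensor f ->
  (fun N => \int[P]_w ((I (truncate N.+1 f) w - I f w) ^+ 2)) @ \oo --> (0 : R).
Proof.
move=> fs; have E N : \int[P]_w ((I (truncate N f) w - I f w) ^+ 2) = n`!%:R * sqnorm (tail N f).
  have tl := tail_symmetric N fs; have tr := truncate_symmetric N fs.
  rewrite -(RI_I2 I_integral tl).
  have tl2 : L2 P (fun w => - I (tail N f) w).
    by have := L2Z (-1) (L2_I I_integral tl); under eq_fun do rewrite mulN1r.
  have mB : measurable_fun setT (fun w => I (truncate N f) w - I f w) by exact: measurable_funB.
  have ea : \forall w \ae P, I (truncate N f) w - I f w = - I (tail N f) w.
    have := I_add I_integral tr tl; rewrite -truncateK; apply: filterS => w ->.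
    by rewrite opprD addNKr.
  have [_ ->] := L2_ae mB tl2 ea.
  by apply: eq_Rintegral => w _; rewrite sqrrN.
have h : (fun N => n`!%:R * sqnorm (tail N f)) @ \oo --> (0 : R).
  by rewrite -[X in _ --> X](mulr0 n`!%:R); apply: cvgM; [exact: cvg_cst|exact: cvg_sqnorm_tail].
rewrite (_ : (fun N => _) = (fun N => n`!%:R * sqnorm (tail N.+1 f))); last by apply/funext => N; exact: E.
by move: h; rewrite -cvg_shiftS.
Qed.

Definition fourth_const p q : R := \sum_(k < (minn p q).+1) fourth_coef R p q k * 2.

Lemma fourth_const_ge0 p q : 0 <= fourth_const p q.
Proof. by apply: sumr_ge0 => k _; rewrite mulr_ge0. Qed.

(** Isometry controls each factor only in the second moment. For truncated tensors the second moment
    of the product is explicit, being the case [a' = b' = 0] of [L2_wick_supported], and bounded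
    uniformly in the truncation; [L2_product_bound] carries both facts to the limit. *)
Lemma fourth_moment p q (a : tensor R p) (b : tensor R q) : symmetric_tensor a -> symmetric_tensor b ->
  L2 P (fun w => I a w * I b w) /\
  \int[P]_w ((I a w * I b w) ^+ 2) <= fourth_const p q * (sqnorm a * sqnorm b).
Proof.
move=> sa sb.
have fin N : (0 < N)%N -> L2 P (fun w => I (truncate N a) w * I (truncate N b) w) /\
    \int[P]_w ((I (truncate N a) w * I (truncate N b) w) ^+ 2) <= fourth_const p q * (sqnorm a * sqnorm b).
  move=> N0; have sN := truncate_symmetric N sa; have tN := truncate_symmetric N sb.
  have z n : supported N (fun _ : n.-tuple nat => 0 : R) by [].
  have [w2 wE] := L2_wick_supported ip_inner e_basis W_isonormal I_integral N0 sN tN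
    (symmetric_tensor0 R p) (symmetric_tensor0 R q) (@truncate_supported _ N _ a) (@truncate_supported _ N _ b)
    (z p) (z q).
  have [||l2 ->] := @L2_ae (fun w => I (truncate N a) w * I (truncate N b) w) _ _ w2.
  - exact: measurable_funM.
  - have := I0 I_integral p; apply: filterS => w I0w.
    by rewrite /wick_diff I0w mul0r subr0.
  split=> //; rewrite wE /fourth_const mulr_suml; apply: ler_sum => k _; rewrite -mulrA.
  apply: ler_wpM2l => //; have := ltn_ord k; rewrite ltnS leq_min => /andP[kp kq].
  have t0 n : tnorm2 (fun _ : n.-tuple nat => 0 : R) = 0%E by apply: esum1 => t _; rewrite expr0n.
  have := tnorm2_commutator kp kq sN.1 tN.1 (symmetric_tensor0 R p).1 (symmetric_tensor0 R q).1.
  rewrite !t0 mule0 adde0 -(sqnormE sN.1) -(sqnormE tN.1) -!EFinM => h.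
  have sc : square_summable (commutator (k := k) (truncate N a) (truncate N b) (fun=> 0) (fun=> 0)).
    exact: (le_lt_trans h (ltry _)).
  move: h; rewrite -(sqnormE sc) lee_fin => /le_trans; apply; apply: ler_wpM2l => //.
  apply: ler_pM; rewrite ?sqnorm_ge0//.
    by rewrite [leRHS](sqnorm_truncate N sa) lerDl sqnorm_ge0.
  by rewrite [leRHS](sqnorm_truncate N sb) lerDl sqnorm_ge0.
apply: (L2_product_bound (Xs := fun N => I (truncate N.+1 a)) (Ys := fun N => I (truncate N.+1 b))).
- by move=> N; apply: (L2_I I_integral); exact: truncate_symmetric.
- by move=> N; apply: (L2_I I_integral); exact: truncate_symmetric.
- exact: (L2_I I_integral).
- exact: (L2_I I_integral).
- exact: cvg_I_truncate.
- exact: cvg_I_truncate.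
- by move=> N; case: (fin N.+1 isT).
- by move=> N; case: (fin N.+1 isT).
Qed.

Definition wick_form p q (a : tensor R p) (b : tensor R q) (a' : tensor R p) (b' : tensor R q) : \bar R :=
  (\int[P]_w (wick_diff I a b a' b' w ^+ 2))%:E.

Lemma L2_wick p q (a : tensor R p) (b : tensor R q) (a' : tensor R p) (b' : tensor R q) :
  symmetric_tensor a -> symmetric_tensor b -> symmetric_tensor a' -> symmetric_tensor b' ->
  L2 P (wick_diff I a b a' b').
Proof. by move=> sa sb sa' sb'; apply: L2B; [case: (fourth_moment sa sb)|case: (fourth_moment sa' sb')]. Qed.

Lemma RI_sqrD (u v : T -> R) (s : R) : 0 < s -> L2 P u -> L2 P v ->
  \int[P]_w ((u w + v w) ^+ 2) <= (1 + s) * \int[P]_w (u w ^+ 2) + (1 + s^-1) * \int[P]_w (v w ^+ 2).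
Proof.
move=> s0 u2 v2; have lu : L1 P (fun w => u w ^+ 2) by case: u2.
have lv : L1 P (fun w => v w ^+ 2) by case: v2.
rewrite -!RintegralZl// -RintegralD//; [|exact: L1Z|exact: L1Z].
apply: RI_le; [by case: (L2D u2 v2)|by apply: L1D; exact: L1Z|move=> w; exact: sqrD_le].
Qed.

Lemma wick_form_axioms p q :
  [/\ forall a b a' b', (0 <= @wick_form p q a b a' b')%E,
   forall a b a' b', symmetric_tensor a -> symmetric_tensor b ->
     symmetric_tensor a' -> symmetric_tensor b' ->
     (@wick_form p q a b a' b' <= (2 * fourth_const p q)%:E * (tnorm2 a * tnorm2 b + tnorm2 a' * tnorm2 b'))%E,
   forall a c b a' c' b' (s : R), 0 < s ->
     symmetric_tensor a -> symmetric_tensor b -> symmetric_tensor a' -> symmetric_tensor b' ->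
     symmetric_tensor c -> symmetric_tensor c' ->
     (@wick_form p q (fun t => (a t + c t)%R) b (fun t => (a' t + c' t)%R) b' <=
        (1 + s)%:E * wick_form a b a' b' + (1 + s^-1)%:E * wick_form c b c' b')%E
   & forall a b c a' b' c' (s : R), 0 < s ->
     symmetric_tensor a -> symmetric_tensor b -> symmetric_tensor a' -> symmetric_tensor b' ->
     symmetric_tensor c -> symmetric_tensor c' ->
     (@wick_form p q a (fun t => (b t + c t)%R) a' (fun t => (b' t + c' t)%R) <=
        (1 + s)%:E * wick_form a b a' b' + (1 + s^-1)%:E * wick_form a c a' c')%E].
Proof.
split.
- by move=> *; rewrite lee_fin; apply: Rintegral_ge0 => w _; exact: sqr_ge0.
- move=> a b a' b' sa sb sa' sb'; have [l1 b1] := fourth_moment sa sb; have [l2 b2] := fourth_moment sa' sb'.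
  have -> : (tnorm2 a * tnorm2 b + tnorm2 a' * tnorm2 b' = (sqnorm a * sqnorm b + sqnorm a' * sqnorm b')%:E)%E.
    by rewrite EFinD !EFinM (sqnormE sa.1) (sqnormE sb.1) (sqnormE sa'.1) (sqnormE sb'.1).
  rewrite -EFinM lee_fin.
  have l2' : L2 P (fun w => - (I a' w * I b' w)).
    by have := L2Z (-1) l2; under eq_fun do rewrite mulN1r.
  apply: (le_trans (RI_sqrD ltr01 l1 l2')); rewrite invr1.
  have -> : \int[P]_w ((- (I a' w * I b' w)) ^+ 2) = \int[P]_w ((I a' w * I b' w) ^+ 2).
    by apply: eq_Rintegral => w _; rewrite sqrrN.
  by move: b1 b2; nra.
- move=> a c b a' c' b' s s0 sa sb sa' sb' sc sc'; rewrite -!EFinM -EFinD lee_fin.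
  have w1 := L2_wick sa sb sa' sb'; have w2 := L2_wick sc sb sc' sb'.
  have [||_ ->] := @L2_ae (wick_diff I (fun t => a t + c t) b (fun t => a' t + c' t) b') _ _ (L2D w1 w2).
  + by apply: measurable_funB; exact: measurable_funM.
  + have := I_add I_integral sa' sc'; have := I_add I_integral sa sc; apply: filterS2 => w E1 E2.
    by rewrite /wick_diff E1 E2; ring.
  exact: RI_sqrD.
- move=> a b c a' b' c' s s0 sa sb sa' sb' sc sc'; rewrite -!EFinM -EFinD lee_fin.
  have w1 := L2_wick sa sb sa' sb'; have w2 := L2_wick sa sc sa' sc'.
  have [||_ ->] := @L2_ae (wick_diff I a (fun t => b t + c t) a' (fun t => b' t + c' t)) _ _ (L2D w1 w2).
  + by apply: measurable_funB; exact: measurable_funM.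
  + have := I_add I_integral sb' sc'; have := I_add I_integral sb sc; apply: filterS2 => w E1 E2.
    by rewrite /wick_diff E1 E2; ring.
  exact: RI_sqrD.
Qed.

Lemma fourth_coef_ge0 p q k : 0 <= fourth_coef R p q k. Proof. by rewrite ler0n. Qed.

(** For truncated tensors the identity holds for each pair of slices by [L2_wick_supported]. All the
    double sums are finite and continuous under truncation, so two limits of one real sequence are
    compared. *)
Lemma wick_identity p q (f : tensor R p.+1) (g : tensor R q.+1) : symmetric_tensor f -> symmetric_tensor g ->
  double_sum (@wick_form p q) f g =
  (\sum_(k < (minn p q).+1) double_sum (commutator_form k (fourth_coef R p q k)) f g)%E.
Proof.
move=> sf sg; have [D0 DB Dl Dr] := wick_form_axioms p q.
have C0 : 0 <= 2 * fourth_const p q by rewrite mulr_ge0// fourth_const_ge0.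
have kpq (k : 'I_(minn p q).+1) : (k <= p)%N /\ (k <= q)%N.
  by have := ltn_ord k; rewrite ltnS leq_min => /andP.
have c1 := cvg_double_sum C0 D0 DB Dl Dr sf sg.
have c2 : (fun N => \sum_(k < (minn p q).+1)
    fine (double_sum (commutator_form k (fourth_coef R p q k)) (truncate N f) (truncate N g))) @ \oo -->
    \sum_(k < (minn p q).+1) fine (double_sum (commutator_form k (fourth_coef R p q k)) f g).
  apply: cvg_finite_sum => k; have [kp kq] := kpq k.
  exact: (cvg_commutator_form kp kq (fourth_coef_ge0 p q k) sf sg).
rewrite -(double_sum_fine C0 D0 DB sf sg).
have -> : (\sum_(k < (minn p q).+1) double_sum (commutator_form k (fourth_coef R p q k)) f g =
    (\sum_(k < (minn p q).+1) fine (double_sum (commutator_form k (fourth_coef R p q k)) f g))%:E)%E.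
  rewrite -sumEFin; apply: eq_bigr => k _; have [kp kq] := kpq k.
  by rewrite (commutator_form_fine kp kq (fourth_coef_ge0 p q k) sf sg).
congr EFin; rewrite -cvg_shiftS in c1; rewrite -cvg_shiftS in c2.
rewrite (_ : (fun N => _) = (fun N => \sum_(k < (minn p q).+1)
    fine (double_sum (commutator_form k (fourth_coef R p q k)) (truncate N.+1 f) (truncate N.+1 g)))) in c1.
  exact: (cvg_unique _ c1 c2).
apply/funext => N' {c2}; set N := N'.+1; have N0 : (0 < N)%N by [].
have fN := truncate_symmetric N sf; have gN := truncate_symmetric N sg.
have fS := @truncate_supported _ N _ f; have gS := @truncate_supported _ N _ g.
apply: EFin_inj; rewrite (double_sum_fine C0 D0 DB fN gN) -sumEFin.
rewrite (eq_bigr (fun k : 'I_(minn p q).+1 => double_sum (commutator_form k (fourth_coef R p q k)) (truncate N f) (truncate N g))); last first.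
  move=> k _; have [kp kq] := kpq k.
  by rewrite (commutator_form_fine kp kq (fourth_coef_ge0 p q k) fN gN).
rewrite /double_sum -esum_sum; last first.
  by move=> i k _ _; apply: esum_ge0 => l _; rewrite mule_ge0 ?tnorm2_ge0 ?lee_fin ?fourth_coef_ge0.
apply: eq_esum => i _; rewrite -esum_sum; last first.
  by move=> l k _ _; rewrite mule_ge0 ?tnorm2_ge0 ?lee_fin ?fourth_coef_ge0.
apply: eq_esum => l _; rewrite /wick_form.
have [_ ->] := L2_wick_supported ip_inner e_basis W_isonormal I_integral N0 (slice_symmetric i fN) (slice_symmetric l gN)
   (slice_symmetric l fN) (slice_symmetric i gN) (@slice_supported _ _ _ _ i fS) (@slice_supported _ _ _ _ l gS)
   (@slice_supported _ _ _ _ l fS) (@slice_supported _ _ _ _ i gS).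
rewrite -sumEFin; apply: eq_bigr => k _; have [kp kq] := kpq k.
by rewrite EFinM sqnormE//; apply: commutator_square_summable => //; exact: slice_symmetric.
Qed.

(** A deterministic identity: the Gaussian mean is there to supply an instance of [mu] to
    [zero_contraction_term]. *)
Lemma zero_identity p q (f : tensor R p.+1) (g : tensor R q.+1) :
  symmetric_tensor f -> symmetric_tensor g ->
  2^-1 * fine (double_sum (commutator_form 0 (fourth_coef R p q 0)) f g) =
  \sum_(r < (minn p q).+1) ((q.+1 * p.+1)%:R * q.+1`!%:R * p.+1`!%:R * 'C(p, r)%:R * 'C(q, r)%:R) *
    (sqnorm (tensor_contraction r f g) - sqnorm (tensor_contraction r.+1 f g)).
Proof.
move=> sf sg.
have c0 : 0 <= fourth_coef R p q 0 by rewrite ler0n.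
have c1 := cvg_commutator_form (leq0n p) (leq0n q) c0 sf sg.
have c2 : (fun N => 2^-1 * fine (double_sum (commutator_form 0 (fourth_coef R p q 0)) (truncate N f) (truncate N g)))
   @ \oo --> 2^-1 * fine (double_sum (commutator_form 0 (fourth_coef R p q 0)) f g).
  by apply: cvgM; [exact: cvg_cst|exact: c1].
have c3 : (fun N => \sum_(r < (minn p q).+1) ((q.+1 * p.+1)%:R * q.+1`!%:R * p.+1`!%:R * 'C(p, r)%:R * 'C(q, r)%:R) *
    (sqnorm (tensor_contraction r (truncate N f) (truncate N g)) - sqnorm (tensor_contraction r.+1 (truncate N f) (truncate N g)))) @ \oo -->
   \sum_(r < (minn p q).+1) ((q.+1 * p.+1)%:R * q.+1`!%:R * p.+1`!%:R * 'C(p, r)%:R * 'C(q, r)%:R) *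
    (sqnorm (tensor_contraction r f g) - sqnorm (tensor_contraction r.+1 f g)).
  apply: cvg_finite_sum => r; have := ltn_ord r; rewrite ltnS leq_min => /andP[rp rq].
  apply: cvgM; first exact: cvg_cst.
  by apply: cvgB; apply: cvg_sqnorm_contraction => //; exact: leqW.
rewrite (_ : (fun N => \sum_(r < _) _) = (fun N => 2^-1 * fine (double_sum (commutator_form 0 (fourth_coef R p q 0))
    (truncate N f) (truncate N g)))) in c3; first exact: (cvg_unique _ c2 c3).
apply/funext => N {c1 c2}; apply/esym.
have fN := truncate_symmetric N sf; have gN := truncate_symmetric N sg.
have fS := @truncate_supported _ N _ f; have gS := @truncate_supported _ N _ g.
set u := truncate N f in fN fS *; set v := truncate N g in gN gS *.
pose a := coef u : seq 'I_N -> R; pose b := coef v : seq 'I_N -> R.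
have zterm := @zero_contraction_term R N (gauss_mean e W (N := N)) (gauss_meanD e W_isonormal (N := N))
  (gauss_meanZ e W_isonormal (N := N)) (gauss_mean1 e W N) (gauss_meanX ip_inner e_basis W_isonormal (N := N))
  p q _ _ (coef_perm_invariant (N := N) fN) (coef_perm_invariant (N := N) gN).
rewrite -/a -/b in zterm.
pose S i l := \sum_(t : (p - 0 + (q - 0)).-tuple 'I_N)
    (symz (ctensor p 0 (fun s => a (i :: s)) (fun s => b (l :: s))) t -
     symz (ctensor p 0 (fun s => a (l :: s)) (fun s => b (i :: s))) t) ^+ 2.
have D0 i l : (0 <= commutator_form 0 (fourth_coef R p q 0) (slice i u) (slice l v) (slice l u) (slice i v))%E.
  by rewrite mule_ge0 ?tnorm2_ge0 ?lee_fin.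
have cz (x : tensor R p) (y : tensor R q) t : (forall s, x s = 0) \/ (forall s, y s = 0) ->
    symmetrization (tensor_contraction 0 x y) t = 0.
  move=> xy; rewrite /symmetrization big1 ?mulr0// => s _; rewrite /tensor_contraction.
  by rewrite (usum_finite (r := [::])) ?big_nil// => i _; case: xy => ->; rewrite ?mul0r ?mulr0.
(* Slices with index at least [N] vanish, which makes the double sum finite. *)
have Dz i l : (N <= i)%N \/ (N <= l)%N ->
    commutator_form 0 (fourth_coef R p q 0) (slice i u) (slice l v) (slice l u) (slice i v) = 0%E.
  move=> il; rewrite /commutator_form (_ : tnorm2 _ = 0%E) ?mule0//; apply: esum1 => t _.
  rewrite /commutator !cz ?subrr ?expr0n//.
    by case: il => h; [right|left] => s; exact: (@slice_eq0 _ N).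
  by case: il => h; [left|right] => s; exact: (@slice_eq0 _ N).
have DE (i l : 'I_N) : commutator_form 0 (fourth_coef R p q 0) (slice i u) (slice l v) (slice l u) (slice i v) =
    ((p.+1%:R * q.+1%:R) ^+ 2 * ((p - 0 + (q - 0))`!%:R * S i l))%:E.
  rewrite /commutator_form -sqnormE; last by apply: commutator_square_summable => //; exact: slice_symmetric.
  rewrite (@sqnorm_commutator_supported _ p q 0 N)//; try exact: slice_supported.
  rewrite -EFinM; congr EFin; rewrite /fourth_coef !bin0 exp1n !muln1 mul1n mulrCA; congr (_ * _).
  rewrite /S mulr_sumr; apply: eq_bigr => t _; rewrite -exprMn mulrBr.
  (* Each slice carries its order as a factor; the square of their product is set apart. *)
  have sE (i' l' : 'I_N) : symz (ctensor p 0 (coef (slice i' u)) (coef (slice l' v))) t =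
     p.+1%:R * q.+1%:R * symz (ctensor p 0 (fun s => a (i' :: s)) (fun s => b (l' :: s))) t.
    rewrite /symz mulrCA; congr (_ * _); rewrite mulr_sumr; apply: eq_bigr => s _.
    rewrite /ctensor /contr !big_words0 /= !coef_slice.
    - by rewrite /a /b; ring.
    - by rewrite size_drop size_map size_enum_ord; lia.
    - by rewrite size_take size_map size_enum_ord; case: ltnP; lia.
  by rewrite !sE.
rewrite /double_sum (esum_nat_finite (N := N)); last 2 first.
- by move=> i; apply: esum_ge0.
- by move=> i Ni; apply: esum1 => l _; apply: Dz; left.
rewrite (eq_bigr (fun i : 'I_N => (\sum_(l < N) (p.+1%:R * q.+1%:R) ^+ 2 * ((p - 0 + (q - 0))`!%:R * S i l))%:E)); last first.
  move=> i _; rewrite (esum_nat_finite (N := N))//; last by move=> l Nl; apply: Dz; right.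
  by rewrite -sumEFin; apply: eq_bigr => l _; exact: DE.
rewrite sumEFin /=.
transitivity ((p.+1%:R * q.+1%:R) ^+ 2 * (2^-1 * \sum_(i < N) \sum_(l < N) ((p - 0 + (q - 0))`!%:R * S i l))).
  rewrite mulrCA; congr (_ * _); rewrite mulr_sumr; apply: eq_bigr => i _; by rewrite mulr_sumr.
rewrite zterm mulr_sumr; apply: eq_bigr => r _.
have := ltn_ord r; rewrite ltnS leq_min => /andP[rp rq].
rewrite !(@sqnorm_contraction_supported _ N)//; try exact: leqW.
(* [(p.+1 q.+1)^2 p! q!] regroups as [q.+1 p.+1] times the two larger factorials. *)
by rewrite /a /b mulrA; congr (_ * _); rewrite !factS !natrM; ring.
Qed.

End WickForm.

(** * The Malliavin matrix *)

Section Series.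
Variables (R : realType) (H : completeNormedModType R) (ip : H -> H -> R) (e : nat -> H).
Hypothesis ip_inner : inner_product ip.
Hypothesis e_basis : complete_orthonormal_system ip e.

Lemma nneseries_EFin (s : nat -> R) (l : R) : (fun n => \sum_(0 <= i < n) s i) @ \oo --> l ->
  (\sum_(0 <= i <oo) (s i)%:E = l%:E)%E.
Proof.
move=> sl; apply: cvg_lim => //.
rewrite (_ : (fun n => (\sum_(0 <= i < n) (s i)%:E)%E) = (fun n => (\sum_(0 <= i < n) s i)%:E)).
  by apply/fine_cvgP; split; [near=> n|exact: sl].
by apply/funext => n; rewrite sumEFin.
Unshelve. all: by end_near. Qed.

Lemma sqr_norm_series x : (\sum_(0 <= i <oo) (ip x (e i) ^+ 2)%:E = (`|x| ^+ 2)%:E)%E.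
Proof. by apply: nneseries_EFin; exact: parseval. Qed.

(** Lagrange's identity through Parseval: for fixed [i] the sum over [l] is the squared norm of
    [x_i y - y_i x], and expanding it leaves sums over [i] that Parseval evaluates. *)
Lemma gram_series x y :
  (\sum_(0 <= i <oo) \sum_(0 <= l <oo) ((ip x (e i) * ip y (e l) - ip x (e l) * ip y (e i)) ^+ 2)%:E =
   (2 * (`|x| ^+ 2 * `|y| ^+ 2 - ip x y ^+ 2))%:E)%E.
Proof.
have E i : (\sum_(0 <= l <oo) ((ip x (e i) * ip y (e l) - ip x (e l) * ip y (e i)) ^+ 2)%:E =
    (ip x (e i) ^+ 2 * `|y| ^+ 2 + ip y (e i) ^+ 2 * `|x| ^+ 2 - 2 * ip x y * (ip x (e i) * ip y (e i)))%:E)%E.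
  have := sqr_norm_series (ip x (e i) *: y - ip y (e i) *: x).
  rewrite -(ip_norm ip_inner) !(ipBl ip_inner, ipBr ip_inner, ipZl ip_inner, ipZr ip_inner).
  rewrite (ipC ip_inner y x) !(ip_norm ip_inner) => h.
  transitivity ((ip x (e i) * (ip x (e i) * `|y| ^+ 2 - ip y (e i) * ip x y) -
     ip y (e i) * (ip x (e i) * ip x y - ip y (e i) * `|x| ^+ 2))%:E); last by congr EFin; ring.
  rewrite -h; apply: eq_eseriesr => l _; congr EFin.
  by rewrite (ipBl ip_inner) !(ipZl ip_inner); ring.
under eq_eseriesr => i _ do rewrite E.
apply: nneseries_EFin.
have -> : 2 * (`|x| ^+ 2 * `|y| ^+ 2 - ip x y ^+ 2) =
    `|x| ^+ 2 * `|y| ^+ 2 + `|y| ^+ 2 * `|x| ^+ 2 - 2 * ip x y * ip x y by ring.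
under eq_fun do rewrite sumrB big_split/= -!mulr_suml -mulr_sumr.
apply: cvgB; first apply: cvgD; apply: cvgM; try exact: cvg_cst; by [exact: parseval|exact: parseval_ip].
Qed.

End Series.

(** * The derivative of a multiple integral and the determinant *)

Section Derivative.
Variables (R : realType) (H : completeNormedModType R) (ip : H -> H -> R) (e : nat -> H).
Context (d : measure_display) (T : measurableType d) (P : probability T R).
Variable W : H -> {RV P >-> R}.
Variable I : forall n : nat, tensor R n -> {RV P >-> R}.
Hypothesis ip_inner : inner_product ip.
Hypothesis e_basis : complete_orthonormal_system ip e.
Hypothesis W_isonormal : isonormal ip W.
Hypothesis I_integral : forall n : nat, multiple_integral ip e W (I (n := n)).

Lemma cvg_EFin_real (u : nat -> R) (l : R) : u @ \oo --> l -> (fun n => (u n)%:E) @ \oo --> l%:E.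
Proof. by move=> ul; apply/fine_cvgP; split; [near=> n|exact: ul]. Unshelve. all: by end_near. Qed.

Section Field.
Variables (p : nat) (f : tensor R p.+1).
Hypothesis fs : symmetric_tensor f.

Let c i w := I (slice i f) w.

Let series_c w := (\sum_(0 <= i <oo) ((c i w) ^+ 2)%:E)%E.

Let mc2 i : measurable_fun setT (fun w => ((c i w) ^+ 2)%:E).
Proof. by apply/measurable_EFinP; exact: measurable_funX. Qed.

Let mseries : measurable_fun setT series_c.
Proof. by apply: ge0_emeasurable_sum => // i w _ _; rewrite lee_fin sqr_ge0. Qed.

Let sliceB N i : slice i (truncate N f) = (fun t => slice i f t - slice i (tail N f) t).
Proof. by apply/funext => t; rewrite /slice /tail; ring. Qed.

Let sum_tail N : (\sum_(0 <= i <oo) (p`!%:R * sqnorm (slice i (tail N f)))%:E =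
   (p`!%:R * (p.+1%:R ^+ 2 * sqnorm (tail N f)))%:E)%E.
Proof.
have ts := tail_symmetric N fs.
under eq_eseriesr => i _ do rewrite EFinM (sqnormE (slice_symmetric i ts).1).
rewrite nneseriesZl; last by move=> i _; exact: tnorm2_ge0.
rewrite nneseries_esumT; last by move=> i; exact: tnorm2_ge0.
by rewrite tnorm2_slices -(sqnormE ts.1) -!EFinM.
Qed.

Let int_series : (\int[P]_w series_c w < +oo)%E.
Proof.
rewrite integral_nneseries//; last by move=> i w _; rewrite lee_fin sqr_ge0.
under eq_eseriesr => i _ do rewrite (E_I2 I_integral (slice_symmetric i fs)) EFinM (sqnormE (slice_symmetric i fs).1).
rewrite nneseriesZl; last by move=> i _; exact: tnorm2_ge0.
rewrite nneseries_esumT; last by move=> i; exact: tnorm2_ge0.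
by rewrite tnorm2_slices -(sqnormE fs.1) -!EFinM ltry.
Qed.

(** Each coordinate of the derivative is an integral known up to a null set; only where their
    squares are summable do they define a vector. *)
Let good : set T := [set w | (series_c w < +oo)%E].

Let mgood : measurable good.
Proof.
rewrite (_ : good = series_c @^-1` `]-oo, +oo%E[).
  by rewrite -[X in measurable X]setTI; apply: mseries => //; exact: emeasurable_itv.
by apply/seteqP; split=> w /=; rewrite in_itv.
Qed.

Let good_ae : \forall w \ae P, good w.
Proof.
have s0 w : (0 <= series_c w)%E by apply: nneseries_ge0 => i _ _; rewrite lee_fin sqr_ge0.
have : P.-integrable setT series_c.
  apply/integrableP; split=> //; under eq_integral do rewrite gee0_abs//.
  exact: int_series.
move=> /(integrable_ae measurableT); apply: filterS => w /(_ Logic.I) h.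
by rewrite /good /= -ge0_fin_numE.
Qed.

Let good_bound w : good w -> exists y, forall j, ip y (e j) = c j w.
Proof.
move=> gw.
have [|y [_ hy]] := @basis_sum_exists _ _ _ _ ip_inner e_basis (c^~ w) (fine (series_c w)).
  move=> n; rewrite -lee_fin fineK; last first.
    by rewrite ge0_fin_numE//; apply: nneseries_ge0 => i _ _; rewrite lee_fin sqr_ge0.
  rewrite -sumEFin -(big_mkord xpredT (fun i => (c i w ^+ 2)%:E)).
  by apply: nneseries_lim_ge => i _ _; rewrite lee_fin sqr_ge0.
by exists y.
Qed.

(** Requiring [good w] inside the set makes [u] the default 0 off [good], so that its coordinates
    are measurable, as [uE] shows. *)
Let u w : H := xget 0 [set y | good w /\ forall j, ip y (e j) = c j w].

Let uE w j : ip (u w) (e j) = c j w * \1_good w.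
Proof.
rewrite indicE; have [gw|gw] := pselect (good w).
  have [y hy] := good_bound gw.
  have : exists y, [set y | good w /\ forall j, ip y (e j) = c j w] y by exists y.
  by rewrite /u mem_set// mulr1 => /(xgetPex 0)[_ ->].
by rewrite /u xgetPN ?(ip0l ip_inner) ?memNset ?mulr0// => y [].
Qed.

Let mu_e j : measurable_fun setT (fun w => ip (u w) (e j)).
Proof.
rewrite (_ : (fun w => _) = (fun w => c j w * \1_good w)); last by apply/funext => w; exact: uE.
by apply: measurable_funM => //; exact: measurable_indic.
Qed.

Let mu_h h : measurable_fun setT (fun w => ip (u w) h).
Proof.
apply: (measurable_fun_cvg (h := fun n w => \sum_(0 <= i < n) ip (u w) (e i) * ip h (e i))).
  by move=> n; apply: measurable_sum => i; apply: measurable_funM => //; exact: measurable_cst.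
by move=> w _; exact: (parseval_ip ip_inner e_basis).
Qed.

Let u_ae i : \forall w \ae P, ip (u w) (e i) = I (slice i f) w.
Proof. by apply: filterS good_ae => w gw; rewrite uE indicE mem_set// mulr1. Qed.

Let poly N : mpoly N.+1 R := chaos p.+1 (coef (truncate N.+1 f) : seq 'I_N.+1 -> R).

Let us N w : H := \sum_(i < N.+1) ('D_(delta_mx 0 i) (polyfun (poly N)) (\row_(j < N.+1) W (e j) w)) *: e i.

(** For [i <= N] differentiating the chaos produces its slice by [mderiv_chaos]; for larger [i] both
    the coordinate and the slice of the truncated tensor vanish. *)
Let us_e N i : \forall w \ae P, ip (us N w) (e i) = I (slice i (truncate N.+1 f)) w.
Proof.
have tN := truncate_symmetric N.+1 fs; have tS := @truncate_supported _ N.+1 _ f.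
have ipus w : ip (us N w) (e i) = if insub i is Some j then gauss_poly e W (mderiv j (poly N)) w else 0.
  rewrite /us (ip_suml ip_inner); case: insubP => [j jN ji|jN].
    rewrite (bigD1 j)//= (ipZl ip_inner) e_basis.1 ji eqxx mulr1 big1 ?addr0.
      by rewrite derive_polyfun gauss_polyE.
    move=> k kj; rewrite (ipZl ip_inner) e_basis.1 -ji; by rewrite (negbTE (kj : (k : nat) != j)) mulr0.
  rewrite big1// => k _; rewrite (ipZl ip_inner) e_basis.1 ltn_eqF ?mulr0//.
  by rewrite (leq_trans (ltn_ord k))// leqNgt.
case: (insubP 'I_N.+1 i) ipus => [j jN ji|jN] ipus.
  have := I_chaos ip_inner e_basis W_isonormal I_integral (ltn0Sn N) (slice_symmetric i tN) (@slice_supported _ _ _ _ i tS).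
  apply: filterS => w ->; rewrite ipus /gauss_poly mderiv_chaos; last exact: coef_perm_invariant.
  rewrite -chaosZ; congr meval; apply: eq_chaos => s sp.
  by rewrite -ji coef_slice.
have := I0 I_integral p.
rewrite (_ : (fun=> 0) = slice i (truncate N.+1 f)); last first.
  by apply/funext => t; rewrite (slice_eq0 t tS)// leqNgt.
by apply: filterS => w ->; rewrite ipus.
Qed.

(** The approximants are the polynomials of the truncated tensors. Their errors, for the variable
    and for its derivative, are multiples of the squared norm of the tail. *)
Lemma malliavin_derivative_exists :
  exists2 v : T -> H, is_malliavin_derivative ip W (I f) v &
    forall i, \forall w \ae P, ip (v w) (e i) = I (slice i f) w.
Proof.
exists u => //; split=> //.
exists (fun N w => gauss_poly e W (poly N) w), us; split.
- move=> N; exists N.+1, (polyfun (poly N)), (fun i : 'I_N.+1 => e i); split.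
  + exact: smooth_polyfun.
  + by apply/funext => w; rewrite gauss_polyE.
  + by [].
- under eq_fun do rewrite unlock.
  rewrite (_ : (fun j => _) = (fun N => (\int[P]_w ((I (truncate N.+1 f) w - I f w) ^+ 2))%:E)).
    have h : (fun N => \int[P]_w ((I (truncate N.+1 f) w - I f w) ^+ 2)) @ \oo --> (0 : R).
      exact: (cvg_I_truncate I_integral fs).
    exact: (cvg_EFin_real h).
  apply/funext => N; have tN := truncate_symmetric N.+1 fs.
  have d2 : L2 P (fun w => I (truncate N.+1 f) w - I f w) by apply: L2B; exact: (L2_I I_integral).
  have mg : measurable_fun setT (fun w => gauss_poly e W (poly N) w - I f w).
    by apply: measurable_funB => //; exact: measurable_gauss_poly.
  have ae : \forall w \ae P, gauss_poly e W (poly N) w - I f w = I (truncate N.+1 f) w - I f w.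
    have := I_chaos ip_inner e_basis W_isonormal I_integral (ltn0Sn N) tN (@truncate_supported _ N.+1 _ f).
    by apply: filterS => w ->.
  have [g2 <-] := L2_ae mg d2 ae.
  by rewrite EFin_RI//; case: g2.
- under eq_fun do rewrite unlock.
  rewrite (_ : (fun j => _) = (fun N => (p`!%:R * (p.+1%:R ^+ 2 * sqnorm (tail N.+1 f)))%:E)).
    have h : (fun N => p`!%:R * (p.+1%:R ^+ 2 * sqnorm (tail N f))) @ \oo --> (0 : R).
      have := cvgM (cvg_cst (p`!%:R : R)) (cvgM (cvg_cst (p.+1%:R ^+ 2 : R)) (cvg_sqnorm_tail fs)).
      by rewrite !mulr0; exact.
    rewrite -cvg_shiftS in h; exact: (cvg_EFin_real h).
  apply/funext => N; have tN := truncate_symmetric N.+1 fs; have ts := tail_symmetric N.+1 fs.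
  have musB h : measurable_fun setT (fun w => ip (us N w - u w) h).
    under eq_fun do rewrite (ipBl ip_inner); apply: measurable_funB => //.
    under eq_fun do rewrite /us (ip_suml ip_inner); apply: measurable_sum => i.
    rewrite (_ : (fun w => _) = (fun w => gauss_poly e W (mderiv i (poly N)) w * ip (e i) h)).
      by apply: measurable_funM; [exact: measurable_gauss_poly|exact: measurable_cst].
    by apply/funext => w; rewrite (ipZl ip_inner) derive_polyfun gauss_polyE.
  (* Parseval reduces the error in [H] to its coordinates, each of which is minus the integral of a
     slice of the tail; [sum_tail] adds them up. *)
  under eq_integral do rewrite -(sqr_norm_series ip_inner e_basis).
  rewrite integral_nneseries//; last 2 first.
  + by move=> i; apply/measurable_EFinP; exact: measurable_funX.
  + by move=> i w _; rewrite lee_fin sqr_ge0.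
  rewrite -sum_tail; apply: eq_eseriesr => i _.
  have ae : \forall w \ae P, ip (us N w - u w) (e i) = - I (slice i (tail N.+1 f)) w.
    have h1 := us_e N i; have h2 := u_ae i.
    have := I_sub I_integral (slice_symmetric i fs) (slice_symmetric i ts); rewrite -sliceB.
    apply: filterS3 h1 h2 => w E1 E2 E3; rewrite (ipBl ip_inner) E1 E2 E3.
    by rewrite addrAC subrr add0r.
  have n2 : L2 P (fun w => - I (slice i (tail N.+1 f)) w).
    by have := L2Z (-1) (L2_I I_integral (slice_symmetric i ts)); under eq_fun do rewrite mulN1r.
  have [g2 E] := L2_ae (musB (e i)) n2 ae.
  rewrite -EFin_RI; last by case: g2.
  rewrite E -(RI_I2 I_integral (slice_symmetric i ts)); congr EFin.
  by apply: eq_Rintegral => w _; rewrite sqrrN.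
Qed.

End Field.

Hypothesis W_generates : generated_by W.

(** [xget] selects some derivative, since one exists, and uniqueness gives it the coordinates of the
    one constructed above. *)
Lemma malliavin_derivativeP p (f : tensor R p.+1) : symmetric_tensor f ->
  (forall h, measurable_fun setT (fun w => ip (malliavin_derivative ip W (I f) w) h)) /\
  forall i, \forall w \ae P, ip (malliavin_derivative ip W (I f) w) (e i) = I (slice i f) w.
Proof.
move=> fs; have [v Dv ve] := malliavin_derivative_exists fs.
have D : is_malliavin_derivative ip W (I f) (malliavin_derivative ip W (I f)).
  have : exists u, [set u : T -> H | is_malliavin_derivative ip W (I f) u] u by exists v.
  exact: (xgetPex (fun=> 0)).
split; first by case: D.
have uniq := malliavin_unique ip_inner e_basis W_isonormal W_generates D Dv.
by move=> i; apply: filterS2 uniq (ve i) => w ->.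
Qed.

Lemma det_malliavin_matrix (F G : {RV P >-> R}) w : \det (malliavin_matrix ip W F G w) =
  `|malliavin_derivative ip W F w| ^+ 2 * `|malliavin_derivative ip W G w| ^+ 2 -
  ip (malliavin_derivative ip W F w) (malliavin_derivative ip W G w) ^+ 2.
Proof.
have det2 (A : 'M[R]_(1 + 1)) : \det A = A (lshift 1 0) (lshift 1 0) * A (rshift 1 0) (rshift 1 0) -
    A (lshift 1 0) (rshift 1 0) * A (rshift 1 0) (lshift 1 0).
  rewrite (expand_det_row _ (lshift 1 0)) !big_ord_recl big_ord0 addr0 /cofactor !det_mx11 !mxE /=.
  rewrite expr0 expr1 mul1r mulN1r mulrN; congr (A _ _ * A _ _ - A _ _ * A _ _); exact: val_inj.
rewrite det2 /malliavin_matrix block_mxEul block_mxEur block_mxEdl block_mxEdr.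
by rewrite !mxE eqxx !mulr1n -expr2.
Qed.

(** The determinant is a double series of squares, so Tonelli exchanges sums and expectation before
    any integrability is known; coordinates are replaced by integrals of slices only afterwards,
    inside each term. *)
Lemma expected_det p q (f : tensor R p.+1) (g : tensor R q.+1) : symmetric_tensor f -> symmetric_tensor g ->
  ('E_P[fun w => \det (malliavin_matrix ip W (I f) (I g) w)] =
   (2^-1)%:E * double_sum (@wick_form _ _ _ P I p q) f g)%E.
Proof.
move=> fs gs; rewrite unlock.
have [mf ef] := malliavin_derivativeP fs; have [mg eg] := malliavin_derivativeP gs.
set u := malliavin_derivative ip W (I f) in mf ef *; set v := malliavin_derivative ip W (I g) in mg eg *.
have mB i l : measurable_fun setT (fun w => ip (u w) (e i) * ip (v w) (e l) - ip (u w) (e l) * ip (v w) (e i)).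
  by apply: measurable_funB; exact: measurable_funM.
have m2 i l : measurable_fun setT (fun w => ((ip (u w) (e i) * ip (v w) (e l) - ip (u w) (e l) * ip (v w) (e i)) ^+ 2)%:E).
  by apply/measurable_EFinP; exact: measurable_funX.
have p2 i l w : (0 <= ((ip (u w) (e i) * ip (v w) (e l) - ip (u w) (e l) * ip (v w) (e i)) ^+ 2)%:E)%E.
  by rewrite lee_fin sqr_ge0.
have ms i : measurable_fun setT (fun w => \sum_(0 <= l <oo) ((ip (u w) (e i) * ip (v w) (e l) - ip (u w) (e l) * ip (v w) (e i)) ^+ 2)%:E)%E.
  by apply: ge0_emeasurable_sum => // l w _ _.
have ps i w : (0 <= \sum_(0 <= l <oo) ((ip (u w) (e i) * ip (v w) (e l) - ip (u w) (e l) * ip (v w) (e i)) ^+ 2)%:E)%E.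
  by apply: nneseries_ge0.
transitivity (\int[P]_w ((2^-1)%:E * \sum_(0 <= i <oo) \sum_(0 <= l <oo)
    ((ip (u w) (e i) * ip (v w) (e l) - ip (u w) (e l) * ip (v w) (e i)) ^+ 2)%:E))%E.
  apply: eq_integral => w _; rewrite (gram_series ip_inner e_basis) det_malliavin_matrix -EFinM.
  by congr EFin; rewrite [RHS]mulrA mulVf ?mul1r.
have i2 : (0 <= (2^-1 : R)%:E)%E by rewrite lee_fin invr_ge0.
have mS : measurable_fun setT (fun w => \sum_(0 <= i <oo) \sum_(0 <= l <oo)
    ((ip (u w) (e i) * ip (v w) (e l) - ip (u w) (e l) * ip (v w) (e i)) ^+ 2)%:E)%E.
  by apply: ge0_emeasurable_sum => // i w _ _.
have pS w : (0 <= \sum_(0 <= i <oo) \sum_(0 <= l <oo)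
    ((ip (u w) (e i) * ip (v w) (e l) - ip (u w) (e l) * ip (v w) (e i)) ^+ 2)%:E)%E.
  by apply: nneseries_ge0.
rewrite ge0_integralZl//.
congr (_ * _)%E; rewrite integral_nneseries//.
rewrite nneseries_esumT; last by move=> i; exact: integral_ge0.
apply: eq_esum => i _; rewrite integral_nneseries//.
rewrite nneseries_esumT; last by move=> l; exact: integral_ge0.
apply: eq_esum => l _.
have w2 := L2_wick ip_inner e_basis W_isonormal I_integral (slice_symmetric i fs) (slice_symmetric l gs)
  (slice_symmetric l fs) (slice_symmetric i gs).
have ae : \forall w \ae P, ip (u w) (e i) * ip (v w) (e l) - ip (u w) (e l) * ip (v w) (e i) =
    wick_diff I (slice i f) (slice l g) (slice l f) (slice i g) w.
  by apply: filterS2 (filterI (ef i) (eg l)) (filterI (ef l) (eg i)) => w [-> ->] [-> ->].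
have [l2 E] := L2_ae (mB i l) w2 ae.
by rewrite /wick_form -E EFin_RI//; case: l2.
Qed.

End Derivative.

Lemma T_double_sum (R : realType) p q k (f : tensor R p.+1) (g : tensor R q.+1) :
  (k <= p)%N -> (k <= q)%N -> symmetric_tensor f -> symmetric_tensor g ->
  T_ f g k = ((2^-1)%:E * double_sum (commutator_form k (fourth_coef R p q k)) f g)%E.
Proof.
move=> kp kq fs gs; rewrite /T_ esum_pair; last first.
  by move=> x; rewrite lee_fin mulr_ge0 ?sqnorm_ge0// !mulr_ge0// exprn_ge0.
congr (_ * _)%E; apply: eq_esum => i _; apply: eq_esum => l _ /=.
rewrite /commutator_form -sqnormE; last by apply: commutator_square_summable => //; exact: slice_symmetric.
have -> : fourth_coef R p q k = (k`! ^ 2)%:R * 'C(q, k)%:R ^+ 2 * 'C(p, k)%:R ^+ 2 * (p - k + (q - k))`!%:R.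
  by rewrite /fourth_coef natrM (natrM _ (k`! ^ 2 * 'C(q, k) ^ 2)%N) (natrM _ (k`! ^ 2)%N) !natrX.
rewrite -EFinM; congr EFin; congr (_ * _ * _).
by congr (_ `!%:R); lia.
Qed.

(** The remainder lives in the extended reals; its finiteness, part of the conclusion, makes the
    equality one between real numbers. *)
Theorem theorem1 (R : realType) (H : completeNormedModType R)
    (ip : H -> H -> R) (e : nat -> H)
    (d : measure_display) (T : measurableType d) (P : probability T R)
    (W : H -> {RV P >-> R})
    (I : forall n : nat, tensor R n -> {RV P >-> R})
    (ip_inner : inner_product ip)
    (e_basis : complete_orthonormal_system ip e)
    (W_isonormal : isonormal ip W)
    (W_generates : generated_by W)
    (I_integral : forall n : nat, multiple_integral ip e W (I n))
    (n m : nat) (n_ge1 : (1 <= n)%N) (m_ge1 : (1 <= m)%N)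
    (f : tensor R n) (g : tensor R m)
    (f_sym : symmetric_tensor f) (g_sym : symmetric_tensor g) :
  ('E_P[fun w => \det (malliavin_matrix ip W (I n f) (I m g) w)] =
   (\sum_(0 <= r < (minn n.-1 m.-1).+1)
      (m * n)%:R * m`!%:R * n`!%:R * 'C(n.-1, r)%:R * 'C(m.-1, r)%:R *
      (sqnorm (tensor_contraction r f g) - sqnorm (tensor_contraction r.+1 f g)))%R%:E
   + remainder f g)%E /\
  (0 <= remainder f g < +oo)%E.
Proof.
(* Orders are written [p.+1] and [q.+1], so that slices have orders [p] and [q]. *)
case: n n_ge1 f f_sym => // p _ f f_sym; case: m m_ge1 g g_sym => // q _ g g_sym.
rewrite -[p.+1.-1]/p -[q.+1.-1]/q.
have kpq k : (k <= minn p q)%N -> (k <= p)%N /\ (k <= q)%N by rewrite leq_min => /andP.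
have TE k : (k <= minn p q)%N ->
    T_ f g k = (2^-1 * fine (double_sum (commutator_form k (fourth_coef R p q k)) f g))%:E.
  move=> /kpq[kp kq]; rewrite (T_double_sum kp kq f_sym g_sym) EFinM.
  by rewrite (commutator_form_fine kp kq (fourth_coef_ge0 R p q k) f_sym g_sym).
have T0 k : (k <= minn p q)%N -> 0 <= 2^-1 * fine (double_sum (commutator_form k (fourth_coef R p q k)) f g).
  move=> _; rewrite mulr_ge0// ?invr_ge0// fine_ge0// double_sum_ge0// => *.
  by rewrite mule_ge0 ?tnorm2_ge0// lee_fin fourth_coef_ge0.
have remE : remainder f g = (\sum_(1 <= k < (minn p q).+1)
    2^-1 * fine (double_sum (commutator_form k (fourth_coef R p q k)) f g))%:E.
  rewrite /remainder -sumEFin big_nat [RHS]big_nat; apply: eq_bigr => k /andP[_ kl].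
  by rewrite TE.
split; last first.
  rewrite remE ltry andbT lee_fin big_nat sumr_ge0// => k /andP[_ kl]; exact: T0.
rewrite (expected_det ip_inner e_basis W_isonormal I_integral W_generates f_sym g_sym).
rewrite (wick_identity ip_inner e_basis W_isonormal I_integral f_sym g_sym).
transitivity ((\sum_(0 <= k < (minn p q).+1) 2^-1 * fine (double_sum (commutator_form k (fourth_coef R p q k)) f g))%:E).
  rewrite (_ : (\sum_(k < (minn p q).+1) double_sum (commutator_form k (fourth_coef R p q k)) f g =
      (\sum_(k < (minn p q).+1) fine (double_sum (commutator_form k (fourth_coef R p q k)) f g))%:E)%E).
    by rewrite -EFinM mulr_sumr -(big_mkord xpredT (fun k => 2^-1 * fine (double_sum (commutator_form k (fourth_coef R p q k)) f g))).
  rewrite -sumEFin; apply: eq_bigr => k _; have [kp kq] := kpq k (ltn_ord k).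
  by rewrite (commutator_form_fine kp kq (fourth_coef_ge0 R p q k) f_sym g_sym).
(* The index [k = 0] is split off and evaluated by [zero_identity]; the indices from 1 on form the
   remainder. *)
rewrite remE -EFinD; congr EFin; rewrite big_ltn//; congr (_ + _).
by rewrite (zero_identity ip_inner e_basis W_isonormal f_sym g_sym) big_mkord.
Qed.
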